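(* Let $(M,T,\mu)$ be a conservative ergodic infinite ($\sigma$-finite) measure preserving dynamical system, $\tau:M\to(0,+\infty)$ measurable with $0<\inf_M\tau\le\sup_M\tau<\infty$, and $(\mathcal M,(\varphi_t)_t,\nu)$ the suspension flow over $(M,T,\mu)$ with roof function $\tau$. Let $f:\mathbb R\times\mathcal M\to\mathbb R^d$ be measurable, bounded and uniformly Lipschitz in its first coordinate, and let $F(y,\omega):=\int_0^{\tau(\omega)}f(y,(\omega,s))\,ds$ for $(y,\omega)\in\mathbb R\times M$. Let $\overline\tau>0$, let $\overline\mu$ be a probability measure on $M$ absolutely continuous with respect to $\mu$ and let $(\mathfrak a_\epsilon)_{\epsilon>0}$ be positive numbers with $\lim_{\epsilon\to0}\mathfrak a_\epsilon=0$ and $\lim_{\epsilon\to0}\epsilon/\mathfrak a_\epsilon=0$. Assume that: (a) the functions $F(\cdot,\omega)$ are twice differentiable, uniformly bounded and with uniformly bounded derivatives of first and second orders; (b) the family of processes $v_t^\epsilon:=\mathfrak a_\epsilon\int_0^{t/\epsilon}F(\overline\tau\epsilon s,T^{\lfloor s\rfloor}(\cdot))\,ds$ converges in distribution, as $\epsilon\to0$, to a process $(v_t)_{t\ge0}$ (with respect to $\overline\mu$ in $\mathcal C([0,S'])$ for all $S'>0$), and the family $\dot v_t^\epsilon:=\mathfrak a_\epsilon\int_0^{t/\epsilon}D_1F(\overline\tau\epsilon s,T^{\lfloor s\rfloor}(\cdot))\,ds$ is tight (with respect to $\overline\mu$ in $\mathcal C([0,S'])$ for all $S'>0$); (c) for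 all $S'>0$, $(\epsilon n_{t/\epsilon})_{t\in[0,S']}$ converges in probability with respect to $\overline\mu$ to $(t/\overline\tau)_{t\in[0,S']}$ for the uniform metric, as $\epsilon\to0$; (d) the processes $z_t^\epsilon:=\sqrt{\epsilon\,\mathfrak a_\epsilon}\int_0^{t/\epsilon}(\tau\circ T^{\lfloor s\rfloor}-\overline\tau)\,ds$ converge in distribution to $0$ with respect to $\overline\mu$, for the uniform topology on $\mathcal C([0,S'])$ for all $S'>0$, as $\epsilon\to0$. Then the renormalized perturbed ergodic integral $$u_t^\epsilon(\omega):=\mathfrak a_\epsilon\int_0^{t/\epsilon}f(\epsilon s,\varphi_s(\omega))\,ds,\qquad\omega\in\mathcal M,$$ satisfies, for every $S>0$, $$(u_t^\epsilon)_{t\in[0,S]}\longrightarrow(v_{t/\overline\tau})_{t\in[0,S]}\qquad(\epsilon\to0)$$ strongly in distribution with respect to $\nu$, for the uniform norm.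
   Context: Suspension flow: $\mathcal M=\{(y,s)\in M\times[0,+\infty): 0\le s<\tau(y)\}$, $\nu=\mu\otimes\mathrm{Leb}$ restricted to $\mathcal M$, and $\varphi_t(y,s)=\big(T^{n_{t+s}(y)}(y),\,t+s-t_{n_{t+s}(y)}(y)\big)$ where $t_m(y)=\sum_{k=0}^{m-1}\tau(T^ky)$ and $n_t(y)=\sup\{n\in\mathbb N: t_n(y)\le t\}$. $D_1F$ is the derivative of $F$ in its first coordinate. Strong convergence in distribution with respect to $\nu$ means convergence in distribution with respect to every probability measure absolutely continuous with respect to $\nu$. *)

(* Defs.v *)
From HB Require Import structures.
From mathcomp Require Export all_boot all_order all_algebra.
From mathcomp Require Export all_classical all_reals all_analysis.
From mathcomp Require Export measurable_realfun.
Export Order.TTheory GRing.Theory Num.Theory.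
Export numFieldNormedType.Exports.

Set Implicit Arguments.
Unset Strict Implicit.
Unset Printing Implicit Defensive.

Global Open Scope classical_set_scope.
Global Open Scope ring_scope.

Definition measure_preserving d (M : measurableType d) (R : realType)
    (mu : set M -> \bar R) (T : M -> M) :=
  measurable_fun setT T /\
  forall A, measurable A -> mu (T @^-1` A) = mu A.

Definition wandering_set (M : Type) (T : M -> M) (W : set M) :=
  trivIset setT (fun n : nat => iter n T @^-1` W).

Definition conservative d (M : measurableType d) (R : realType)
    (mu : set M -> \bar R) (T : M -> M) :=
  forall W, measurable W -> wandering_set T W -> mu W = 0%E.

Definition ergodic d (M : measurableType d) (R : realType)
    (mu : set M -> \bar R) (T : M -> M) :=
  forall A, measurable A -> T @^-1` A = A -> mu A = 0%E \/ mu (~` A) = 0%E.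

Section suspension.
Context d (M : measurableType d) (R : realType).
Variables (T : M -> M) (tau : M -> R).

Definition suspension_space : set (M * R) :=
  [set p | 0 <= p.2 /\ p.2 < tau p.1].

Lemma measurable_suspension_space :
  measurable_fun setT tau -> measurable suspension_space.
Proof.
move=> mtau.
have mfst : measurable_fun setT (fun p : M * R => tau p.1).
  by apply: measurableT_comp => //; exact: measurable_fst.
have msnd : measurable_fun setT (fun p : M * R => p.2).
  exact: measurable_snd.
have mlt := measurable_fun_ltr msnd mfst.
have := measurableI _ _ (msnd measurableT _ (measurable_itv `[0, +oo[))
                        (mlt measurableT [set true] I).
rewrite !setTI; congr measurable; apply/seteqP.
by split=> -[y s] /=; rewrite in_itv/= andbT => -[].
Qed.

Definition suspension_measure (mu : {measure set M -> \bar R})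
    (mtau : measurable_fun setT tau) : set (M * R) -> \bar R :=
  mrestr (mu \x (@lebesgue_measure R))%E (measurable_suspension_space mtau).

Definition return_time (m : nat) (y : M) : R :=
  \sum_(0 <= k < m) tau (iter k T y).

(* [0] is the default value of [supremum] on empty or unbounded sets, which do
   not occur when [0 <= t] and [tau] is bounded away from [0]. *)
Definition return_count (t : R) (y : M) : nat :=
  supremum 0%N [set n : nat | return_time n y <= t].

Definition suspension_flow (t : R) (p : M * R) : M * R :=
  let n := return_count (t + p.2) p.1 in
  (iter n T p.1, t + p.2 - return_time n p.1).

End suspension.

Definition vintegral (R : realType) (n : nat) (A : set R)
    (g : R -> 'rV[R]_n) : 'rV[R]_n :=
  \row_i \int[@lebesgue_measure R]_(s in A) g s 0 i.

Definition D1 (R : realType) (n : nat) (M : Type) (F : R -> M -> 'rV[R]_n) :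
    R -> M -> 'rV[R]_n :=
  fun y w => derive1 (fun z => F z w) y.

Definition twice_differentiable1 (R : realType) (n : nat) (M : Type)
    (F : R -> M -> 'rV[R]_n) :=
  forall w y, derivable (fun z => F z w) y 1 /\
              derivable (fun z => D1 F z w) y 1.

Definition uniformly_bounded (R : realType) (n : nat) (M : Type)
    (F : R -> M -> 'rV[R]_n) :=
  exists K : R, forall y w, `|F y w| <= K.

(* A path is a function on all of [R], of which only the restriction to
[[0, S]] matters: [{uniform `[0, S] -> V}] carries the topology of uniform
convergence on [[0, S]], so that C([0, S], V) is the set [Cpath S] modulo
equality on [[0, S]]. *)

Section processes.
Context (R : realType) (V : uniformType).

Definition Cpath (S : R) : set {uniform` `[0, S] -> V} :=
  [set x : R -> V | {within `[0, S], continuous x}].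

Definition bounded_continuous_functional (S : R)
    (Phi : {uniform` `[0, S] -> V} -> R) :=
  {within @Cpath S, continuous Phi} /\
  exists K : R, forall x, @Cpath S x -> `|Phi x| <= K.

(* Convergence in distribution in C([0, S], V), as epsilon tends to 0+, of the
   processes [X eps], defined on the subset [D] of full [P]-measure, to the
   process [Y], defined on the probability space ([Om], [Q]). *)
Definition cvg_in_distribution d d' (Om : measurableType d)
    (Om' : measurableType d') (P : probability Om R) (D : set Om)
    (X : R -> Om -> R -> V) (Q : probability Om' R) (Y : Om' -> R -> V)
    (S : R) :=
  forall Phi : {uniform` `[0, S] -> V} -> R,
    bounded_continuous_functional Phi ->
    (\int[P]_(w in D) (Phi (X eps w))%:E)%E @[eps --> 0^'+] -->
      (\int[Q]_w (Phi (Y w))%:E)%E.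

(* [closed K] is automatic in the Hausdorff space C([0, S], V); here it makes
   [K] saturated for equality on [[0, S]]. *)
Definition tight d (Om : measurableType d) (P : probability Om R)
    (X : R -> Om -> R -> V) (S : R) :=
  forall eta : R, 0 < eta ->
    exists K : set {uniform` `[0, S] -> V},
      [/\ compact K, closed K, K `<=` @Cpath S &
          forall eps, 0 < eps -> (P [set w | ~ K (X eps w)] <= eta%:E)%E].

End processes.

Definition strong_cvg_in_distribution (R : realType) (V : uniformType)
    d d' (Om : measurableType d) (Om' : measurableType d')
    (nu : set Om -> \bar R) (D : set Om) (X : R -> Om -> R -> V)
    (Q : probability Om' R) (Y : Om' -> R -> V) (S : R) :=
  forall P : probability Om R, P `<< nu ->
    cvg_in_distribution P D X Q Y S.

Definition uniform_dist (R : realType) (S : R) (x y : R -> R) : \bar R :=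
  ereal_sup [set (`|x t - y t|)%:E | t in `[0, S]].

Definition cvg_in_probability_unif (R : realType) d (Om : measurableType d)
    (P : probability Om R) (X : R -> Om -> R -> R) (y : R -> R) (S : R) :=
  forall eta : R, 0 < eta ->
    P [set w | (eta%:E < uniform_dist S (X eps w) y)%E] @[eps --> 0^'+] -->
      0%E.

Definition continuous_process (R : realType) (n : nat) d
    (Om : measurableType d) (v : Om -> R -> 'rV[R]_n) :=
  (forall t i, 0 <= t -> measurable_fun setT (fun w => v w t 0 i)) /\
  (forall w, {within `[0, +oo[, continuous (v w)}).

Section renormalized_processes.
Context d (M : measurableType d) (R : realType) (n : nat).
Variables (T : M -> M) (tau : M -> R) (taubar : R) (a : R -> R).

(* f is only meaningful on the suspension space, hence the half-open
   interval. *)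
Definition roof_integral (f : R -> M * R -> 'rV[R]_n) (y : R) (w : M) :
    'rV[R]_n :=
  vintegral `[0, tau w[ (fun s => f y (w, s)).

Definition slow_process (F : R -> M -> 'rV[R]_n) (eps : R) (w : M) (t : R) :
    'rV[R]_n :=
  a eps *: vintegral `[0, t / eps]
    (fun s => F (taubar * eps * s) (iter (Num.truncn s) T w)).

Definition roof_process (eps : R) (w : M) (t : R) : R :=
  Num.sqrt (eps * a eps) *
  \int[@lebesgue_measure R]_(s in `[0, t / eps])
    (tau (iter (Num.truncn s) T w) - taubar).

Definition flow_process (f : R -> M * R -> 'rV[R]_n) (eps : R) (p : M * R)
    (t : R) : 'rV[R]_n :=
  a eps *: vintegral `[0, t / eps]
    (fun s => f (eps * s) (suspension_flow T tau s p)).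

End renormalized_processes.

(* Main.v *)
Require Import Defs.
From mathcomp Require Import ring lra.
Set Implicit Arguments.
Unset Strict Implicit.
Unset Printing Implicit Defensive.

(** The theorem holds because the flow integral is, up to a vanishing error, a
time-changed ergodic sum over the base, and because for ergodic systems a limit
in distribution does not depend on the absolutely continuous initial law.

Averaging along one orbit ([flow_slow_close]). Cutting the time interval at the
return times [t_k], the integral [u^eps_t] starting from [(w, 0)] is, up to
[O(a eps)], the sum of the [a eps * F(eps t_k, T^k w)] over the returns before
time [t / eps]. The process [v^eps] involves [F(eps k taubar, T^k w)] instead.
Write [e_k = t_k - k taubar]. The second-order error in the Taylor formula is
[a eps * eps^2 e_k^2] at each of [O(1 / eps)] steps, and is small because
[sqrt(eps * a eps) e_k] tends to zero. The first-order error is the sum of the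
products of [eps e_k] with the increments of the derivative process. Replacing
this process by its averages over windows of macroscopic length [delta], and
summing by parts ([smoothed_sum_le]), one sees that it is of the order of the
oscillation of the process at scale [delta], which is small by tightness
([tight_equicontinuous]); here [eps e_k] is small because [eps / a eps] tends
to zero. The same smallness shows that the number of returns before time
[t / eps] is close to [t / (eps taubar)], and [v^eps] is asymptotically
equicontinuous since it converges in distribution
([cvg_in_distribution_equicontinuous]). Hence [u^eps] started at height [0] is
uniformly close in probability to [v^eps] at time [t / taubar]
([flow_slow_close_in_probability]).

From one law to all laws. A Lipschitz functional of [u^eps] changes by
[O(a eps)] when the starting point moves along its fibre or from [(w, 0)] to
[(T w, 0)] ([flow_process_height], [flow_process_base]). It is therefore a
function of the base point that is asymptotically invariant, uniformly. If its
means under two absolutely continuous laws had different limits, convex sets of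
almost invariant observables would separate them at all scales; elements of
almost minimal quadratic norm in these sets converge almost everywhere to an
invariant, hence constant, function, a contradiction
([almost_invariant_observables_empty], [asymptotically_invariant_means]).

Lipschitz functionals suffice, since a bounded continuous functional is the
increasing limit of its Lipschitz minorants
([lipschitz_cvg_in_distribution]). All expectations are meaningful because
open sets of paths define events ([measurable_path_open]). *)

(** * Paths and the uniform distance *)

Section path_space.
Context (R : realType) (V : normedModType R).
Local Notation Cpath S := (@Defs.Cpath R V S).
Implicit Types (S e r eta delta L s t : R) (x y z : R -> V).

Definition path_close S r x y := forall t : R, 0 <= t <= S -> `|x t - y t| <= r.

Lemma path_close_sym S r x y : path_close S r x y -> path_close S r y x.
Proof. by move=> xy t tS; rewrite distrC; exact: xy. Qed.

Lemma path_close_trans S r r' x y z :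
  path_close S r x y -> path_close S r' y z -> path_close S (r + r') x z.
Proof.
move=> xy yz t tS.
by rewrite (le_trans (ler_distD (y t) _ _))// lerD// ?xy// yz.
Qed.

Lemma nbhs_path S x (U : set (R -> V)) :
  nbhs (x : {uniform` `[0, S] -> V}) U <->
  exists2 e : R, 0 < e & forall y, path_close S e x y -> U y.
Proof.
split=> [/uniform_nbhs[E [entE EU]]|[e e0 eU]].
  have [e /= e0 eE] : exists2 e : R, 0 < e &
      [set xy : V * V | ball xy.1 e xy.2] `<=` E.
    by move: entE; rewrite -entourage_ballE => -[e ? ?]; exists e.
  exists (e / 2) => [|y xy]; first by rewrite divr_gt0.
  apply: EU => t; rewrite /= in_itv/= => tS; apply: eE.
  by rewrite /= -ball_normE /= (le_lt_trans (xy t tS))//; lra.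
apply/uniform_nbhs; exists [set xy : V * V | ball xy.1 e xy.2]; split.
  by rewrite -entourage_ballE; exists e.
move=> y xy; apply: eU => t tS.
have := xy t; rewrite /= in_itv/= => /(_ tS).
by rewrite -ball_normE => /ltW.
Qed.

Lemma within_path (U : normedModType R) S (A : set {uniform` `[0, S] -> V})
    (Phi : {uniform` `[0, S] -> V} -> U) :
  {within A, continuous Phi} <->
  (forall x, A x -> forall eta : R, 0 < eta -> exists2 e : R, 0 < e &
     forall y, A y -> path_close S e x y -> `|Phi x - Phi y| <= eta).
Proof.
split=> [|H].
  move=> /(@subspace_continuousP _ A _ Phi) H x Ax eta eta0.
  have := H x Ax (ball (Phi x) eta) (nbhsx_ballx _ _ eta0).
  rewrite /= => /nbhs_path[e e0 He]; exists e => // y Ay /He /(_ Ay) /=.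
  by rewrite -ball_normE => /ltW.
apply/(@subspace_continuousP _ A _ Phi) => x Ax.
apply/cvgrPdist_le => eta eta0; have [e e0 He] := H x Ax eta eta0.
apply/nbhs_path; exists e => // y xy Ay; exact: He.
Qed.

Lemma CpathP S x : Cpath S x <->
  forall t : R, 0 <= t <= S -> forall eta : R, 0 < eta -> exists2 e : R, 0 < e &
     forall s : R, 0 <= s <= S -> `|t - s| < e -> `|x t - x s| <= eta.
Proof.
have inS t : `[0, S]%classic t = (0 <= t <= S) :> Prop by rewrite /= in_itv.
split=> [/(@subspace_continuousP _ `[0, S]%classic _ x) H t tS eta eta0|H].
  have := H t; rewrite inS => /(_ tS) /cvgrPdist_le/(_ eta eta0).
  move=> /nbhs_ballP[e /= e0 He]; exists e => // s sS ts.
  by apply: He; rewrite ?inS// -ball_normE.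
apply/(@subspace_continuousP _ `[0, S]%classic _ x) => t; rewrite inS => tS.
apply/cvgrPdist_le => eta eta0; have [e e0 He] := H t tS eta eta0.
apply/nbhs_ballP; exists e => //= s; rewrite -ball_normE/= => ts.
by rewrite in_itv/= => sS; exact: He.
Qed.

Lemma lipschitz_Cpath S L x :
  (forall s t : R, 0 <= s <= S -> 0 <= t <= S -> s <= t ->
     `|x s - x t| <= L * (t - s)) -> Cpath S x.
Proof.
move=> xL; apply/CpathP => t tS eta eta0.
have L0 : 0 < `|L| + 1 by rewrite ltr_wpDl.
exists (eta / (`|L| + 1)) => [|s sS ts]; first by rewrite divr_gt0.
have : `|x t - x s| <= `|L| * `|t - s|.
  wlog st : s t tS sS {ts} / s <= t => [th|].
    by have [st|/ltW ts'] := leP s t; [exact: th|rewrite distrC (distrC t) th].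
  rewrite distrC (le_trans (xL _ _ sS tS st))//.
  by rewrite [`|t - s|]ger0_norm ?subr_ge0// ler_wpM2r ?subr_ge0// ler_norm.
move=> /le_trans; apply; rewrite ltr_pdivlMr// in ts.
by rewrite (le_trans _ (ltW ts))// mulrC ler_wpM2l// lerDl.
Qed.

(** Easy half of the theorem of Ascoli. Each path of [K] is uniformly continuous
on the compact [[0, S]], and paths uniformly close to it have almost the same
oscillations at a given scale; compactness of [K] then gives one scale
for all its paths. *)
Lemma compact_equicontinuous S (K : set {uniform` `[0, S] -> V}) eta :
  0 < eta -> compact K -> K `<=` Cpath S ->
  exists2 delta : R, 0 < delta & forall x, K x -> forall s t : R,
    0 <= s <= S -> 0 <= t <= S -> `|s - t| <= delta -> `|x s - x t| <= eta.
Proof.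
move=> eta0 cK KC.
have near1 x : Cpath S x -> \forall e \near (0 : R)^'+, forall s t : R,
    0 <= s <= S -> 0 <= t <= S -> `|s - t| <= e -> `|x s - x t| <= eta / 2.
  move=> /CpathP xC.
  have := @segment_compact R 0 S.
  move=> /compact_near_coveringP/(_ _ (0 : R)^'+
    (fun e s => 0 <= s <= S -> forall t : R, 0 <= t <= S -> `|s - t| <= e ->
       `|x s - x t| <= eta / 2)).
  move=> H; have : \forall e \near (0 : R)^'+, `[0, S]%classic `<=`
      (fun s => 0 <= s <= S -> forall t : R, 0 <= t <= S -> `|s - t| <= e ->
       `|x s - x t| <= eta / 2).
    apply: H => s; rewrite /= in_itv/= => sS.
    have [e e0 He] := xC s sS (eta / 4) ltac:(lra).
    near=> s' e' => /= s'S t tS st.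
    have ss' : `|s - s'| < e / 2.
      near: s'; apply/nbhs_ballP; exists (e/2) => /=; first lra.
      by move=> u; rewrite -ball_normE.
    have e'e : e' < e / 2 by near: e'; apply: nbhs_right_lt; lra.
    rewrite (le_trans (ler_distD (x s) _ _))//.
    have := He s' s'S ltac:(lra).
    have := He t tS.
    have : `|s - t| < e.
      rewrite (le_lt_trans (ler_distD s' _ _))//; lra.
    move=> -> // => /(_ isT); rewrite (distrC (x s')); lra.
  apply: filterS => e eS s t sS; apply: eS => //.
have := cK => /compact_near_coveringP/(_ _ (0 : R)^'+
    (fun e x => forall s t : R, 0 <= s <= S -> 0 <= t <= S -> `|s - t| <= e ->
       `|x s - x t| <= eta)) H.
have : \forall e \near (0 : R)^'+, K `<=`
    (fun x => forall s t : R, 0 <= s <= S -> 0 <= t <= S -> `|s - t| <= e ->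
       `|x s - x t| <= eta).
  apply: H => x Kx.
  have xx : \forall x' \near x, path_close S (eta / 4) x x'.
    by apply/nbhs_path; exists (eta / 4) => //; lra.
  exists ((fun x' => path_close S (eta / 4) x x'),
     (fun e => forall s t : R, 0 <= s <= S -> 0 <= t <= S -> `|s - t| <= e ->
       `|x s - x t| <= eta / 2)).
    by split=> //; exact/near1/KC.
  move=> [x' e] /= [xx' He] s t sS tS st.
  have h1 := xx' s sS; have h2 := xx' t tS; have h3 := He s t sS tS st.
  rewrite (le_trans (ler_distD (x s) _ _))// (distrC (x' s)).
  have := ler_distD (x t) (x s) (x' t); lra.
move=> He; have : \forall e \near (0:R)^'+, 0 < e /\ K `<=`
    (fun x => forall s t : R, 0 <= s <= S -> 0 <= t <= S -> `|s - t| <= e ->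
       `|x s - x t| <= eta).
  by near=> e; split; [near: e; exact: nbhs_right_gt|near: e].
by move=> /filter_ex[e [e0 eK]]; exists e => // x Kx s t; exact: eK.
Unshelve. all: by end_near. Qed.

End path_space.

(** * Oscillation of paths, and events on random paths *)

Section oscillation.
Context (R : realType) (V : normedModType R).
Implicit Types (S r eta : R) (x y : R -> V) (J : set (R * R)).

Lemma Cpath_uniformly_continuous S x eta : 0 < eta -> @Cpath R V S x ->
  exists2 delta : R, 0 < delta & forall s t : R,
    0 <= s <= S -> 0 <= t <= S -> `|s - t| <= delta -> `|x s - x t| <= eta.
Proof.
move=> eta0 xC.
have [delta d0 xd] := @compact_equicontinuous R V S [set x] eta eta0
  (@compact_set1 _ _) ltac:(by move=> ? ->).
by exists delta => //; exact: xd.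
Qed.

(** The increments are truncated at [1], so that the supremum exists for all
functions and the oscillation is a bounded functional. *)
Definition oscillation J x : R :=
  sup [set Num.min 1 `|x st.1 - x st.2| | st in J].

Let osc_ubound J x : has_ubound [set Num.min 1 `|x st.1 - x st.2| | st in J].
Proof. by exists 1 => _ [st _ <-]; rewrite ge_min lexx. Qed.

Lemma oscillation_le J x r : J !=set0 ->
  (forall st, J st -> `|x st.1 - x st.2| <= r) -> oscillation J x <= r.
Proof.
move=> [st Jst] xr; apply: ge_sup; first by exists (Num.min 1 `|x st.1 - x st.2|), st.
by move=> _ [st' Jst' <-]; rewrite ge_min xr// orbT.
Qed.

Lemma oscillation_le1 J x : J !=set0 -> oscillation J x <= 1.
Proof.
move=> [st Jst]; apply: ge_sup; first by exists (Num.min 1 `|x st.1 - x st.2|), st.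
by move=> _ [st' Jst' <-]; rewrite ge_min lexx.
Qed.

Lemma oscillation_ge0 J x : J !=set0 -> 0 <= oscillation J x.
Proof.
move=> [st Jst]; apply: (@le_trans _ _ (Num.min 1 `|x st.1 - x st.2|)).
  by rewrite le_min ler01 normr_ge0.
by apply: ub_le_sup => //; exists st.
Qed.

Lemma oscillation_lt J x r st : r <= 1 -> oscillation J x < r -> J st ->
  `|x st.1 - x st.2| <= r.
Proof.
move=> r1 xr Jst; rewrite leNgt; apply/negP => rx.
move: xr; rewrite ltNge => /negP; apply.
apply: (@le_trans _ _ (Num.min 1 `|x st.1 - x st.2|)).
  by rewrite le_min r1 ltW.
by apply: ub_le_sup => //; exists st.
Qed.

Lemma oscillation_close J S r x y : 0 <= r -> J !=set0 ->
  (forall st, J st -> 0 <= st.1 <= S /\ 0 <= st.2 <= S) ->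
  path_close S r x y -> oscillation J y <= oscillation J x + 2 * r.
Proof.
move=> r0 J0 JS xy; apply: ge_sup.
  by move: J0 => [st Jst]; exists (Num.min 1 `|y st.1 - y st.2|), st.
move=> _ [st Jst <-]; have [s1 s2] := JS _ Jst.
apply: (@le_trans _ _ (Num.min 1 `|x st.1 - x st.2| + 2 * r)); last first.
  by rewrite lerD2r; apply: ub_le_sup => //; exists st.
have h1 := xy _ s1; have h2 := xy _ s2.
have h3 := ler_distD (x st.1) (y st.1) (y st.2).
have h4 := ler_distD (x st.2) (x st.1) (y st.2).
rewrite (distrC (y st.1) (x st.1)) in h3.
rewrite ge_min; apply/orP.
by case: (leP 1 `|x st.1 - x st.2|) => _; [left; lra|right; lra].
Qed.

Lemma oscillation_bounded_continuous J S : J !=set0 ->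
  (forall st, J st -> 0 <= st.1 <= S /\ 0 <= st.2 <= S) ->
  @bounded_continuous_functional R V S (oscillation J).
Proof.
move=> J0 JS; split; last first.
  exists 1 => x _; rewrite ger0_norm; [exact: oscillation_le1|].
  exact: oscillation_ge0.
apply/(@within_path _ V R^o) => x _ eta eta0.
exists (eta / 2) => [|y _ xy]; first by lra.
have h1 := oscillation_close (ltac:(lra) : 0 <= eta / 2) J0 JS xy.
have h2 := oscillation_close (ltac:(lra) : 0 <= eta / 2) J0 JS
  (path_close_sym xy).
by rewrite ler_norml; lra.
Qed.

End oscillation.

Section measurable_process.
Context (R : realType) (V : normedModType R).
Context d (Om : measurableType d).

Section coordinates.
Variables (m : nat) (coor : 'I_m -> V -> R).
Hypothesis coorP : forall x y (r : R), 0 <= r ->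
  `|x - y| <= r <-> forall i, `|coor i x - coor i y| <= r.
Variables (S : R) (S_gt0 : 0 < S).

Let mesh n (j : 'I_n.+2) : R := S * j%:R / n.+1%:R.

Let code n (x : R -> V) : {ffun 'I_n.+2 * 'I_m -> int} :=
  [ffun p => Num.floor (n.+1%:R * coor p.2 (x (mesh p.1)))].

Let coded n (eta : R) (c : {ffun 'I_n.+2 * 'I_m -> int}) (x : R -> V) :=
  forall (t : R) (j : 'I_n.+2) i, 0 <= t <= S ->
    S * j%:R / n.+1%:R <= t < S * j.+1%:R / n.+1%:R ->
    `|coor i (x t) - (c (j, i))%:~R / n.+1%:R| <= eta.

Let mesh_ex n (t : R) : 0 <= t <= S -> exists j : 'I_n.+2,
  S * j%:R / n.+1%:R <= t < S * j.+1%:R / n.+1%:R.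
Proof.
move=> /andP[t0 tS].
have n0 : 0 < n.+1%:R :> R by rewrite ltr0n.
have q0 : 0 <= t * n.+1%:R / S by rewrite divr_ge0 ?mulr_ge0// ltW.
have /andP[q1 q2] := truncn_itv q0.
have jn : (Num.truncn (t * n.+1%:R / S) < n.+2)%N.
  rewrite ltnS -(@ler_nat R) (le_trans q1)// ler_pdivrMr// mulrC.
  by rewrite ler_wpM2l.
exists (Ordinal jn) => /=; apply/andP; split.
  by rewrite ler_pdivrMr// mulrC -ler_pdivlMr.
by rewrite ltr_pdivlMr// mulrC [S * _]mulrC -ltr_pdivrMr// mulrC.
Qed.

Let code_coded x (eta : R) : 0 < eta -> @Cpath R V S x ->
  exists N, forall n, (N <= n)%N -> coded eta (code n x) x.
Proof.
move=> eta0 xC.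
have [delta d0 xd] := Cpath_uniformly_continuous (divr_gt0 eta0 (ltr0Sn R 1)) xC.
pose N := Num.truncn (Num.max (S / delta) (2 / eta)).
exists N => n Nn t j i tS /andP[jt tj].
have n0 : 0 < n.+1%:R :> R by rewrite ltr0n.
have : Num.max (S / delta) (2 / eta) < n.+1%:R.
  by rewrite (lt_le_trans (truncnS_gt _))// ler_nat ltnS.
rewrite gt_max ltr_pdivrMr// [2 / eta < _]ltr_pdivrMr// => /andP[Sd neta].
have mS : 0 <= mesh j <= S.
  rewrite /mesh divr_ge0 ?mulr_ge0 ?(ltW S_gt0)//=.
  by rewrite (le_trans jt)//; case/andP: tS.
have tm : `|t - mesh j| <= delta.
  rewrite ger0_norm ?subr_ge0// /mesh lerBlDr.
  apply: (le_trans (ltW tj)); rewrite -natr1 mulrDr mulrDl addrC lerD2r mulr1.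
  by rewrite ler_pdivrMr//; lra.
have eta20 : 0 <= eta / 2 by lra.
have := (coorP (x t) (x (mesh j)) eta20).1 (xd _ _ tS mS tm) i.
rewrite ffunE /=; set u := coor i (x t); set v := coor i (x (mesh j)).
have /andP[f1 f2] := floor_itv (n.+1%:R * v).
have : `|v - (Num.floor (n.+1%:R * v))%:~R / n.+1%:R| <= eta / 2.
  rewrite ger0_norm ?subr_ge0; last by rewrite ler_pdivrMr//; lra.
  rewrite lerBlDr -lerBlDl ler_pdivlMr// mulrBl.
  rewrite intrD in f2; lra.
move=> h1 h2; have := ler_distD v u ((Num.floor (n.+1%:R * v))%:~R / n.+1%:R).
lra.
Qed.

(** Rounding the coordinates of the path at the points of a finite mesh gives a
code with countably many values, so that every event about the code is
measurable. An open event holds for the path if and only if, for some margin,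
it holds for all the continuous paths that follow the code within this margin,
as soon as the mesh is fine enough. *)
Lemma measurable_path_open (D : set Om) (X : Om -> R -> V)
    (U : set (R -> V)) :
  measurable D ->
  (forall (t : R) i, 0 <= t <= S -> measurable_fun D (fun w => coor i (X w t))) ->
  (forall w, D w -> @Cpath R V S (X w)) ->
  (forall x, @Cpath R V S x -> U x -> exists2 e : R, 0 < e &
     forall y, @Cpath R V S y -> path_close S e x y -> U y) ->
  measurable (D `&` [set w | U (X w)]).
Proof.
move=> mD mX XC oU.
pose good n (eta : R) (c : {ffun 'I_n.+2 * 'I_m -> int}) :=
  forall y, @Cpath R V S y -> coded eta c y -> U y.
(* [k] is the margin [1 / (k + 1)], [N] the index from which the mesh is fine
   enough for the path at hand. *)
have -> : D `&` [set w | U (X w)] =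
    \bigcup_k \bigcup_N \bigcap_(n in [set n | (N <= n)%N])
      (D `&` [set w | good n k.+1%:R^-1 (code n (X w))]).
  apply/seteqP; split=> [w /= [Dw Uw]|w [k _ [N _ H]]].
    have [e e0 eU] := oU _ (XC w Dw) Uw.
    have e20 : 0 < e / 2 by lra.
    have [N HN] := code_coded e20 (XC w Dw).
    exists (Num.truncn (2 / e)) => //; exists N => // n /= Nn; split => // y yC yc.
    apply: (eU y yC) => t tS; apply/coorP; first exact: ltW.
    move=> i; have [j jt] := mesh_ex n tS.
    have h1 := yc t j i tS jt; have h2 := HN n Nn t j i tS jt.
    have : (Num.truncn (2 / e)).+1%:R^-1 <= e / 2 :> R.
      rewrite -[leRHS]invrK lef_pV2 ?posrE ?invr_gt0// invf_div.
      by rewrite ltW// truncnS_gt.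
    have h3 := ler_distD ((code n (X w) (j, i))%:~R / n.+1%:R)
      (coor i (X w t)) (coor i (y t)).
    rewrite distrC in h1.
    move=> h4; apply: (le_trans h3); apply: (le_trans (lerD h2 (le_trans h1 h4))).
    lra.
  have Dw : D w by have [] := H N (leqnn N).
  split=> //; have [N' HN'] := @code_coded (X w) k.+1%:R^-1 ltac:(by []) (XC w Dw).
  have [_ /=] := H (maxn N N') (leq_maxl _ _).
  by apply; [exact: XC|apply: HN'; exact: leq_maxr].
apply: bigcup_measurable => k _; apply: bigcup_measurable => N _.
apply: bigcap_measurable; first by exists N => /=.
move=> n _.
have -> : D `&` [set w | good n k.+1%:R^-1 (code n (X w))] =
    \bigcup_(c : {ffun 'I_n.+2 * 'I_m -> int})
      (if `[< good n k.+1%:R^-1 c >] then D `&` [set w | code n (X w) = c]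
       else set0).
  apply/seteqP; split=> [w [Dw gw]|w [c _]].
    exists (code n (X w)) => //; rewrite ifT//; exact/asboolP.
  by case: asboolP => // + [Dw /= wc]; rewrite -wc.
apply: countable_bigcupT_measurable; first exact: countableP.
move=> c; case: ifPn => // _.
have -> : D `&` [set w | code n (X w) = c] =
    \bigcap_(p : 'I_n.+2 * 'I_m)
      (D `&` (fun w => coor p.2 (X w (mesh p.1))) @^-1`
        `[(c p)%:~R / n.+1%:R, (c p + 1)%:~R / n.+1%:R[) `&` D.
  have n0 : 0 < n.+1%:R :> R by rewrite ltr0n.
  apply/seteqP; split=> [w [Dw wc]|w [H Dw]].
    split=> // p _; split=> //=; rewrite in_itv/= -wc ffunE.
    by rewrite ler_pdivrMr// ltr_pdivlMr// mulrC floor_itv.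
  split=> //=; apply/ffunP => p; rewrite ffunE.
  have [_ /=] := H p I; rewrite in_itv/= ler_pdivrMr// ltr_pdivlMr// mulrC.
  exact: floor_def.
apply: measurableI => //; apply: fin_bigcap_measurable => [|p _].
  exact: finite_finset.
apply: mX => //; rewrite /mesh divr_ge0 ?mulr_ge0 ?(ltW S_gt0)//=.
rewrite ler_pdivrMr ?ltr0n// ler_wpM2l ?(ltW S_gt0)// ler_nat.
by rewrite -ltnS ltn_ord.
Qed.

End coordinates.
End measurable_process.

(** * Bounded integrals, random paths and Lipschitz functionals *)

Section bounded_integral.
Context d (Om : measurableType d) (R : realType).
Variables (m : {measure set Om -> \bar R}) (D : set Om).
Hypotheses (mD : measurable D) (Dfin : (m D < +oo)%E).
Implicit Types (g h : Om -> R) (K : R).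

Lemma bounded_integrable g K : measurable_fun D g ->
  (forall w, D w -> `|g w| <= K) -> m.-integrable D (EFin \o g).
Proof.
move=> mg gK; apply: measurable_bounded_integrable => //.
exists K; split; first exact: num_real.
by move=> x Kx w /gK /le_trans; apply; exact: ltW.
Qed.

Lemma Rintegral_close g h K delta :
  measurable_fun D g -> measurable_fun D h ->
  (forall w, D w -> `|g w| <= K) -> (forall w, D w -> `|h w| <= K) ->
  (forall w, D w -> `|g w - h w| <= delta) ->
  `|\int[m]_(w in D) g w - \int[m]_(w in D) h w| <= delta * fine (m D).
Proof.
move=> mg mh gK hK gh; have ig := bounded_integrable mg gK.
have ih := bounded_integrable mh hK.
have mgh : measurable_fun D (fun w => g w - h w) by exact: measurable_funB.
have igh := bounded_integrable mgh gh.
rewrite -RintegralB// (le_trans (le_normr_Rintegral _ _))//.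
rewrite -Rintegral_cst//; apply: le_Rintegral => //.
  apply: (@bounded_integrable _ delta); first exact: measurableT_comp.
  by move=> w Dw; rewrite normr_id; exact: gh.
  by apply: (@bounded_integrable _ `|delta|) => //; exact: measurable_cst.
Qed.

Lemma normr_Rintegral_le g K : measurable_fun D g ->
  (forall w, D w -> `|g w| <= K) ->
  `|\int[m]_(w in D) g w| <= K * fine (m D).
Proof.
move=> mg gK.
have [->|/set0P[w Dw]] := eqVneq D set0.
  by rewrite Rintegral_set0 measure0 mulr0 normr0.
have K0 : 0 <= K by rewrite (le_trans _ (gK w Dw)).
have := @Rintegral_close g (cst 0) K K mg (measurable_cst _) gK.
rewrite Rintegral_cst// mul0r subr0; apply.
  by move=> *; rewrite normr0.
by move=> u Du; rewrite subr0 gK.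
Qed.

Lemma Rintegral_bounded_cvg (g_ : nat -> Om -> R) g K :
  (forall n, measurable_fun D (g_ n)) -> measurable_fun D g ->
  (forall n w, D w -> `|g_ n w| <= K) ->
  {ae m, forall w, D w -> g_ ^~ w @ \oo --> g w} ->
  (fun n => \int[m]_(w in D) g_ n w) @ \oo --> \int[m]_(w in D) g w.
Proof.
move=> mg_ mg gK gcvg; apply: fine_cvg.
have iK : m.-integrable D (EFin \o cst K).
  by apply: (@bounded_integrable _ `|K|) => //; exact: measurable_cst.
have [|||||ig _ H] := @dominated_convergence _ _ _ m D mD
  (fun n => EFin \o g_ n) (EFin \o g) (EFin \o cst K).
- by move=> n; exact/measurable_EFinP.
- exact/measurable_EFinP.
- by apply: filterS gcvg => w gw Dw; apply: cvg_EFin; [exact: nearW|exact: gw].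
- exact: iK.
- by apply: aeW => w n Dw; rewrite lee_fin gK.
rewrite fineK; first exact: H.
exact: integrable_fin_num ig.
Qed.

End bounded_integral.

Lemma EFin_Rintegral d (Om : measurableType d) (R : realType)
    (P : probability Om R) (D : set Om) (g : Om -> R) (K : R) :
  measurable D -> measurable_fun D g -> (forall w, D w -> `|g w| <= K) ->
  (\int[P]_(w in D) (g w)%:E)%E = (\int[P]_(w in D) g w)%:E.
Proof.
move=> mD mg gK; rewrite fineK//; apply: integrable_fin_num => //.
apply: bounded_integrable mg gK => //.
by rewrite (le_lt_trans (probability_le1 _ _))// ltry.
Qed.


Lemma probability_lty d (Om : measurableType d) (R : realType)
  (P : probability Om R) D : measurable D -> (P D < +oo)%E.
Proof. by move=> mD; rewrite (le_lt_trans (probability_le1 _ _))// ltry. Qed.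

Section random_paths.
Context (R : realType) (V : normedModType R).
Local Notation Cpath S := (@Defs.Cpath R V S).

Definition path_open S (U : set (R -> V)) :=
  forall x, Cpath S x -> U x -> exists2 e : R, 0 < e &
     forall y, Cpath S y -> path_close S e x y -> U y.

(** Only the relatively open sets of continuous paths have to define events:
this is what the expectations of continuous functionals and the probabilities
of closed sets of paths require. *)
Definition random_path d (Om : measurableType d) (D : set Om) S
    (X : Om -> R -> V) :=
  [/\ measurable D, forall w, D w -> Cpath S (X w) &
    forall U, path_open S U -> measurable (D `&` [set w | U (X w)])].

Definition lipschitz_functional S (Phi : (R -> V) -> R) :=
  exists K k : R, [/\ 0 <= K, 0 <= k, forall x, Cpath S x -> `|Phi x| <= K &
    forall x y (r : R), Cpath S x -> Cpath S y -> 0 <= r ->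
      path_close S r x y -> `|Phi x - Phi y| <= k * r].

Lemma lipschitz_functional_continuous S Phi : lipschitz_functional S Phi ->
  @bounded_continuous_functional R V S Phi.
Proof.
move=> [K [k [K0 k0 PhiK Phik]]]; split; last by exists K.
apply/(@within_path _ V R^o) => x xC eta eta0.
exists (eta / (k + 1)) => [|y yC xy]; first by rewrite divr_gt0// ltr_wpDl.
rewrite (le_trans (Phik _ _ (eta / (k + 1)) _ _ _ _))//.
  by rewrite divr_ge0 ?ltW// ltr_wpDl.
by rewrite mulrA ler_pdivrMr ?ltr_wpDl//; nra.
Qed.

Lemma random_path_functional d (Om : measurableType d) (D : set Om) S X Phi :
  random_path D S X -> @bounded_continuous_functional R V S Phi ->
  measurable_fun D (fun w => Phi (X w)).
Proof.
move=> [mD XC oX] [/(@within_path _ V R^o) cPhi _] _.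
apply: (measurability _ (RGenOInfty.measurableE R)) => //.
move=> /= _ [_ [c ->] <-].
have -> : D `&` (fun w => Phi (X w)) @^-1` `]c, +oo[%classic =
    D `&` [set w | [set x | c < Phi x] (X w)].
  by apply/seteqP; split=> w [Dw /=]; rewrite in_itv/= andbT.
apply: oX => x xC /= cx.
have [e e0 He] := cPhi x xC ((Phi x - c) / 2) ltac:(lra).
exists e => // y yC /(He y yC).
by rewrite ler_norml => /andP[]; lra.
Qed.

(** The inf-convolution of a bounded functional with [k] times the uniform
distance, which increases to the functional as [k] grows. *)
Definition lipschitz_minorant S (Phi : (R -> V) -> R) (k : R) x : R :=
  inf [set Phi yr.1 + k * yr.2 | yr in
        [set yr : (R -> V) * R | [/\ Cpath S yr.1, 0 <= yr.2 &
           path_close S yr.2 x yr.1]]].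

Section minorant.
Variables (S : R) (Phi : (R -> V) -> R) (K : R).
Hypothesis PhiK : forall x, Cpath S x -> `|Phi x| <= K.
Hypothesis K0 : 0 <= K.

Let minorant_lbound (k : R) x : 0 <= k -> lbound
  [set Phi yr.1 + k * yr.2 | yr in
        [set yr : (R -> V) * R | [/\ Cpath S yr.1, 0 <= yr.2 &
           path_close S yr.2 x yr.1]]] (- K).
Proof.
move=> k0 _ [[y r] /= [yC r0 xy] <-].
by have := PhiK yC; rewrite ler_norml => /andP[? _]; nra.
Qed.

Lemma lipschitz_minorant_le k x : 0 <= k -> Cpath S x ->
  lipschitz_minorant S Phi k x <= Phi x.
Proof.
move=> k0 xC; apply: ge_inf; first by exists (- K); exact: minorant_lbound.
exists (x, 0) => /=; last by rewrite mulr0 addr0.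
by split=> // t _; rewrite subrr normr0.
Qed.

Lemma lipschitz_minorant_ge k x c : Cpath S x ->
  (forall y r, Cpath S y -> 0 <= r -> path_close S r x y ->
    c <= Phi y + k * r) -> c <= lipschitz_minorant S Phi k x.
Proof.
move=> xC H; apply: lb_le_inf; last by move=> _ [[y r] /= [? ? ?] <-]; exact: H.
exists (Phi x + k * 0), (x, 0) => //=.
by split=> // t _; rewrite subrr normr0.
Qed.

Lemma lipschitz_minorantP k : 0 <= k ->
  lipschitz_functional S (lipschitz_minorant S Phi k).
Proof.
move=> k0.
have half x y r : Cpath S x -> Cpath S y -> 0 <= r -> path_close S r x y ->
    lipschitz_minorant S Phi k x <= lipschitz_minorant S Phi k y + k * r.
  move=> xC yC r0 xy; rewrite -lerBlDr; apply: lipschitz_minorant_ge => //.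
  move=> z r' zC r'0 yz; rewrite lerBlDr -addrA -mulrDr.
  apply: ge_inf; first by exists (- K); exact: minorant_lbound.
  exists (z, r' + r) => //=; split=> //; first exact: addr_ge0.
  by rewrite addrC; exact: path_close_trans xy yz.
exists K, k; split=> // [x xC|x y r xC yC r0 xy].
  rewrite ler_norml; apply/andP; split.
    apply: lipschitz_minorant_ge => // y r yC r0 _.
    by have := PhiK yC; rewrite ler_norml => /andP[? _]; nra.
  rewrite (le_trans (lipschitz_minorant_le _ _))//.
  by rewrite (le_trans (ler_norm _))// PhiK.
rewrite ler_norml; have := half _ _ _ xC yC r0 xy.
have := half _ _ _ yC xC r0 (path_close_sym xy); lra.
Qed.

(** Near [x] the values of [Phi] are close to [Phi x] by continuity; at a
positive distance from [x] the penalty eventually exceeds the range of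
[Phi]. *)
Lemma lipschitz_minorant_cvg x : {within @Defs.Cpath R V S, continuous Phi} ->
  Cpath S x -> (fun n => lipschitz_minorant S Phi n%:R x) @ \oo --> Phi x.
Proof.
move=> /(@within_path _ V R^o) cPhi xC; apply/cvgrPdist_le => eta eta0.
have [e e0 He] := cPhi x xC eta eta0.
near=> n.
rewrite ger0_norm ?subr_ge0 ?lipschitz_minorant_le//.
rewrite lerBlDl -lerBlDr; apply: lipschitz_minorant_ge => // y r yC r0 xy.
have nK : 2 * K / e <= n%:R by near: n; exact: nbhs_infty_ger.
have [re|er] := leP r e.
  have := He y yC (fun t tS => le_trans (xy t tS) re).
  have nr0 : 0 <= n%:R * r by rewrite mulr_ge0.
  by rewrite ler_norml => /andP[? ?]; lra.
have := PhiK xC; have := PhiK yC; rewrite !ler_norml => /andP[? ?] /andP[? ?].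
have : 2 * K <= n%:R * r.
  by rewrite ler_pdivrMr// in nK; rewrite (le_trans nK)// ler_wpM2l// ltW.
lra.
Unshelve. all: by end_near. Qed.

End minorant.

End random_paths.

(** * Convergence in distribution through Lipschitz functionals *)

Section portmanteau.
Context (R : realType) (V : normedModType R) d d' (Om : measurableType d)
  (Om' : measurableType d').
Variables (P : probability Om R) (D : set Om) (X : R -> Om -> R -> V)
  (Q : probability Om' R) (Y : Om' -> R -> V) (S : R).

Lemma cvg_in_distribution_Rintegral Phi : random_path setT S Y ->
  cvg_in_distribution P D X Q Y S -> @bounded_continuous_functional R V S Phi ->
  (\int[P]_(w in D) Phi (X eps w)) @[eps --> 0^'+] --> \int[Q]_w Phi (Y w).
Proof.
move=> rY /(_ Phi) H cPhi; have [_ [K PhiK]] := cPhi.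
have [_ YC _] := rY.
apply: fine_cvg; rewrite -(@EFin_Rintegral _ _ _ _ _ _ K) //; first exact: H.
  exact: random_path_functional rY cPhi.
by move=> w _; apply: PhiK; exact: YC.
Qed.

Hypotheses (rX : forall eps : R, 0 < eps -> random_path D S (X eps))
  (rY : random_path setT S Y).

Let lower (Phi : (R -> V) -> R) (eta : R) :
  (forall Psi, lipschitz_functional S Psi ->
  (\int[P]_(w in D) Psi (X eps w)) @[eps --> 0^'+] --> \int[Q]_w Psi (Y w)) ->
  @bounded_continuous_functional R V S Phi -> 0 < eta ->
  \forall eps \near 0^'+,
    \int[Q]_w Phi (Y w) - eta <= \int[P]_(w in D) Phi (X eps w).
Proof.
move=> H cPhi eta0; have [cPhi1 [K0 PhiK0]] := cPhi.
have K0' : 0 <= `|K0| by [].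
have PhiK x : @Cpath R V S x -> `|Phi x| <= `|K0|.
  by move=> xC; rewrite (le_trans (PhiK0 x xC))// ler_norm.
move: `|K0| K0' PhiK => K K_ge0 PhiK.
have mY Psi : @bounded_continuous_functional R V S Psi -> measurable_fun setT (Psi \o Y).
  by move=> cPsi; exact: random_path_functional rY cPsi.
have [_ YC _] := rY.
have lipm n := lipschitz_minorantP PhiK K_ge0 (ler0n R n).
have minK n x : @Cpath R V S x -> `|lipschitz_minorant S Phi n%:R x| <= K.
  move=> xC; rewrite ler_norml; apply/andP; split.
    apply: lipschitz_minorant_ge => // y r yC r0 _.
    have := PhiK y yC; rewrite ler_norml => /andP[? _].
    have : 0 <= n%:R * r by rewrite mulr_ge0.
    lra.
  rewrite (le_trans (lipschitz_minorant_le PhiK _ _))//.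
  by rewrite (le_trans (ler_norm _))// PhiK.
have cv : (fun n => \int[Q]_w lipschitz_minorant S Phi n%:R (Y w)) @ \oo -->
    \int[Q]_w Phi (Y w).
  apply: (@Rintegral_bounded_cvg _ _ _ _ _ _ _ _ _ K) => //.
  - exact: probability_lty.
  - by move=> n; apply/mY/lipschitz_functional_continuous/lipm.
  - exact: mY.
  - by move=> n w _; apply: minK; exact: YC.
  - apply: aeW => w _. exact: (lipschitz_minorant_cvg PhiK cPhi1 (YC w I)).
have /cvgrPdist_le/(_ (eta / 2) ltac:(lra))[N _ /(_ N (leqnn N)) /=] := cv.
rewrite ler_norml => /andP[_ cN].
have /cvgrPdist_le/(_ (eta / 2) ltac:(lra)) := H _ (lipm N).
apply: filterS2 (nbhs_right_gt (0 : R)) => eps eps0.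
rewrite ler_norml => /andP[_ ceps].
have [mD XC _] := rX eps0.
suff : \int[P]_(w in D) lipschitz_minorant S Phi N%:R (X eps w) <=
    \int[P]_(w in D) Phi (X eps w) by lra.
have Dfin := probability_lty P mD.
apply: le_Rintegral => //.
- apply: (@bounded_integrable _ _ _ _ _ mD Dfin _ K).
    apply: random_path_functional (rX eps0) _.
    exact: lipschitz_functional_continuous.
  by move=> w Dw; apply: minK; exact: XC.
- apply: (@bounded_integrable _ _ _ _ _ mD Dfin _ K).
    exact: random_path_functional (rX eps0) _.
  by move=> w Dw; apply: PhiK; exact: XC.
- move=> w Dw; apply: (lipschitz_minorant_le PhiK) => //; exact: XC.
Qed.

(** A bounded continuous functional is the increasing limit of its Lipschitz
minorants, and so is its opposite; each of the two gives one of the inequalities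
between the inferior or superior limit of the expectations and the expectation
of the limit. *)
Lemma lipschitz_cvg_in_distribution :
  (forall Psi, lipschitz_functional S Psi ->
  (\int[P]_(w in D) Psi (X eps w)) @[eps --> 0^'+] --> \int[Q]_w Psi (Y w)) ->
  cvg_in_distribution P D X Q Y S.
Proof.
move=> H Phi cPhi; have [cPhi1 [K PhiK]] := cPhi.
have [_ YC _] := rY.
rewrite (@EFin_Rintegral _ _ _ _ _ _ K) //; last 2 first.
  exact: random_path_functional rY cPhi.
  by move=> w _; apply: PhiK; exact: YC.
have intX eps : 0 < eps -> P.-integrable D (EFin \o (fun w => Phi (X eps w))).
  move=> eps0; have [mD XC _] := rX eps0.
  apply: (@bounded_integrable _ _ _ _ _ mD (probability_lty P mD) _ K).
    exact: random_path_functional (rX eps0) _.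
  by move=> w Dw; apply: PhiK; exact: XC.
have mD : measurable D by have [] := rX (@ltr01 R).
apply: cvg_EFin.
  apply: filterS (nbhs_right_gt (0 : R)) => eps eps0.
  by apply: integrable_fin_num => //; exact: intX.
apply/cvgrPdist_le => eta eta0.
have cNPhi : @bounded_continuous_functional R V S (fun x => - Phi x).
  split; last by exists K => x xC; rewrite normrN PhiK.
  move=> /within_path in cPhi1; apply/(@within_path _ V R^o).
  move=> x xC e e0; have [r r0 Hr] := cPhi1 x xC e e0.
  by exists r => // y yC xy; rewrite -opprD normrN; exact: Hr.
have mPhiY : measurable_fun setT (Phi \o Y).
  exact: random_path_functional rY cPhi.
have iY : Q.-integrable setT (EFin \o (Phi \o Y)).
  apply: (@bounded_integrable _ _ _ _ _ measurableT
    (probability_lty Q measurableT) _ K) => //.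
  by move=> w _; apply: PhiK; exact: YC.
have RN d0 (T0 : measurableType d0) (P0 : probability T0 R) D0 (g : T0 -> R) :
    measurable D0 -> P0.-integrable D0 (EFin \o g) ->
    \int[P0]_(w in D0) - g w = - \int[P0]_(w in D0) g w.
  move=> mD0 ig; rewrite -mulN1r -RintegralZl//.
  by apply: eq_Rintegral => w _; rewrite mulN1r.
have [L1 L2] := (lower H cPhi eta0, lower H cNPhi eta0).
apply: filterS3 L1 L2 (nbhs_right_gt (0 : R)) => eps.
move=> h1 h2 eps0; move: h2; rewrite RN// RN//; last exact: intX.
move=> h2; rewrite /= -/(Rintegral _ _ _) ler_norml; lra.
Qed.

End portmanteau.

Section closeness.
Context (R : realType) (V : normedModType R) d (Om : measurableType d).
Variables (P : probability Om R) (D : set Om) (S : R).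

(** On [G] the functional moves by at most [k * eta]; elsewhere it is only
known to be bounded by [K]. *)
Lemma Rintegral_lipschitz_close (X Y : Om -> R -> V) (G : set Om)
    Phi (K k eta zeta : R) :
  random_path D S X -> random_path D S Y ->
  @bounded_continuous_functional R V S Phi ->
  (forall x, @Cpath R V S x -> `|Phi x| <= K) -> 0 <= K -> 0 <= k -> 0 <= eta ->
  (forall x y (r : R), @Cpath R V S x -> @Cpath R V S y -> 0 <= r ->
      path_close S r x y -> `|Phi x - Phi y| <= k * r) ->
  measurable G -> (P (D `\` G) <= zeta%:E)%E ->
  (forall w, D w -> G w -> path_close S eta (X w) (Y w)) ->
  `|\int[P]_(w in D) Phi (X w) - \int[P]_(w in D) Phi (Y w)| <=
    k * eta + 2 * K * zeta.
Proof.
move=> rX rY cPhi PhiK K0 k0 eta0 Phik mG PG XY.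
have [mD XC _] := rX; have [_ YC _] := rY.
have mX := random_path_functional rX cPhi.
have mY := random_path_functional rY cPhi.
have XK w : D w -> `|Phi (X w)| <= K by move=> Dw; apply/PhiK/XC.
have YK w : D w -> `|Phi (Y w)| <= K by move=> Dw; apply/PhiK/YC.
have DU : D = (D `&` G) `|` (D `\` G).
  apply/seteqP; split=> [w Dw|w [[]|[]]//].
  by have [|] := pselect (G w); [left|right].
have mDG : measurable (D `&` G) by exact: measurableI.
have mDnG : measurable (D `\` G) by exact: measurableD.
have split_ (g : Om -> R) : measurable_fun D g -> (forall w, D w -> `|g w| <= K) ->
    \int[P]_(w in D) g w = \int[P]_(w in D `&` G) g w +
      \int[P]_(w in D `\` G) g w.
  move=> mg gK; rewrite {1}DU Rintegral_setU// -?DU.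
    by apply: (@bounded_integrable _ _ _ _ _ mD (probability_lty P mD) _ K).
  by apply/disj_setPS => w [[_ ?] []].
rewrite !split_// opprD addrACA (le_trans (ler_normD _ _))// lerD//.
  have := @Rintegral_close _ _ _ P _ mDG (probability_lty P mDG)
    (fun w => Phi (X w)) (fun w => Phi (Y w)) K (k * eta).
  move=> /(_ (measurable_funS mD (@subIsetl _ _ _) mX)).
  move=> /(_ (measurable_funS mD (@subIsetl _ _ _) mY)).
  move=> H; apply: (le_trans (H _ _ _)).
  - by move=> w [Dw _]; exact: XK.
  - by move=> w [Dw _]; exact: YK.
  - by move=> w [Dw Gw]; apply: Phik => //; [exact: XC|exact: YC|exact: XY].
  rewrite ler_piMr ?mulr_ge0// -lee_fin fineK ?probability_le1//.
  by rewrite ge0_fin_numE// probability_lty.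
have mXs := measurable_funS mD (@subDsetl _ D G) mX.
have mYs := measurable_funS mD (@subDsetl _ D G) mY.
have Pz : fine (P (D `\` G)) <= zeta.
  by rewrite -lee_fin fineK// ge0_fin_numE// probability_lty.
have := @normr_Rintegral_le _ _ _ P _ mDnG (probability_lty P mDnG) _ K mXs.
have := @normr_Rintegral_le _ _ _ P _ mDnG (probability_lty P mDnG) _ K mYs.
move=> /(_ (fun w Dw => YK w Dw.1)) h1 /(_ (fun w Dw => XK w Dw.1)) h2.
rewrite (le_trans (ler_normB _ _))//; have := ler_wpM2l K0 Pz; lra.
Qed.

End closeness.

(** * Almost invariant observables of an ergodic map *)

Section almost_everywhere_convergence.
Context d (M : measurableType d) (R : realType).

(** The sum of the absolute increments has a finite integral, hence is finite
almost everywhere, where the sequence converges absolutely. *)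
Lemma summable_increments_ae_cvg (P : {measure set M -> \bar R})
    (g : nat -> M -> R) (c : R) :
  (forall n, measurable_fun setT (g n)) ->
  (forall n, (\int[P]_x `|g n.+1 x - g n x|%:E <= (c / 2 ^+ n)%:E)%E) ->
  {ae P, forall x, cvgn (g ^~ x)}.
Proof.
move=> mg gc.
pose f n x := (`|g n.+1 x - g n x|%:E)%E : \bar R.
have mf n : measurable_fun setT (f n).
  by apply/measurable_EFinP/measurableT_comp => //; exact: measurable_funB.
have f0 n x : setT x -> (0 <= f n x)%E by rewrite lee_fin.
have If : P.-integrable setT (fun x => \sum_(n <oo) f n x)%E.
  apply/integrableP; split.
    apply: (@ge0_emeasurable_sum _ _ _ setT f xpredT) => [k x _ _|k _] //.
    exact: f0.
  under eq_integral do (rewrite gee0_abs; last by apply: nneseries_ge0 => n _ _; exact: f0).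
  rewrite integral_nneseries//.
  apply: (@le_lt_trans _ _ (2 * c)%:E); last exact: ltry.
  apply: lime_le.
    by apply: is_cvg_nneseries => n _ _; apply: integral_ge0 => x _; exact: f0.
  apply: nearW => n.
  apply: (@le_trans _ _ (\sum_(0 <= i < n) (c / 2 ^+ i)%:E)%E).
    by apply: lee_sum => i _; exact: gc.
  rewrite sumEFin lee_fin.
  have c0 : 0 <= c.
    have := gc 0%N; rewrite expr0 divr1 -lee_fin; apply: le_trans.
    by apply: integral_ge0 => x _; exact: f0.
  have -> : \sum_(0 <= i < n) c / 2 ^+ i = 2 * c - 2 * c / 2 ^+ n.
    elim: n => [|n IH]; first by rewrite big_nil expr0 divr1 subrr.
    rewrite big_nat_recr//= IH exprS invfM mulrA.
    have : 2 * c / 2 = c by rewrite mulrAC divff ?mul1r.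
    by move=> ->; ring.
  by rewrite gerBl divr_ge0 ?mulr_ge0.
have := integrable_ae measurableT If.
apply: filterS => x /(_ I) Lfin.
suff : cvgn (series (telescope (g ^~ x))).
  rewrite telescopeK => /cvg_ex[l Hl]; apply/cvg_ex; exists (l + g 0%N x).
  have -> : g ^~ x = fun n => (g n x - g 0%N x) + g 0%N x.
    by apply/funext => n; rewrite subrK.
  by apply: cvgD => //; exact: cvg_cst.
apply: normed_cvg; apply: nondecreasing_is_cvgn.
  by apply: nondecreasing_series => n _ _ /=; exact: normr_ge0.
exists (fine (\sum_(n <oo) f n x)%E) => _ [n _ <-].
rewrite -[leLHS]/(\sum_(0 <= i < n) `|g i.+1 x - g i x|).
rewrite -lee_fin fineK// -sumEFin.
by apply: nneseries_lim_ge => i _ _; exact: f0.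
Qed.

End almost_everywhere_convergence.

Section invariant_means.
Context d (M : measurableType d) (R : realType).
Variables (mu : {measure set M -> \bar R}) (T : M -> M).
Hypothesis T_erg : ergodic mu T.

(** The sets where the superior limit of [g n] is at most a given level are
exactly [T]-invariant, because [g n] is invariant up to an error that vanishes
uniformly. By ergodicity each of them is null or conull, and the limit can only
be the level at which they become conull. *)
Lemma ergodic_limit_cst (g : nat -> M -> R) (K : R) (delta : nat -> R) :
  mu setT != 0%E ->
  (forall n, measurable_fun setT (g n)) -> (forall n x, `|g n x| <= K) ->
  (forall n x, `|g n (T x) - g n x| <= delta n) -> delta @ \oo --> 0 ->
  exists c : R, {ae mu, forall x, forall l : R, g ^~ x @ \oo --> l -> l = c}.
Proof.
move=> muT mg gK gT delta0.
(* [A r] is the set where the superior limit of [g n] is at most [r]. *)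
pose A (r : R) : set M :=
  [set x | forall k, exists N, forall n, (N <= n)%N -> g n x <= r + k.+1%:R^-1].
have mA r : measurable (A r).
  have -> : A r = \bigcap_k \bigcup_N \bigcap_(n in [set n | (N <= n)%N])
      g n @^-1` `]-oo, r + k.+1%:R^-1].
    apply/seteqP; split=> x /= Ax k; first move=> _.
      by have [N HN] := Ax k; exists N => // n /= Nn; rewrite in_itv/= HN.
    have [N _ HN] := Ax k I; exists N => n Nn.
    by have /= := HN n Nn; rewrite in_itv.
  apply: bigcapT_measurable => k; apply: bigcupT_measurable => N.
  apply: bigcap_measurable; first by exists N => /=.
  by move=> n _; rewrite -[X in measurable X]setTI; exact: mg.
have inv r : T @^-1` A r = A r.
  have shift_ (x y : M) : (forall n, `|g n x - g n y| <= delta n) ->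
      A r x -> A r y.
    move=> xy Ax k; have [N HN] := Ax (k.+1 * 2)%N.
    have k2 : 0 < k.+1%:R^-1 / 2 :> R by rewrite divr_gt0// invr_gt0.
    move/cvgrPdist_le : delta0 => /(_ _ k2)[N' _ HN'].
    exists (maxn N N') => n; rewrite geq_max => /andP[/HN h1 /HN'/=].
    rewrite sub0r normrN => /(le_trans (ler_norm _)) h2.
    have := xy n; rewrite ler_norml => /andP[? _].
    have : (k.+1 * 2).+1%:R^-1 <= k.+1%:R^-1 / 2 :> R.
      by rewrite -invfM lef_pV2 ?posrE ?mulr_gt0 ?ltr0n// -natrM ler_nat.
    set u := (k.+1 * 2).+1%:R^-1 in h1 *; set v := k.+1%:R^-1 in h2 *.
    lra.
  apply/seteqP; split=> x /=; apply: shift_ => n; first exact: gT.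
  by rewrite distrC; exact: gT.
have dich r : mu (A r) = 0%E \/ mu (~` A r) = 0%E by exact: T_erg (mA r) (inv r).
pose E := [set r | mu (~` A r) = 0%E].
have lbE : lbound E (- K - 1).
  move=> r /= Er; rewrite leNgt; apply/negP => rK.
  suff A0 : A r = set0 by have := Er; rewrite /E /= A0 setC0 => muT0; rewrite muT0 eqxx in muT.
  apply/seteqP; split=> // x /(_ 0%N)[N /(_ N (leqnn N))].
  rewrite invr1; have := gK N x; rewrite ler_norml => /andP[? ?]; lra.
have EK : E K.
  rewrite /E /= (_ : A K = setT) ?setCT ?measure0//.
  apply/seteqP; split=> // x _ k; exists 0%N => n _.
  by rewrite (le_trans (ler_norm _))// (le_trans (gK n x))// lerDl invr_ge0.
have infE : has_inf E by split; [exists K|exists (- K - 1)].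
exists (inf E).
have up k : {ae mu, forall x, A (inf E + k.+1%:R^-1) x}.
  have k0 : 0 < k.+1%:R^-1 :> R by rewrite invr_gt0.
  have [r Er rk] := inf_adherent k0 infE.
  exists (~` A r); split; [exact: measurableC|exact: Er|move=> x /=].
  apply: contra_not => Ar j; have [N HN] := Ar j; exists N => n Nn.
  by rewrite (le_trans (HN n Nn))// lerD2r ltW.
have dn k : {ae mu, forall x, ~ A (inf E - k.+1%:R^-1) x}.
  have [H|H] := dich (inf E - k.+1%:R^-1).
    by exists (A (inf E - k.+1%:R^-1)); split=> // x /= /contrapT.
  have : inf E <= inf E - k.+1%:R^-1 by apply: ge_inf => //; exists (- K - 1).
  by rewrite leNgt ltrBlDr ltrDl invr_gt0 ltr0n.
have [/ae_foralln up' /ae_foralln dn'] := (up, dn).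
apply: filterS2 up' dn' => x xu xd l gl.
apply/eqP; rewrite eq_le; apply/andP; split.
  apply/ler_addgt0Pr => e e0.
  pose k := Num.truncn (2 / e).
  have ke : k.+1%:R^-1 <= e / 2.
    by rewrite -[leRHS]invrK lef_pV2 ?posrE ?invr_gt0 ?divr_gt0// invf_div ltW// truncnS_gt.
  have [N HN] := xu k k.
  apply: (cvgr_to_le gl); exists N => // n /= /HN.
  set u := k.+1%:R^-1 in ke *; lra.
apply/ler_addgt0Pr => e e0; rewrite leNgt; apply/negP => le.
pose k := Num.truncn (2 / e).
have ke : k.+1%:R^-1 <= e / 2.
  by rewrite -[leRHS]invrK lef_pV2 ?posrE ?invr_gt0 ?divr_gt0// invf_div ltW// truncnS_gt.
apply: (xd k) => j.
have : \forall n \near \oo, g n x <= inf E - k.+1%:R^-1.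
  have : l < inf E - k.+1%:R^-1 by set u := k.+1%:R^-1 in ke *; lra.
  by move=> /(cvgr_lt _ gl); apply: filterS => n /ltW.
move=> [N _ HN]; exists N => n /HN /le_trans; apply.
by rewrite lerDl.
Qed.

End invariant_means.

Section quadratic_mean.
Context d (M : measurableType d) (R : realType) (P : probability M R).
Implicit Types (g h : M -> R).

Lemma integrable_bounded_RV g (K : R) : measurable_fun setT g ->
  (forall x, `|g x| <= K) -> P.-integrable setT (EFin \o g).
Proof.
move=> mg gK; apply: (bounded_integrable measurableT _ mg (fun x _ => gK x)).
exact: probability_lty.
Qed.

Lemma Rintegral_probability_cst (r : R) : \int[P]_x r = r.
Proof.
rewrite Rintegral_cst// [X in r * X](_ : _ = 1) ?mulr1//.
by have /(congr1 fine) := probability_setT P.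
Qed.

Lemma Rintegral_parallelogram g h (K : R) :
  measurable_fun setT g -> measurable_fun setT h ->
  (forall x, `|g x| <= K) -> (forall x, `|h x| <= K) ->
  \int[P]_x (g x - h x) ^+ 2 =
    2 * \int[P]_x g x ^+ 2 + 2 * \int[P]_x h x ^+ 2
    - 4 * \int[P]_x ((g x + h x) / 2) ^+ 2.
Proof.
move=> mg mh gK hK.
have sq (k : M -> R) (C : R) : measurable_fun setT k -> (forall x, `|k x| <= C) ->
    P.-integrable setT (EFin \o (fun x => k x ^+ 2)).
  move=> mk kC; apply: (@integrable_bounded_RV _ (C ^+ 2)).
    exact: measurable_funX.
  move=> x; rewrite normrX lerXn2r ?nnegrE//.
  by rewrite (le_trans _ (kC x)).
have ig := sq _ _ mg gK; have ih := sq _ _ mh hK.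
have ia : P.-integrable setT (EFin \o (fun x => ((g x + h x) / 2) ^+ 2)).
  apply: (sq _ K).
    by apply: measurable_funM => //; exact: measurable_funD.
  move=> x; have := gK x; have := hK x; rewrite !ler_norml => /andP[? ?] /andP[? ?].
  by apply/andP; split; lra.
have iZ (k : M -> R) (c : R) : P.-integrable setT (EFin \o k) ->
    P.-integrable setT (EFin \o (fun x => c * k x)).
  move=> ik; have := integrableZl measurableT c ik.
  by apply: eq_integrable => // x _ /=; rewrite EFinM.
have iD (k k' : M -> R) : P.-integrable setT (EFin \o k) ->
    P.-integrable setT (EFin \o k') ->
    P.-integrable setT (EFin \o (fun x => k x + k' x)).
  move=> ik ik'; have := integrableD measurableT ik ik'.
  by apply: eq_integrable => // x _ /=; rewrite EFinD.
rewrite -!RintegralZl// -RintegralD//; [|exact: iZ|exact: iZ].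
rewrite -RintegralB//; [|by apply: iD; exact: iZ|exact: iZ].
by apply: eq_Rintegral => x _; field.
Qed.

(** Arithmetic-geometric inequality with a weight: with [lam = 2 ^+ n], a mean
square of order [4 ^- n] gives a mean of order [2 ^- n]. *)
Lemma Rintegral_norm_le_square g (K lam : R) : 0 < lam ->
  measurable_fun setT g -> (forall x, `|g x| <= K) ->
  \int[P]_x `|g x| <= (lam * \int[P]_x g x ^+ 2 + lam^-1) / 2.
Proof.
move=> lam0 mg gK.
have i1 : P.-integrable setT (EFin \o (fun x => `|g x|)).
  apply: (@integrable_bounded_RV _ K); first exact: measurableT_comp.
  by move=> x; rewrite normr_id.
have i2 : P.-integrable setT (EFin \o (fun x => g x ^+ 2)).
  apply: (@integrable_bounded_RV _ (K ^+ 2)); first exact: measurable_funX.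
  by move=> x; rewrite normrX lerXn2r ?nnegrE// (le_trans _ (gK x)).
have i2' : P.-integrable setT (EFin \o (fun x => lam / 2 * g x ^+ 2)).
  have := integrableZl measurableT (lam / 2) i2.
  by apply: eq_integrable => // x _ /=; rewrite EFinM.
have i3 : P.-integrable setT (EFin \o (fun=> lam^-1 / 2)).
  by apply: (@integrable_bounded_RV _ `|lam^-1 / 2|).
have -> : (lam * \int[P]_x g x ^+ 2 + lam^-1) / 2 =
    \int[P]_x (lam / 2 * g x ^+ 2 + lam^-1 / 2).
  rewrite RintegralD// RintegralZl// Rintegral_probability_cst.
  by rewrite mulrDl mulrAC.
apply: le_Rintegral => //.
  have := integrableD measurableT i2' i3.
  by apply: eq_integrable => // x _ /=; rewrite EFinD.
move=> x _; rewrite -(real_normK (num_real (g x))).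
have : 0 <= lam^-1 / 2 * (lam * `|g x| - 1) ^+ 2.
  by rewrite mulr_ge0 ?sqr_ge0// divr_ge0// invr_ge0 ltW.
have -> : lam^-1 / 2 * (lam * `|g x| - 1) ^+ 2 =
    lam / 2 * `|g x| ^+ 2 + lam^-1 / 2 - `|g x|.
  by field; rewrite gt_eqF.
by rewrite subr_ge0.
Qed.

End quadratic_mean.

Section asymptotic_invariance.
Context d (M : measurableType d) (R : realType).
Variables (mu : {measure set M -> \bar R}) (T : M -> M).
Hypothesis T_erg : ergodic mu T.
Variables (P1 P2 : probability M R).
Implicit Types (g h : M -> R) (delta eps : R).
Hypotheses (P1mu : P1 `<< mu) (P2mu : P2 `<< mu).

Section convex_sets.
Variables (K l e0 : R).

(** These sets would all be inhabited if, along an asymptotically invariant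
family of observables, the means for [P1] converged to [l] while those for [P2]
kept exceeding [l] by at least [e0]. *)
Definition almost_invariant_observables (delta : R) : set (M -> R) :=
  [set g : M -> R | [/\ measurable_fun setT g, forall x, `|g x| <= K,
    forall x, `|g (T x) - g x| <= delta, \int[P1]_x g x <= l + delta &
    l + e0 <= \int[P2]_x g x]].

Let C := almost_invariant_observables.

Let q (g : M -> R) := \int[P1]_x g x ^+ 2 + \int[P2]_x g x ^+ 2.

Let q_ge0 g : 0 <= q g.
Proof. by rewrite addr_ge0// Rintegral_ge0// => x _; exact: sqr_ge0. Qed.

Let Csub delta delta' : delta <= delta' -> C delta `<=` C delta'.
Proof.
move=> dd g [mg gK gT g1 g2]; split=> // [x|].
  by rewrite (le_trans (gT x)).
by rewrite (le_trans g1)// lerD2l.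
Qed.

Let Cmid delta g h : C delta g -> C delta h ->
  C delta (fun x => (g x + h x) / 2).
Proof.
move=> [mg gK gT g1 g2] [mh hK hT h1 h2].
have mgh : measurable_fun setT (fun x => (g x + h x) / 2).
  by apply: measurable_funM => //; exact: measurable_funD.
have ER (P : probability M R) : \int[P]_x ((g x + h x) / 2) =
    (\int[P]_x g x + \int[P]_x h x) / 2.
  have ig := integrable_bounded_RV P mg gK.
  have ih := integrable_bounded_RV P mh hK.
  rewrite RintegralZr//; first by rewrite RintegralD.
  have := integrableD measurableT ig ih.
  by apply: eq_integrable => // x _ /=; rewrite EFinD.
split=> // [x|x||]; rewrite ?ER.
- have := gK x; have := hK x; rewrite !ler_norml => /andP[? ?] /andP[? ?].
  by apply/andP; split; lra.
- have := gT x; have := hT x; rewrite !ler_norml => /andP[? ?] /andP[? ?].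
  by apply/andP; split; lra.
- lra.
- lra.
Qed.

Let parallelogram delta g h : C delta g -> C delta h ->
  q (fun x => g x - h x) = 2 * q g + 2 * q h - 4 * q (fun x => (g x + h x) / 2).
Proof.
move=> [mg gK _ _ _] [mh hK _ _ _].
by rewrite /q !(Rintegral_parallelogram _ mg mh gK hK); ring.
Qed.

(** These convex sets shrink with [delta], so that the infima of the quadratic
norm over them increase to a finite limit; by the parallelogram identity,
elements that almost realise these infima converge almost everywhere for both
probabilities. Their limit is constant by ergodicity, and therefore has the
same mean for [P1] and for [P2], against the definition of the sets. *)
Lemma almost_invariant_observables_empty : 0 < e0 ->
  ~ (forall delta, 0 < delta -> C delta !=set0).
Proof.
move=> e00 C0.
have K0 : 0 <= K.
  have [g [_ gK _ _ _]] := C0 1 ltr01.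
  have [x _] : [set: M] !=set0.
    apply/set0P/eqP => M0; have := probability_setT P1; rewrite M0 measure0.
    by move=> /eqP; rewrite lt_eqF ?lte01.
  by rewrite (le_trans _ (gK x)).
pose iq (delta : R) := inf [set q g | g in C delta].
have lbq delta : lbound [set q g | g in C delta] 0 by move=> _ [g _ <-].
have iq_le delta g : C delta g -> iq delta <= q g.
  by move=> Cg; apply: ge_inf; [exists 0; exact: lbq|exists g].
have sq_bd (P : probability M R) g : measurable_fun setT g ->
    (forall x, `|g x| <= K) -> \int[P]_x g x ^+ 2 <= K ^+ 2.
  move=> mg gK; rewrite (le_trans (ler_norm _))//.
  have := @normr_Rintegral_le _ _ _ P _ measurableT
     (probability_lty P measurableT) (fun x => g x ^+ 2) (K ^+ 2).
  rewrite [fine _](_ : _ = 1) ?mulr1; last first.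
    by have /(congr1 fine) := probability_setT P.
  apply; first exact: measurable_funX.
  by move=> x _; rewrite normrX lerXn2r ?nnegrE.
pose E := [set iq delta | delta in [set delta : R | 0 < delta]].
have ubE : has_ubound E.
  exists (K ^+ 2 + K ^+ 2) => _ [delta /= d0 <-].
  have [g Cg] := C0 _ d0; rewrite (le_trans (iq_le _ _ Cg))//.
  by have [mg gK _ _ _] := Cg; rewrite lerD// sq_bd.
have supE : has_sup E.
  by split=> //; exists (iq 1); exists 1 => //=; exact: ltr01.
pose I := sup E.
have iqI delta : 0 < delta -> iq delta <= I.
  by move=> d0; apply: ub_le_sup => //; exists delta.
(* The infima are realised up to [c n], and [dl n] bounds the defect of
   invariance; the geometric rates make the increments of [g] summable. *)
pose c (n : nat) : R := (4 ^+ n)^-1.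
have c0 n : 0 < c n by rewrite invr_gt0 exprn_gt0.
have cS n : c n.+1 <= c n.
  by rewrite /c exprS invfM ler_piMl ?(ltW (c0 n))//; lra.
pose dl (n : nat) : R := (2 ^+ n)^-1.
have dl0 n : 0 < dl n by rewrite invr_gt0 exprn_gt0.
have iq_mono delta delta' : 0 < delta -> delta <= delta' -> iq delta' <= iq delta.
  move=> d0 dd; apply: lb_le_inf.
    by have [g Cg] := C0 _ d0; exists (q g), g.
  by move=> _ [g Cg <-]; apply/iq_le/(Csub dd).
have ex n : exists dg : R * (M -> R), [/\ 0 < dg.1, dg.1 <= dl n,
    I - c n < iq dg.1, C dg.1 dg.2 & q dg.2 < iq dg.1 + c n].
  have [_ [delta /= d0 <-] dI] := sup_adherent (c0 n) supE.
  pose delta' := Num.min delta (dl n).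
  have d'0 : 0 < delta' by rewrite lt_min d0 dl0.
  have hi : has_inf [set q g | g in C delta'].
    split; last by exists 0; exact: lbq.
    by have [g Cg] := C0 _ d'0; exists (q g), g.
  have [_ [g Cg <-] gq] := inf_adherent (c0 n) hi.
  exists (delta', g); split=> //=.
    by rewrite ge_min lexx orbT.
  by rewrite (lt_le_trans dI)// iq_mono// ge_min lexx.
have [dg Hdg] := choice ex.
pose g n := (dg n).2; pose delta n := (dg n).1.
have mg n : measurable_fun setT (g n) by have [_ _ _ [mgn _ _ _ _] _] := Hdg n.
have gK n x : `|g n x| <= K by have [_ _ _ [_ gKn _ _ _] _] := Hdg n; exact: gKn.
have gT n x : `|g n (T x) - g n x| <= dl n.
  by have [_ dd _ [_ _ gn _ _] _] := Hdg n; exact: le_trans (gn x) dd.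
have g1 n : \int[P1]_x g n x <= l + dl n.
  have [_ dd _ [_ _ _ gn _] _] := Hdg n; apply: (le_trans gn).
  by rewrite lerD2l.
have g2 n : l + e0 <= \int[P2]_x g n x by have [_ _ _ [_ _ _ _ gn] _] := Hdg n; exact: gn.
have qn n : q (fun x => g n.+1 x - g n x) <= 8 * c n.
  have [d0 _ dI Cg qg] := Hdg n; have [d0' _ dI' Cg' qg'] := Hdg n.+1.
  (* The two scales need not be ordered, but their maximum is one of them. *)
  pose m := Num.max (delta n) (delta n.+1).
  have Cm : C m (g n) by apply: Csub Cg; rewrite le_max lexx.
  have Cm' : C m (g n.+1) by apply: Csub Cg'; rewrite le_max lexx orbT.
  rewrite (parallelogram Cm' Cm).
  have qm := iq_le _ _ (Cmid Cm' Cm).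
  have Im : I - c n <= iq m.
    rewrite /m; have [dd|dd] := leP (delta n) (delta n.+1).
      by rewrite (le_trans _ (ltW dI'))// lerD2l lerN2.
    exact: ltW dI.
  have := iqI _ d0; have := iqI _ d0'; have := cS n.
  rewrite -/(g n) -/(g n.+1) in qg qg' *; lra.
have dl_cvg : dl @ \oo --> 0.
  have -> : dl = fun n => 2^-1 ^+ n by apply/funext => n; rewrite exprVn.
  by apply: cvg_expr; rewrite ger0_norm//; lra.
have ae_cvg (P : probability M R) :
    (forall h, \int[P]_x h x ^+ 2 <= q h) -> {ae P, forall x, cvgn (g ^~ x)}.
  move=> Pq; apply: (@summable_increments_ae_cvg _ _ _ P g 5) => // n.
  have mh : measurable_fun setT (fun x => g n.+1 x - g n x).
    exact: measurable_funB.
  have hK x : `|g n.+1 x - g n x| <= 2 * K.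
    rewrite (le_trans (ler_normB _ _))//.
    by have := gK n x; have := gK n.+1 x; lra.
  rewrite (@EFin_Rintegral _ _ _ P _ (fun x => `|g n.+1 x - g n x|) (2 * K))//.
  - rewrite lee_fin.
    have p2 : 0 < 2 ^+ n :> R by rewrite exprn_gt0.
    apply: (le_trans (Rintegral_norm_le_square P p2 mh hK)).
    have := ler_wpM2l (ltW p2) (le_trans (Pq _) (qn n)).
    have -> : 2 ^+ n * (8 * c n) = 8 * dl n.
      rewrite /c /dl (_ : 4 = 2 * 2 :> R) ?exprMn; last by ring.
      by field; rewrite gt_eqF.
    have := dl0 n; rewrite -/(dl n); lra.
  - exact: measurableT_comp.
  - by move=> x _; rewrite normr_id.
have ae1 : {ae P1, forall x, cvgn (g ^~ x)}.
  by apply: ae_cvg => h; rewrite lerDl Rintegral_ge0// => x _; exact: sqr_ge0.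
have ae2 : {ae P2, forall x, cvgn (g ^~ x)}.
  by apply: ae_cvg => h; rewrite lerDr Rintegral_ge0// => x _; exact: sqr_ge0.
have mu0 : mu setT != 0%E.
  apply/eqP => mu0; have := (null_content_dominatesP _ _).1 P1mu _ measurableT mu0.
  by rewrite (probability_setT P1) => /eqP; rewrite gt_eqF ?lte01.
have [k Hk] := ergodic_limit_cst T_erg mu0 mg gK gT dl_cvg.
have lim (P : probability M R) : P `<< mu -> {ae P, forall x, cvgn (g ^~ x)} ->
    (fun n => \int[P]_x g n x) @ \oo --> k.
  move=> Pmu aeP.
  have Hk' : {ae P, forall x, forall l : R, g ^~ x @ \oo --> l -> l = k}.
    have [N [mN N0 sub]] := Hk; exists N; split => //.
    exact: (null_content_dominatesP _ _).1 Pmu _ mN N0.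
  have := @Rintegral_bounded_cvg _ _ _ P _ measurableT
    (probability_lty P measurableT) g (fun=> k) K mg (measurable_cst _) (fun n x _ => gK n x).
  rewrite Rintegral_probability_cst; apply.
  apply: filterS2 aeP Hk' => x /cvg_ex[l' xl'] /(_ _ xl') <- _.
  exact: xl'.
have kl : k <= l.
  have := lim _ P1mu ae1 => H1.
  have H2 : (fun n => l + dl n) @ \oo --> l + 0 by apply: cvgD => //; exact: cvg_cst.
  rewrite -[leRHS]addr0; apply: ler_cvg_to H1 H2 _.
  by apply: nearW.
have : l + e0 <= k.
  apply: (cvgr_to_ge (lim _ P2mu ae2)); exact: nearW.
lra.
Qed.

End convex_sets.

(** This is what makes convergence in distribution strong for ergodic systems
(Zweimueller): otherwise the observables [psi eps], or their opposites, would
inhabit the sets [almost_invariant_observables] along a subsequence. *)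
Lemma asymptotically_invariant_means (psi : R -> M -> R) (K l : R) :
  (forall eps, 0 < eps -> measurable_fun setT (psi eps)) ->
  (forall eps x, 0 < eps -> `|psi eps x| <= K) ->
  (forall delta : R, 0 < delta -> \forall eps \near 0^'+,
     forall x, `|psi eps (T x) - psi eps x| <= delta) ->
  (\int[P1]_x psi eps x) @[eps --> 0^'+] --> l ->
  (\int[P2]_x psi eps x) @[eps --> 0^'+] --> l.
Proof.
have upper (phi : R -> M -> R) (k e0 : R) : 0 < e0 ->
    (forall eps, 0 < eps -> measurable_fun setT (phi eps)) ->
    (forall eps x, 0 < eps -> `|phi eps x| <= K) ->
    (forall delta : R, 0 < delta -> \forall eps \near 0^'+,
       forall x, `|phi eps (T x) - phi eps x| <= delta) ->
    (\int[P1]_x phi eps x) @[eps --> 0^'+] --> k ->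
    \forall eps \near 0^'+, \int[P2]_x phi eps x < k + e0.
  move=> e00 mphi phiK phiT phik; apply: contrapT => H.
  apply: (@almost_invariant_observables_empty K k e0 e00) => delta d0.
  apply: contrapT => Cempty; apply: H.
  have /cvgrPdist_le/(_ _ d0) := phik.
  apply: filterS3 (phiT _ d0) (nbhs_right_gt (0 : R)) => eps epsT eps0.
  rewrite ler_norml => /andP[epsk _]; rewrite ltNge; apply/negP => le.
  apply: Cempty; exists (phi eps); split=> //; first exact: mphi.
    by move=> x; exact: phiK.
  by rewrite addrC -lerBlDr; lra.
move=> mpsi psiK psiT psil; apply/cvgrPdist_lt => eta eta0.
have U1 := upper psi l eta eta0 mpsi psiK psiT psil.
have RN (P : probability M R) eps : 0 < eps ->
    \int[P]_x - psi eps x = - \int[P]_x psi eps x.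
  move=> eps0; rewrite -mulN1r -RintegralZl//.
    by apply: eq_Rintegral => x _; rewrite mulN1r.
  by apply: integrable_bounded_RV (mpsi _ eps0) _ => x; exact: psiK.
have U2 : \forall eps \near 0^'+, \int[P2]_x - psi eps x < - l + eta.
  apply: (upper (fun eps x => - psi eps x)) => //.
  - by move=> eps eps0; apply: measurableT_comp => //; exact: mpsi.
  - by move=> eps x eps0; rewrite normrN psiK.
  - move=> delta /psiT; apply: filterS => eps H x.
    by rewrite -opprD normrN.
  - apply: (@cvg_trans _ _ _ _ _ (cvgN psil)).
    apply: near_eq_cvg; apply: filterS (nbhs_right_gt (0 : R)) => eps eps0.
    by rewrite /= RN.
apply: filterS3 U1 U2 (nbhs_right_gt (0 : R)) => eps h1 h2 eps0.
rewrite RN// in h2; rewrite ltr_norml; lra.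
Qed.

End asymptotic_invariance.

(** * Lebesgue integrals over intervals and with a parameter *)

Section lebesgue_shift.
Context (R : realType).
Local Notation leb := (@lebesgue_measure R).
Implicit Types (a b c r : R) (g h : R -> R) (D : set R).

Let shift c : R -> measurableTypeR R := fun s => s + c.

Let measurable_shift c : measurable_fun setT (shift c).
Proof. exact: measurable_funD. Qed.

Lemma lebesgue_measure_shift c (A : set R) : measurable A ->
  pushforward leb (shift c) A = leb A.
Proof.
move=> mA; apply/esym/lebesgue_measure_unique => //=.
  exact: measurable_shift.
move=> _ _ [[a b]] _ <-.
rewrite /pushforward (_ : shift c @^-1` _ = `]a - c, b - c]%classic).
  rewrite !lebesgue_measure_itv/= !lte_fin ltrD2r.
  by case: ifP => // _; rewrite -!EFinB; congr EFin; ring.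
by apply/seteqP; split=> s /=; rewrite !in_itv/= /shift ltrBlDr lerBrDr.
Qed.

Lemma ge0_integral_shift c (f : R -> \bar R) D :
  measurable D -> measurable_fun D f -> (forall s, D s -> (0 <= f s)%E) ->
  (\int[leb]_(s in [set s | D (s + c)%R]) f (s + c)%R = \int[leb]_(s in D) f s)%E.
Proof.
move=> mD mf f0.
have -> : (\int[leb]_(s in D) f s =
    \int[pushforward leb (shift c)]_(s in D) f s)%E.
  apply: eq_measure_integral => /=; first exact: measurable_shift.
  by move=> ? A mA AS; exact/esym/lebesgue_measure_shift.
rewrite ge0_integral_pushforward//; first exact: measurable_shift.
by move=> s /set_mem; exact: f0.
Qed.

Lemma Rintegral_shift c g D : measurable D -> measurable_fun D g ->
  \int[leb]_(s in [set s | D (s + c)]) g (s + c) = \int[leb]_(s in D) g s.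
Proof.
move=> mD mg; have mg' : measurable_fun D (EFin \o g) by exact/measurable_EFinP.
congr fine; rewrite integralE [RHS]integralE; congr (_ - _)%E.
  rewrite -(ge0_integral_shift c mD (measurable_funepos mg'))//.
  by apply: eq_integral => s _; rewrite !funeposE.
rewrite -(ge0_integral_shift c mD (measurable_funeneg mg'))//.
by apply: eq_integral => s _; rewrite !funenegE.
Qed.

Lemma lebesgue_measure_co a b : a <= b -> leb `[a, b[ = (b - a)%:E.
Proof.
rewrite le_eqVlt => /predU1P[->|ab].
  by rewrite lebesgue_measure_itv/= ltxx subrr.
by rewrite lebesgue_measure_itv/= lte_fin ab.
Qed.

Lemma lebesgue_measure_co_lty a b : (leb `[a, b[ < +oo)%E.
Proof.
rewrite lebesgue_measure_itv/=; case: ifP => _; last exact: ltry.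
by rewrite -EFinB ltry.
Qed.

Lemma Rintegral_co_split a b c g (K : R) : a <= b -> b <= c ->
  measurable_fun `[a, c[ g -> (forall s, a <= s < c -> `|g s| <= K) ->
  \int[leb]_(s in `[a, c[) g s =
    \int[leb]_(s in `[a, b[) g s + \int[leb]_(s in `[b, c[) g s.
Proof.
move=> ab bc mg gK.
have E : `[a, c[%classic = `[a, b[%classic `|` `[b, c[%classic :> set R.
  apply/seteqP; split=> s /=; rewrite !in_itv/=.
    move=> /andP[as_ sc]; have [sb|bs] := ltP s b; first by left; rewrite as_.
    by right.
  move=> [/andP[-> sb]|/andP[bs ->]]; first by rewrite (lt_le_trans sb).
  by rewrite (le_trans ab).
rewrite E Rintegral_setU -?E//.
  apply: (@bounded_integrable _ _ _ _ _ _ _ _ K) => //.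
    exact: lebesgue_measure_co_lty.
apply/disj_setPS => s /=; rewrite !in_itv/= => -[/andP[_ sb] /andP[bs _]].
by move: sb; rewrite ltNge bs.
Qed.

Lemma Rintegral_co_close a b g h (K delta : R) : a <= b ->
  measurable_fun `[a, b[ g -> measurable_fun `[a, b[ h ->
  (forall s, a <= s < b -> `|g s| <= K) ->
  (forall s, a <= s < b -> `|h s| <= K) ->
  (forall s, a <= s < b -> `|g s - h s| <= delta) ->
  `|\int[leb]_(s in `[a, b[) g s - \int[leb]_(s in `[a, b[) h s|
    <= delta * (b - a).
Proof.
move=> ab mg mh gK hK gh.
have <- : fine (leb `[a, b[) = b - a by rewrite lebesgue_measure_co.
apply: (@Rintegral_close _ _ _ leb `[a, b[ (measurable_itv _)
  (lebesgue_measure_co_lty a b) g h K delta mg mh) => s; rewrite /= in_itv/=.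
- exact: gK.
- exact: hK.
- exact: gh.
Qed.

Lemma Rintegral_co_norm a b g (K : R) : a <= b ->
  measurable_fun `[a, b[ g -> (forall s, a <= s < b -> `|g s| <= K) ->
  `|\int[leb]_(s in `[a, b[) g s| <= K * (b - a).
Proof.
move=> ab mg gK.
have <- : fine (leb `[a, b[) = b - a by rewrite lebesgue_measure_co.
apply: (@normr_Rintegral_le _ _ _ leb `[a, b[ (measurable_itv _)
  (lebesgue_measure_co_lty a b) g K mg) => s; rewrite /= in_itv/=.
exact: gK.
Qed.

Lemma Rintegral_co_shift a b c g : measurable_fun `[a + c, b + c[ g ->
  \int[leb]_(s in `[a, b[) g (s + c) = \int[leb]_(s in `[a + c, b + c[) g s.
Proof.
move=> mg; rewrite -(@Rintegral_shift c _ `[a + c, b + c[)//; congr Rintegral.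
by apply/seteqP; split=> s /=; rewrite !in_itv/= lerD2r ltrD2r.
Qed.

Lemma Rintegral_cc_co a b g (K : R) : measurable_fun `[a, b[ g ->
  (forall s, a <= s < b -> `|g s| <= K) ->
  \int[leb]_(s in `[a, b]) g s = \int[leb]_(s in `[a, b[) g s.
Proof.
move=> mg gK; rewrite -Rintegral_itv_bndo_bndc//.
apply: (@bounded_integrable _ _ _ _ _ _ _ _ K) => //.
  exact: lebesgue_measure_co_lty.
Qed.

End lebesgue_shift.

Section row_vectors.
Context (R : realType) (d : nat).
Implicit Types (x y : 'rV[R]_d) (r : R).

Lemma row_norm_leP x r : 0 <= r -> `|x| <= r <-> forall i, `|x 0 i| <= r.
Proof.
move=> r0; rewrite [`|x|]mx_normrE; split.
  move=> /bigmax_leP[_ H] i; exact: (H (0, i)).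
move=> H; apply/bigmax_leP; split=> // -[j i] _ /=.
by rewrite (ord1 j).
Qed.

Lemma row_dist_leP x y r : 0 <= r ->
  `|x - y| <= r <-> forall i, `|x 0 i - y 0 i| <= r.
Proof.
move=> r0; rewrite row_norm_leP//; split=> H i; have := H i; rewrite !mxE//.
Qed.

Lemma row_coord_le x i : `|x 0 i| <= `|x|.
Proof. exact: (row_norm_leP x (normr_ge0 x)).1. Qed.

End row_vectors.

Section parametric_integral.
Context (R : realType) d (Z : measurableType d).
Local Notation leb := (@lebesgue_measure R).

(** The theorem of Tonelli, applied to the positive and negative parts of [g]
extended by zero outside of [A]. *)
Lemma measurable_parametric_integral (A : set (Z * R)) (g : Z * R -> R) :
  measurable A -> measurable_fun A g ->
  measurable_fun setT (fun z => \int[leb]_(s in xsection A z) g (z, s)).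
Proof.
move=> mA mg.
pose g' : Z * R -> \bar R := (EFin \o g) \_ A.
have mg' : measurable_fun setT g'.
  have mEg : measurable_fun A (EFin \o g) by exact/measurable_EFinP.
  exact: (measurable_restrictT _ mA).1 mEg.
have -> : (fun z => \int[leb]_(s in xsection A z) g (z, s)) =
    fine \o ((fubini_F leb g'^\+ \- fubini_F leb g'^\-)%E).
  apply/funext => z; rewrite /= /Rintegral; congr fine.
  rewrite integral_mkcond integralE /fubini_F; congr (_ - _)%E.
    apply: eq_integral => s _; rewrite !funeposE /g' !patchE mem_xsection.
    by case: ifPn.
  apply: eq_integral => s _; rewrite !funenegE /g' !patchE mem_xsection.
  by case: ifPn.
apply: measurableT_comp; first exact: fine_measurable.
apply: emeasurable_funB; apply: measurable_fun_fubini_tonelli_F => //.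
- exact: measurable_funepos.
- exact: measurable_funeneg.
Qed.

End parametric_integral.

Section countable_pieces.
Context d d' (Z : measurableType d) (X : measurableType d').

Lemma measurable_fun_pieces (D : set Z) (N : Z -> nat) (h : Z -> X)
    (h_ : nat -> Z -> X) :
  (forall n, measurable (D `&` [set z | N z = n])) ->
  (forall n, measurable_fun setT (h_ n)) ->
  (forall z, D z -> h z = h_ (N z) z) -> measurable_fun D h.
Proof.
move=> mN mh hh.
have -> : D = \bigcup_n (D `&` [set z | N z = n]).
  apply/seteqP; split=> [z Dz|z [n _ []]//].
  by exists (N z).
apply/measurable_fun_bigcup => // n.
apply: (@eq_measurable_fun _ _ _ _ _ (h_ n)).
  by move=> z; rewrite inE => -[Dz /= <-]; rewrite hh.
exact: measurable_funTS.
Qed.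

End countable_pieces.

(** * Return times and the suspension flow *)

Section return_times.
Context (R : realType) dM (M : measurableType dM).
Variables (T : M -> M) (tau : M -> R) (tm : R).
Hypotheses (tm0 : 0 < tm) (tau_ge : forall y, tm <= tau y).
Implicit Types (y : M) (s t r : R).
Local Notation t_ := (return_time T tau).
Local Notation count := (return_count T tau).

Lemma return_time0 y : t_ 0 y = 0.
Proof. by rewrite /return_time big_geq. Qed.

Lemma return_timeS n y : t_ n.+1 y = t_ n y + tau (iter n T y).
Proof. by rewrite /return_time big_nat_recr. Qed.

Lemma return_timeT n y : t_ n.+1 y = tau y + t_ n (T y).
Proof.
elim: n => [|n IH]; first by rewrite return_timeS !return_time0 add0r addr0.
by rewrite return_timeS IH return_timeS -iterSr addrA.
Qed.

Lemma return_time_ge n y : n%:R * tm <= t_ n y.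
Proof.
elim: n => [|n IH]; first by rewrite mul0r return_time0.
by rewrite return_timeS -natr1 mulrDl mul1r lerD.
Qed.

Lemma return_time_mono n m y : (n <= m)%N -> t_ n y <= t_ m y.
Proof.
move=> /subnK <-; elim: (m - n)%N => [|k IH]//.
rewrite addSn return_timeS (le_trans IH)// lerDl.
by rewrite (le_trans (ltW tm0)).
Qed.

Lemma return_count_unique n t y : t_ n y <= t -> t < t_ n.+1 y ->
  count t y = n.
Proof.
move=> tn nt; rewrite /return_count.
have ubn : ubound [set m | t_ m y <= t] n.
  move=> m /= mt; rewrite leEnat leqNgt; apply/negP => nm.
  have := return_time_mono y nm; rewrite leNgt => /negP; apply.
  exact: le_lt_trans nt.
have A0 : [set m | t_ m y <= t] != set0 by apply/set0P; exists n.
rewrite /supremum (negbTE A0); case: xgetP => [m -> [ubm lbm]|].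
  by apply/eqP; rewrite eq_le; apply/andP; split; [exact: lbm|exact: ubm].
by move=> /(_ n); case; split=> // m; apply.
Qed.

Lemma return_countP t y : 0 <= t ->
  t_ (count t y) y <= t < t_ (count t y).+1 y.
Proof.
move=> t0; have ex : exists n, t < t_ n y.
  exists (Num.truncn (t / tm)).+1.
  rewrite (lt_le_trans _ (return_time_ge _ _))// -ltr_pdivrMr//.
  exact: truncnS_gt.
have := ex_minnP ex; case=> -[|n] tn min_n.
  by move: tn; rewrite return_time0 ltNge t0.
have nt : t_ n y <= t by rewrite leNgt; apply/negP => /min_n; rewrite ltnn.
by rewrite (return_count_unique nt tn) nt tn.
Qed.

Lemma return_count_le t y : 0 <= t -> (count t y)%:R <= t / tm.
Proof.
move=> t0; have /andP[h _] := return_countP y t0.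
rewrite ler_pdivlMr//; exact: le_trans (return_time_ge _ y) h.
Qed.

Local Notation flow := (suspension_flow T tau).

Lemma suspension_flow_height s r y : flow s (y, r) = flow (s + r) (y, 0).
Proof. by rewrite /suspension_flow /= addr0. Qed.

Lemma suspension_flow_fiber n s y : t_ n y <= s -> s < t_ n.+1 y ->
  flow s (y, 0) = (iter n T y, s - t_ n y).
Proof.
by move=> ns sn; rewrite /suspension_flow /= addr0 (return_count_unique ns sn).
Qed.

Lemma suspension_flow_base s y : 0 <= s ->
  flow s (T y, 0) = flow (s + tau y) (y, 0).
Proof.
move=> s0; have /andP[h1 h2] := return_countP (T y) s0.
rewrite (suspension_flow_fiber h1 h2).
rewrite (@suspension_flow_fiber (count s (T y)).+1); last 2 first.
- by rewrite return_timeT addrC lerD2r.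
- by rewrite return_timeT addrC ltrD2l.
by rewrite iterSr return_timeT; congr pair; ring.
Qed.

Lemma suspension_flow_in s p : 0 <= s -> suspension_space tau p ->
  suspension_space tau (flow s p).
Proof.
case: p => y r s0 [/= r0 rt].
have /andP[h1 h2] := return_countP y (addr_ge0 s0 r0).
split=> /=; first by rewrite subr_ge0.
by move: h2; rewrite return_timeS ltrBlDl.
Qed.

Lemma suspension_space_base y : suspension_space tau (y, 0).
Proof. by split=> //=; rewrite (lt_le_trans tm0). Qed.

End return_times.

Section measurability.
Context (R : realType) dM (M : measurableType dM).
Variables (T : M -> M) (tau : M -> R) (tm : R).
Hypotheses (mT : measurable_fun setT T) (mtau : measurable_fun setT tau).
Hypotheses (tm0 : 0 < tm) (tau_ge : forall y, tm <= tau y).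
Local Notation leb := (@lebesgue_measure R).
Local Notation D := (suspension_space tau).

Let mD : measurable D. Proof. exact: measurable_suspension_space. Qed.

Lemma measurable_iter n : measurable_fun setT (iter n T).
Proof.
elim: n => [|n IH]; first exact: measurable_id.
exact: (measurableT_comp mT IH).
Qed.

Lemma measurable_return_time n : measurable_fun setT (return_time T tau n).
Proof.
elim: n => [|n IH].
  rewrite (_ : return_time T tau 0 = cst 0); first exact: measurable_cst.
  by apply/funext => y; rewrite return_time0.
rewrite (_ : return_time T tau n.+1 =
  fun y => return_time T tau n y + tau (iter n T y)).
  apply: measurable_funD => //.
  exact: (measurableT_comp mtau (measurable_iter n)).
by apply/funext => y; rewrite return_timeS.
Qed.

Let mle dZ (Z : measurableType dZ) (g h : Z -> R) : measurable_fun setT g ->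
  measurable_fun setT h -> measurable [set z | g z <= h z].
Proof.
move=> mg mh; have mgh := measurable_fun_ler mg mh.
have := mgh measurableT [set true] I.
by rewrite setTI.
Qed.

Let mlt dZ (Z : measurableType dZ) (g h : Z -> R) : measurable_fun setT g ->
  measurable_fun setT h -> measurable [set z | g z < h z].
Proof.
move=> mg mh; have mgh := measurable_fun_ltr mg mh.
have := mgh measurableT [set true] I.
by rewrite setTI.
Qed.

Section roof.
Variables (d : nat) (f : R -> M * R -> 'rV[R]_d).
Hypothesis f_meas : forall i, measurable_fun ([set: R] `*` D)
  (fun q : R * (M * R) => f q.1 q.2 0 i).

Let mRD : measurable ([set: R] `*` D : set (R * (M * R))).
Proof. exact: measurableX. Qed.

Lemma measurable_roof_integral i :
  measurable_fun setT (fun yw : R * M => roof_integral tau f yw.1 yw.2 0 i).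
Proof.
pose A := [set q : (R * M) * R | 0 <= q.2 /\ q.2 < tau q.1.2].
have mtau2 : measurable_fun setT (fun q : (R * M) * R => tau q.1.2).
  apply: (measurableT_comp mtau); apply: (measurableT_comp measurable_snd).
  exact: measurable_fst.
have mA : measurable A.
  by apply: measurableI; [exact: mle|exact: mlt].
have mg : measurable_fun A
    (fun q : (R * M) * R => f q.1.1 (q.1.2, q.2) 0 i).
  apply: (@measurable_comp _ _ _ _ _ _ ([set: R] `*` D)
    (fun q : R * (M * R) => f q.1 q.2 0 i) A
    (fun q : (R * M) * R => (q.1.1, (q.1.2, q.2)))) => //.
    by move=> _ [[[y w] s] /= [? ?] <-].
  apply: measurable_funTS; apply: measurable_fun_pair.
    by apply: (measurableT_comp measurable_fst); exact: measurable_fst.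
  apply: measurable_fun_pair; last exact: measurable_snd.
  by apply: (measurableT_comp measurable_snd); exact: measurable_fst.
have := measurable_parametric_integral mA mg.
rewrite (_ : (fun z : R * M => _) =
  (fun yw : R * M => roof_integral tau f yw.1 yw.2 0 i))//.
apply/funext => -[y w]; rewrite /roof_integral /vintegral mxE.
congr Rintegral; apply/seteqP; split=> s; rewrite /xsection /= in_itv/=.
  by rewrite inE => -[/= -> ->].
by move=> /andP[? ?]; rewrite inE.
Qed.

Let flow_window := [set q : (M * R) * R | D q.1 /\ 0 <= q.2].

Let mW : measurable flow_window.
Proof.
apply: measurableI; last by apply: mle => //; exact: measurable_snd.
by rewrite -[X in measurable X]setTI; exact: measurable_fst.
Qed.

(** On the event that [n] returns have taken place, the flow is the explicit
measurable map with base point [iter n T y] and height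
[s + r - return_time n y]. *)
Lemma measurable_flow_integrand (eps : R) i :
  measurable_fun [set q : (M * R) * R | D q.1 /\ 0 <= q.2]
    (fun q : (M * R) * R => f (eps * q.2) (suspension_flow T tau q.2 q.1) 0 i).
Proof.
apply: (@measurable_comp _ _ _ _ _ _ ([set: R] `*` D)
    (fun q : R * (M * R) => f q.1 q.2 0 i) flow_window
    (fun q : (M * R) * R => (eps * q.2, suspension_flow T tau q.2 q.1))) => //.
  move=> _ [[p s] /= [Dp s0] <-]; split=> //.
  exact: (suspension_flow_in T tm0 tau_ge s0 Dp).
have m11 : measurable_fun setT (fun q : (M * R) * R => q.1.1).
  by apply: (measurableT_comp measurable_fst); exact: measurable_fst.
have m12 : measurable_fun setT (fun q : (M * R) * R => q.2 + q.1.2).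
  apply: measurable_funD; first exact: measurable_snd.
  by apply: (measurableT_comp measurable_snd); exact: measurable_fst.
apply: (@measurable_fun_pieces _ _ ((M * R) * R)%type (R * (M * R))%type flow_window
  (fun q => return_count T tau (q.2 + q.1.2) q.1.1)
  (fun q : (M * R) * R => (eps * q.2, suspension_flow T tau q.2 q.1))
  (fun n (q : (M * R) * R) => (eps * q.2,
     (iter n T q.1.1, q.2 + q.1.2 - return_time T tau n q.1.1)))) => [n|n|//].
  have -> : flow_window `&`
      [set q | return_count T tau (q.2 + q.1.2) q.1.1 = n] =
      flow_window `&`
       ([set q : (M * R) * R | return_time T tau n q.1.1 <= q.2 + q.1.2] `&`
       [set q : (M * R) * R | q.2 + q.1.2 < return_time T tau n.+1 q.1.1]).
    apply/seteqP; split=> -[[y r] s] [[[/= r0 rt] s0] /=].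
      move=> <-; split=> //.
      by have /andP[] := return_countP T tm0 tau_ge y (addr_ge0 s0 r0).
    by move=> [h1 h2]; split=> //; exact: (return_count_unique tm0 tau_ge h1 h2).
  apply: measurableI => //; apply: measurableI.
    by apply: mle => //; exact: (measurableT_comp (measurable_return_time n) m11).
  by apply: mlt => //; exact: (measurableT_comp (measurable_return_time n.+1) m11).
apply: measurable_fun_pair.
  by apply: measurable_funM; [exact: measurable_cst|exact: measurable_snd].
apply: measurable_fun_pair; first exact: (measurableT_comp (measurable_iter n) m11).
apply: measurable_funB => //.
exact: (measurableT_comp (measurable_return_time n) m11).
Qed.

Lemma measurable_flow_process (a : R -> R) (eps t : R) i :
  measurable_fun D (fun p => flow_process T tau a f eps p t 0 i).
Proof.
pose A := flow_window `&` [set q | q.2 <= t / eps].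
have mA : measurable A.
  by apply: measurableI => //; apply: mle => //; exact: measurable_snd.
have mg := measurable_funS mW (@subIsetl _ flow_window _)
  (measurable_flow_integrand eps i) : measurable_fun A _.
have := measurable_parametric_integral mA mg.
move=> /(measurable_funTS (D := D)) H.
apply: (@eq_measurable_fun _ _ _ _ _ (fun p => a eps *
  \int[leb]_(s in xsection A p) f (eps * s) (suspension_flow T tau s p) 0 i)).
  move=> p; rewrite inE => Dp; rewrite /flow_process /vintegral !mxE.
  congr (_ * _); congr Rintegral.
  apply/seteqP; split=> s; rewrite /xsection /= in_itv/=.
    by rewrite inE => -[[_ /= -> ->]].
  by move=> /andP[? ?]; rewrite inE.
by apply: measurable_funM => //; exact: measurable_cst.
Qed.

End roof.

Section slow.
Variable (g : R -> M -> R).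
Hypothesis mg : measurable_fun setT (fun q : R * M => g q.1 q.2).

Let W : set (M * R) := [set q : M * R | 0 <= q.2].

Let mW : measurable W.
Proof. by apply: mle => //; exact: measurable_snd. Qed.

Lemma measurable_slow_integrand (c : R) : measurable_fun [set q : M * R | 0 <= q.2]
  (fun q : M * R => g (c * q.2) (iter (Num.truncn q.2) T q.1)).
Proof.
apply: (@measurable_comp _ _ _ _ _ _ setT (fun q : R * M => g q.1 q.2) W
  (fun q : M * R => (c * q.2, iter (Num.truncn q.2) T q.1))) => //.
apply: (@measurable_fun_pieces _ _ (M * R)%type (R * M)%type W
  (fun q => Num.truncn q.2)
  (fun q : M * R => (c * q.2, iter (Num.truncn q.2) T q.1))
  (fun n q => (c * q.2, iter n T q.1))) => [n|n|//].
  have -> : W `&` [set q | Num.truncn q.2 = n] =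
      W `&` ([set q : M * R | n%:R <= q.2] `&` [set q : M * R | q.2 < n.+1%:R]).
    apply/seteqP; split=> -[y s] [/= s0 /=].
      by move=> <-; split=> //; have /andP[] := truncn_itv s0.
    by move=> [h1 h2]; split=> //; apply: truncn_def; rewrite h1.
  apply: measurableI => //; apply: measurableI.
    by apply: mle => //; exact: measurable_snd.
  by apply: mlt => //; exact: measurable_snd.
apply: measurable_fun_pair.
  by apply: measurable_funM; [exact: measurable_cst|exact: measurable_snd].
exact: (measurableT_comp (measurable_iter n) measurable_fst).
Qed.

Lemma measurable_slow_integral (c r : R) : measurable_fun setT
  (fun w => \int[leb]_(s in `[0, r]) g (c * s) (iter (Num.truncn s) T w)).
Proof.
pose A := W `&` [set q | q.2 <= r].
have mA : measurable A.
  by apply: measurableI => //; apply: mle => //; exact: measurable_snd.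
have mgA := measurable_funS mW (@subIsetl _ W _)
  (measurable_slow_integrand c) : measurable_fun A _.
have := measurable_parametric_integral mA mgA.
congr measurable_fun; apply/funext => w; congr Rintegral.
apply/seteqP; split=> s; rewrite /xsection /= in_itv/=.
  by rewrite inE => -[/= -> ->].
by move=> /andP[? ?]; rewrite inE.
Qed.

Lemma measurable_slow_slice (c : R) (w : M) : measurable_fun (`[0, +oo[ : set R)
  (fun s => g (c * s) (iter (Num.truncn s) T w)).
Proof.
apply: (@measurable_comp _ _ _ _ _ _ W
  (fun q : M * R => g (c * q.2) (iter (Num.truncn q.2) T q.1)) _
  (fun s => (w, s))) => //.
- by move=> _ [s + <-]; rewrite /= in_itv/= andbT.
- exact: measurable_slow_integrand.
- by apply: measurable_funTS; exact: measurable_fun_pair.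
Qed.

End slow.
End measurability.

(** * Derivatives of vector-valued functions *)

Section derivatives.
Context (R : realType) (d : nat).
Implicit Types (G : R -> 'rV[R]_d) (y z : R).

Lemma derivable_coord G y i : derivable G y 1 ->
  is_derive y 1 (fun z => G z 0 i) (derive1 G y 0 i).
Proof.
move=> dG; have dGi := (derivable_mxP _ _ _).1 dG 0 i.
split=> //; rewrite derive1E derive_mx// mxE; congr (derive _ _ _).
Qed.

(** The mean value theorem is applied coordinate by coordinate, as the
intermediate point depends on the coordinate; nothing is lost in the constant
because the norm is the maximum norm. *)
Lemma row_mean_value G (K : R) : (forall y, derivable G y 1) ->
  (forall y, `|derive1 G y| <= K) -> forall y z, `|G y - G z| <= K * `|y - z|.
Proof.
move=> dG GK y z; have K0 : 0 <= K by rewrite (le_trans _ (GK 0)).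
wlog yz : y z / y <= z.
  move=> th; have [|/ltW] := leP y z; first exact: th.
  by move=> /th; rewrite distrC (distrC z).
apply/row_dist_leP; first by rewrite mulr_ge0.
move=> i; rewrite distrC (distrC y).
have [|c _ ->] := @MVT_segment R (fun z => G z 0 i) (fun z => derive1 G z 0 i) y z yz
  (fun x _ => derivable_coord i (dG x)).
  apply: continuous_subspaceT => x; apply: differentiable_continuous.
  by apply/derivable1_diffP; have [] := derivable_coord i (dG x).
rewrite normrM ler_wpM2r//.
exact: le_trans (row_coord_le _ _) (GK c).
Qed.

Lemma row_taylor1 G (K : R) : (forall y, derivable G y 1) ->
  (forall y, derivable (derive1 G) y 1) ->
  (forall y, `|derive1 (derive1 G) y| <= K) ->
  forall y z, `|G y - G z - (y - z) *: derive1 G z| <= K * `|y - z| ^+ 2.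
Proof.
move=> dG ddG GK y z; have K0 : 0 <= K by rewrite (le_trans _ (GK 0)).
rewrite -[_ - _ - _]subr0.
apply/row_dist_leP; first by rewrite mulr_ge0// sqr_ge0.
move=> i; rewrite !mxE subr0.
have mvt (u w : R) : u <= w -> exists2 c, u <= c <= w &
    G w 0 i - G u 0 i = derive1 G c 0 i * (w - u).
  move=> uw.
  have [|c cuw H] := @MVT_segment R (fun z => G z 0 i) (fun z => derive1 G z 0 i) u w uw
    (fun x _ => derivable_coord i (dG x)).
    apply: continuous_subspaceT => x; apply: differentiable_continuous.
    by apply/derivable1_diffP; have [] := derivable_coord i (dG x).
  by exists c => //; move: cuw; rewrite in_itv.
have [c cyz ->] : exists2 c, `|c - z| <= `|y - z| &
    G y 0 i - G z 0 i = derive1 G c 0 i * (y - z).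
  have [yz|/ltW zy] := leP y z.
    have [c /andP[c1 c2] cE] := mvt _ _ yz.
    exists c; first by rewrite !ler0_norm; lra.
    by rewrite -opprB cE; ring.
  have [c /andP[c1 c2] cE] := mvt _ _ zy.
  by exists c => //; rewrite !ger0_norm; lra.
rewrite (mulrC (y - z)) -mulrBl normrM expr2 mulrA ler_wpM2r//.
have := row_mean_value ddG GK c z.
move=> /row_dist_leP-/(_ (mulr_ge0 K0 (normr_ge0 _)))/(_ i) /le_trans; apply.
by rewrite ler_wpM2l.
Qed.

End derivatives.

Section measurable_derivative.
Context (R : realType) (d : nat) dM (M : measurableType dM).

(** The derivative is the limit of the difference quotients with increments
[1 / (n + 1)]. *)
Lemma measurable_D1 (F : R -> M -> 'rV[R]_d) i :
  (forall w y, derivable (fun z => F z w) y 1) ->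
  measurable_fun setT (fun q : R * M => F q.1 q.2 0 i) ->
  measurable_fun setT (fun q : R * M => D1 F q.1 q.2 0 i).
Proof.
move=> dF mF.
apply: (@measurable_fun_cvg _ _ _ setT (fun n (q : R * M) =>
   n.+1%:R * (F (n.+1%:R^-1 + q.1) q.2 0 i - F q.1 q.2 0 i))).
  move=> n; apply: measurable_funM; first exact: measurable_cst.
  apply: measurable_funB => //.
  apply: (measurableT_comp mF (g := fun q : R * M => (n.+1%:R^-1 + q.1, q.2))).
  apply: measurable_fun_pair; last exact: measurable_snd.
  by apply: measurable_funD; [exact: measurable_cst|exact: measurable_fst].
move=> [y w] _ /=.
have [dFi _] := derivable_coord i (dF w y).
have := dFi; rewrite /derivable => /cvg_ex[l Hl].
have lE : l = D1 F y w 0 i.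
  by have [_ <-] := derivable_coord i (dF w y); apply/esym/cvg_lim.
rewrite -lE.
have h0 : (fun n : nat => n.+1%:R^-1 : R) @ \oo --> 0^'.
  move=> P [e /= e0 HP]; have /cvgrPdist_lt/(_ e e0) := @cvg_harmonic R.
  by apply: filterS => n ne; apply: HP => //=; rewrite ?invr_eq0 ?pnatr_eq0.
have := cvg_comp _ _ h0 Hl.
apply: cvg_trans; apply: near_eq_cvg; apply: nearW => n /=.
by rewrite invrK [_%:A]mulr1.
Qed.

End measurable_derivative.

(** * Integrals of vector-valued functions *)

Section vector_integral.
Context (R : realType) (d : nat).
Implicit Types (g h : R -> 'rV[R]_d) (a b c r s K delta : R).

Definition coord_measurable (A : set R) g :=
  forall i, measurable_fun A (fun s => g s 0 i).

Lemma coord_measurableS (A B : set R) g : measurable B -> A `<=` B ->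
  coord_measurable B g -> coord_measurable A g.
Proof. by move=> mB AB mg i; exact: measurable_funS (mg i). Qed.

Lemma subset_co_ray a b : 0 <= a -> `[a, b[%classic `<=` `[0, +oo[%classic.
Proof.
move=> a0 s /=; rewrite !in_itv/= andbT => /andP[as_ _].
exact: le_trans as_.
Qed.

Lemma vintegral_cc_co a b g K : coord_measurable `[a, b[ g ->
  (forall s, a <= s < b -> `|g s| <= K) ->
  vintegral `[a, b] g = vintegral `[a, b[ g.
Proof.
move=> mg gK; apply/rowP => i; rewrite !mxE; apply: Rintegral_cc_co (mg i) _.
by move=> s /gK; apply: le_trans; exact: row_coord_le.
Qed.

Lemma vintegral_co_split a b c g K : a <= b -> b <= c ->
  coord_measurable `[a, c[ g -> (forall s, a <= s < c -> `|g s| <= K) ->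
  vintegral `[a, c[ g = vintegral `[a, b[ g + vintegral `[b, c[ g.
Proof.
move=> ab bc mg gK; apply/rowP => i; rewrite !mxE.
apply: Rintegral_co_split ab bc (mg i) _.
by move=> s /gK; apply: le_trans; exact: row_coord_le.
Qed.

Lemma vintegral_co_close a b g h K delta : a <= b -> 0 <= delta ->
  coord_measurable `[a, b[ g -> coord_measurable `[a, b[ h ->
  (forall s, a <= s < b -> `|g s| <= K) ->
  (forall s, a <= s < b -> `|h s| <= K) ->
  (forall s, a <= s < b -> `|g s - h s| <= delta) ->
  `|vintegral `[a, b[ g - vintegral `[a, b[ h| <= delta * (b - a).
Proof.
move=> ab d0 mg mh gK hK gh; apply/row_dist_leP.
  by rewrite mulr_ge0// subr_ge0.
move=> i; rewrite !mxE; apply: (Rintegral_co_close ab (mg i) (mh i)).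
- by move=> s /gK; apply: le_trans; exact: row_coord_le.
- by move=> s /hK; apply: le_trans; exact: row_coord_le.
- by move=> s /gh /row_dist_leP; apply.
Qed.

Lemma vintegral_co_norm a b g K : a <= b -> 0 <= K ->
  coord_measurable `[a, b[ g -> (forall s, a <= s < b -> `|g s| <= K) ->
  `|vintegral `[a, b[ g| <= K * (b - a).
Proof.
move=> ab K0 mg gK; apply/row_norm_leP; first by rewrite mulr_ge0// subr_ge0.
move=> i; rewrite !mxE; apply: (Rintegral_co_norm ab (mg i)).
by move=> s /gK; apply: le_trans; exact: row_coord_le.
Qed.

Lemma vintegral_co_shift a b c g : coord_measurable `[a + c, b + c[ g ->
  vintegral `[a, b[ (fun s => g (s + c)) = vintegral `[a + c, b + c[ g.
Proof.
by move=> mg; apply/rowP => i; rewrite !mxE; exact: Rintegral_co_shift (mg i).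
Qed.

Lemma vintegral_co_cst a b (x : 'rV[R]_d) : a <= b ->
  vintegral `[a, b[ (fun=> x) = (b - a) *: x.
Proof.
move=> ab; apply/rowP => i; rewrite !mxE Rintegral_cst// mulrC.
have <- : fine (@lebesgue_measure R `[a, b[) = b - a.
  by rewrite lebesgue_measure_co.
by [].
Qed.

Lemma eq_vintegral_co a b g h : (forall s, a <= s < b -> g s = h s) ->
  vintegral `[a, b[ g = vintegral `[a, b[ h.
Proof.
move=> gh; apply/rowP => i; rewrite !mxE; apply: eq_Rintegral => s.
by rewrite inE /= in_itv/= => /gh ->.
Qed.

Section primitive.
Variables (g : R -> 'rV[R]_d) (K : R).
Hypotheses (K0 : 0 <= K) (mg : coord_measurable `[0, +oo[ g)
  (gK : forall s, 0 <= s -> `|g s| <= K).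

Let mgco a b : 0 <= a -> coord_measurable `[a, b[ g.
Proof. by move=> a0; apply: coord_measurableS mg => //; exact: subset_co_ray. Qed.

Let gKco a b s : 0 <= a -> a <= s < b -> `|g s| <= K.
Proof. by move=> a0 /andP[as_ _]; apply: gK; exact: le_trans as_. Qed.

Lemma primitive_co b : vintegral `[0, b] g = vintegral `[0, b[ g.
Proof. by apply: (@vintegral_cc_co _ _ _ K); [exact: mgco|move=> s; exact: gKco]. Qed.

Lemma primitive_lipschitz b c : 0 <= b -> b <= c ->
  `|vintegral `[0, b] g - vintegral `[0, c] g| <= K * (c - b).
Proof.
move=> b0 bc; rewrite !primitive_co.
rewrite (@vintegral_co_split 0 b c g K)//; [|exact: mgco|move=> s; exact: gKco].
rewrite opprD addNKr normrN; apply: vintegral_co_norm => //; first exact: mgco.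
by move=> s; exact: gKco.
Qed.

(** Integrals of a function and of an approximate translate of it: the
translation itself only moves the two ends of the interval. *)
Lemma primitive_translate (h : R -> 'rV[R]_d) b r delta :
  0 <= b -> 0 <= r -> 0 <= delta -> coord_measurable `[0, +oo[ h ->
  (forall s, 0 <= s -> `|h s| <= K) ->
  (forall s, 0 <= s < b -> `|h s - g (s + r)| <= delta) ->
  `|vintegral `[0, b] h - vintegral `[0, b] g| <= delta * b + 2 * K * r.
Proof.
move=> b0 r0 d0 mh hK hg; have mr : coord_measurable `[r, b + r[ g by exact: mgco.
rewrite primitive_co (@vintegral_cc_co _ _ _ K); last 2 first.
- by apply: coord_measurableS mh => //; exact: subset_co_ray.
- by move=> s /andP[s0 _]; exact: hK.
have mgr : coord_measurable `[0, b[ (fun s => g (s + r)).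
  move=> i; apply: (@measurable_comp _ _ _ R R R (`[0, +oo[%classic : set R)
    (fun s => g s 0 i) `[0, b[%classic (fun s => s + r)) => //.
    move=> _ [s /= + <-]; rewrite !in_itv/= andbT => /andP[s0 _].
    exact: addr_ge0.
  by apply: measurable_funTS; exact: measurable_funD.
have h1 : `|vintegral `[0, b[ h - vintegral `[r, b + r[ g| <= delta * b.
  have E := @vintegral_co_shift 0 b r g; rewrite add0r in E.
  rewrite -(E mr) -[b in leRHS]subr0.
  apply: (@vintegral_co_close _ _ _ _ K) => //.
  - by apply: coord_measurableS mh => //; exact: subset_co_ray.
  - by move=> s /andP[s0 _]; exact: hK.
  - by move=> s /andP[s0 _]; apply: gK; exact: addr_ge0.
have bbr : b <= b + r by rewrite lerDl.
have rbr : r <= b + r by rewrite lerDr.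
have h2 : vintegral `[r, b + r[ g - vintegral `[0, b[ g =
    vintegral `[b, b + r[ g - vintegral `[0, r[ g.
  have := @vintegral_co_split 0 b (b + r) g K b0 bbr (mgco (lexx 0))
    (fun s => gKco (lexx 0)).
  rewrite (@vintegral_co_split 0 r (b + r) g K)//; last 2 first.
  - exact: mgco.
  - by move=> s; exact: gKco.
  by move=> E; apply/eqP; rewrite subr_eq addrAC eq_sym subr_eq addrC -E addrC.
have h3 := @vintegral_co_norm _ _ _ _ bbr K0 (mgco b0) (fun s => gKco b0).
have h4 := @vintegral_co_norm _ _ _ _ r0 K0 (mgco (lexx 0)) (fun s => gKco (lexx 0)).
rewrite (le_trans (ler_distD (vintegral `[r, b + r[ g) _ _))// h2.
apply: (le_trans (lerD h1 (ler_normB _ _))).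
move: h3 h4; rewrite subr0 (addrC b) addrK; lra.
Qed.

End primitive.

End vector_integral.

Section slow_sums.
Context (R : realType) dM (M : measurableType dM) (d : nat).
Variables (T : M -> M) (mT : measurable_fun setT T).
Variables (G : R -> M -> 'rV[R]_d) (K L : R).
Hypotheses (mG : forall i, measurable_fun setT (fun q : R * M => G q.1 q.2 0 i))
  (GK : forall y w, `|G y w| <= K) (K0 : 0 <= K) (L0 : 0 <= L)
  (GL : forall y z w, `|G y w - G z w| <= L * `|y - z|).

Lemma slow_integrand_measurable (c : R) w :
  coord_measurable `[0, +oo[ (fun s => G (c * s) (iter (Num.truncn s) T w)).
Proof. by move=> i; exact: (measurable_slow_slice mT (g := fun y w => G y w 0 i) (mG i) c w). Qed.

(** Between two consecutive integers the point of the orbit is fixed, and the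
slow variable moves by at most [`|c|]. *)
Lemma slow_integral_sum (c : R) w (k : nat) :
  `|vintegral `[0, k%:R] (fun s => G (c * s) (iter (Num.truncn s) T w))
    - \sum_(0 <= j < k) G (c * j%:R) (iter j T w)| <= k%:R * (L * `|c|).
Proof.
set g := fun s => G _ _; have mg := slow_integrand_measurable c w.
have gK s : `|g s| <= K by exact: GK.
rewrite (@primitive_co _ _ _ _ mg (fun s _ => gK s)).
elim: k => [|k IH].
  rewrite big_geq// subr0 mul0r.
  have mg0 : coord_measurable `[0, 0[ g.
    by apply: coord_measurableS mg => //; exact: subset_co_ray.
  have := vintegral_co_norm (lexx 0) K0 mg0 (fun s _ => gK s).
  by rewrite subr0 mulr0.
have kk : k%:R <= k.+1%:R :> R by rewrite ler_nat.
rewrite (@vintegral_co_split _ _ 0 k%:R k.+1%:R g K)//; last first.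
  by apply: coord_measurableS mg => //; exact: subset_co_ray.
rewrite big_nat_recr//= opprD addrACA (le_trans (ler_normD _ _))//.
rewrite -[in leRHS]natr1 mulrDl lerD// mul1r.
have -> : G (c * k%:R) (iter k T w) =
    vintegral `[k%:R, k.+1%:R[ (fun=> G (c * k%:R) (iter k T w)).
  by rewrite vintegral_co_cst// -natr1 addrAC subrr add0r scale1r.
have -> : L * `|c| = L * `|c| * (k.+1%:R - k%:R).
  by rewrite -natr1 addrAC subrr add0r mulr1.
apply: (@vintegral_co_close _ _ _ _ _ _ K) => //.
- by rewrite mulr_ge0.
- by apply: coord_measurableS mg => //; exact: subset_co_ray.
- move=> s ks; have kE : Num.truncn s = k by exact: truncn_def.
  rewrite /g kE (le_trans (GL _ _ _))// ler_wpM2l// -mulrBr normrM.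
  rewrite ler_piMr//; move: ks; rewrite -natr1 => /andP[ks sk].
  by rewrite ger0_norm ?subr_ge0//; lra.
Qed.

End slow_sums.

(** * Summation by parts and integrals along the flow *)

Section summation_by_parts.
Context (R : realType) (V : normedModType R).

Lemma norm_sum_le (u : nat -> V) (n : nat) (c : R) :
  (forall k, (k < n)%N -> `|u k| <= c) ->
  `|\sum_(0 <= k < n) u k| <= n%:R * c.
Proof.
elim: n => [|n IH] uc; first by rewrite big_geq// normr0 mul0r.
rewrite big_nat_recr//= -natr1 mulrDl mul1r (le_trans (ler_normD _ _))//.
by rewrite lerD ?uc// IH// => k kn; rewrite uc// ltnS ltnW.
Qed.

Lemma sum_by_parts (A : nat -> V) (B : nat -> R) (n : nat) :
  \sum_(0 <= k < n) B k *: (A k.+1 - A k) =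
  B n *: A n - B 0%N *: A 0%N - \sum_(0 <= k < n) (B k.+1 - B k) *: A k.+1.
Proof.
elim: n => [|n IH]; first by rewrite !big_geq// subrr subr0.
rewrite !big_nat_recr//= IH scalerBr scalerBl.
set a := B n *: A n; set b := B 0%N *: A 0%N; set c := \sum_(_ <= _ < _) _.
set x := B n *: A n.+1; set y := B n.+1 *: A n.+1.
rewrite [LHS]addrC -[a - b - c]addrA subrKA opprD opprB [y - b]addrC -addrA.
by rewrite [y + _]addrCA [y + _]addrC subrK [RHS]addrA [RHS]addrC.
Qed.

(** Averaging [A] over a window of length [w] makes its increments small,
at the price of an error bounded by the oscillation [eta] of [A]; summing by
parts, that error is only charged to the increments of [B]. *)
Lemma smoothed_sum_le (A : nat -> V) (B : nat -> R) (n w : nat)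
    (beta gamma eta : R) :
  (0 < w)%N -> 0 <= beta -> 0 <= gamma -> 0 <= eta ->
  (forall k j, (k <= n)%N -> (j <= w)%N -> `|A (k + j)%N - A k| <= eta) ->
  (forall k, (k <= n)%N -> `|B k| <= beta) ->
  (forall k, (k < n)%N -> `|B k.+1 - B k| <= gamma) ->
  `|\sum_(0 <= k < n) B k *: (A k.+1 - A k)| <=
    eta * (n%:R * beta / w%:R + 2 * beta + n%:R * gamma).
Proof.
move=> w0 b0 g0 e0 Aw Bb Bg.
have wR : 0 < w%:R :> R by rewrite ltr0n.
pose At k := w%:R^-1 *: \sum_(0 <= j < w) A (k + j)%N.
pose Rk k := A k - At k.
have Rk_le k : (k <= n)%N -> `|Rk k| <= eta.
  move=> kn; have -> : Rk k = - (w%:R^-1 *: \sum_(0 <= j < w) (A (k + j)%N - A k)).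
    rewrite /Rk sumrB scalerBr sumr_const_nat subn0 -[A k *+ w]scaler_nat scalerA.
    by rewrite mulVf ?gt_eqF// scale1r opprB.
  rewrite normrN normrZ ger0_norm ?invr_ge0// mulrC ler_pdivrMr// mulrC.
  by apply: norm_sum_le => j jw; exact: Aw (ltnW jw).
have At_step k : (k <= n)%N -> `|At k.+1 - At k| <= eta / w%:R.
  move=> kn; have -> : At k.+1 - At k = w%:R^-1 *: (A (k + w)%N - A k).
    rewrite /At -scalerBr; congr (_ *: _).
    under eq_bigr do rewrite addSnnS.
    have -> : \sum_(0 <= i < w) A (k + i.+1)%N = \sum_(1 <= i < w.+1) A (k + i)%N.
      by rewrite big_add1.
    have E1 : \sum_(0 <= i < w.+1) A (k + i)%N =
        A (k + 0)%N + \sum_(1 <= i < w.+1) A (k + i)%N by rewrite big_ltn.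
    have E2 : \sum_(0 <= i < w.+1) A (k + i)%N =
        \sum_(0 <= i < w) A (k + i)%N + A (k + w)%N by rewrite big_nat_recr.
    rewrite E2 addn0 in E1; apply/eqP.
    by rewrite subr_eq addrAC (addrC (A (k + w)%N)) E1 addrAC subrr add0r.
  rewrite normrZ ger0_norm ?invr_ge0// mulrC ler_wpM2r ?invr_ge0//.
  exact: Aw.
have -> : \sum_(0 <= k < n) B k *: (A k.+1 - A k) =
    \sum_(0 <= k < n) B k *: (At k.+1 - At k) +
    \sum_(0 <= k < n) B k *: (Rk k.+1 - Rk k).
  rewrite -big_split/=; apply: eq_bigr => k _; rewrite -scalerDr /Rk.
  by congr (_ *: _); rewrite opprB [A k.+1 - _ + _]addrC addrA subrKA [RHS]addrC subrKA.
rewrite (le_trans (ler_normD _ _))//.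
have h1 : `|\sum_(0 <= k < n) B k *: (At k.+1 - At k)| <=
    n%:R * (beta * (eta / w%:R)).
  apply: norm_sum_le => k kn; rewrite normrZ ler_pM//.
    by rewrite Bb// ltnW.
  by rewrite At_step// ltnW.
have h2 : `|\sum_(0 <= k < n) B k *: (Rk k.+1 - Rk k)| <=
    2 * beta * eta + n%:R * (gamma * eta).
  rewrite sum_by_parts (le_trans (ler_normB _ _))// lerD//.
    rewrite (le_trans (ler_normB _ _))// !normrZ.
    have b1 : `|B n| * `|Rk n| <= beta * eta by rewrite ler_pM ?Bb ?Rk_le.
    have b2 : `|B 0%N| * `|Rk 0%N| <= beta * eta by rewrite ler_pM ?Bb ?Rk_le.
    by rewrite -mulrA; lra.
  by apply: norm_sum_le => k kn; rewrite normrZ ler_pM ?Bg ?Rk_le.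
apply: (le_trans (lerD h1 h2)); rewrite le_eqVlt; apply/orP; left; apply/eqP.
by field; rewrite gt_eqF.
Qed.

End summation_by_parts.

Section flow_integrals.
Context (R : realType) dM (M : measurableType dM) (d : nat).
Variables (T : M -> M) (tau : M -> R) (tm tM : R).
Hypotheses (mT : measurable_fun setT T) (mtau : measurable_fun setT tau)
  (tm0 : 0 < tm) (tau_ge : forall y, tm <= tau y) (tau_le : forall y, tau y <= tM).
Local Notation D := (suspension_space tau).
Variables (f : R -> M * R -> 'rV[R]_d) (K L : R).
Hypotheses (f_meas : forall i, measurable_fun ([set: R] `*` D)
     (fun q : R * (M * R) => f q.1 q.2 0 i))
  (K0 : 0 <= K) (L0 : 0 <= L)
  (fK : forall y p, D p -> `|f y p| <= K)
  (fL : forall y y' p, D p -> `|f y p - f y' p| <= L * `|y - y'|).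
Local Notation t_ := (return_time T tau).
Local Notation count := (return_count T tau).
Local Notation flow := (suspension_flow T tau).
Local Notation F := (roof_integral tau f).

Hypothesis tM0 : 0 <= tM.

Lemma flow_slice_measurable (eps : R) p : D p ->
  coord_measurable `[0, +oo[ (fun s => f (eps * s) (flow s p)).
Proof.
move=> Dp i.
apply: (@measurable_comp _ _ _ R ((M * R) * R)%type R
  [set q : (M * R) * R | D q.1 /\ 0 <= q.2]
  (fun q : (M * R) * R => f (eps * q.2) (flow q.2 q.1) 0 i)
  `[0, +oo[%classic (fun s => (p, s))) => //.
- apply: measurableI.
    rewrite -[X in measurable X]setTI; apply: measurable_fst => //.
    exact: measurable_suspension_space.
  have := @measurable_snd _ _ (M * R)%type R.
  move=> /(_ measurableT `[0, +oo[%classic (measurable_itv _)); rewrite setTI.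
  by congr measurable; apply/seteqP; split=> q /=; rewrite in_itv/= andbT.
- by move=> _ [s + <-]; rewrite /= in_itv/= andbT.
- exact: (measurable_flow_integrand mT mtau tm0 tau_ge f_meas).
- by apply: measurable_funTS; apply: measurable_fun_pair; [exact: measurable_cst|exact: measurable_id].
Qed.

Lemma roof_slice_measurable (y : R) (w : M) :
  coord_measurable `[0, tau w[ (fun s => f y (w, s)).
Proof.
move=> i.
apply: (@measurable_comp _ _ _ R (R * (M * R))%type R ([set: R] `*` D)
  (fun q : R * (M * R) => f q.1 q.2 0 i)
  `[0, tau w[%classic (fun s => (y, (w, s)))) => //.
- by apply: measurableX => //; exact: measurable_suspension_space.
- by move=> _ [s + <-]; rewrite /= in_itv/= => /andP[? ?].
- by apply: measurable_funTS; apply: measurable_fun_pair; [exact: measurable_cst|exact: pair1_measurable].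
Qed.

Let flowK (eps s : R) p : D p -> 0 <= s -> `|f (eps * s) (flow s p)| <= K.
Proof. by move=> Dp s0; apply: fK; exact: (suspension_flow_in T tm0 tau_ge s0 Dp). Qed.

(** Between two consecutive returns the flow climbs a fibre, during a time at
most [tM] in which the slow variable moves by at most [eps * tM]. *)
Lemma flow_integral_sum (eps : R) (y : M) (n : nat) : 0 <= eps ->
  `|vintegral `[0, t_ n y[ (fun s => f (eps * s) (flow s (y, 0)))
    - \sum_(0 <= k < n) F (eps * t_ k y) (iter k T y)|
  <= n%:R * (L * eps * tM ^+ 2).
Proof.
move=> eps0; set h := fun s => f (eps * s) _.
have Dy := suspension_space_base tm0 tau_ge y.
have mh : coord_measurable `[0, +oo[ h := flow_slice_measurable eps Dy.
have hK s : 0 <= s -> `|h s| <= K by exact: flowK.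
have t0 k : 0 <= t_ k y.
  by rewrite (le_trans _ (return_time_ge T tau_ge k y))// mulr_ge0// ltW.
elim: n => [|n IH].
  rewrite big_geq// return_time0 subr0 mul0r.
  have mh0 : coord_measurable `[0, 0[ h.
    by apply: coord_measurableS mh => //; exact: subset_co_ray.
  have := vintegral_co_norm (lexx 0) K0 mh0.
  rewrite subr0 mulr0; apply=> s /andP[s0 _]; exact: hK.
have tau0 : 0 <= tau (iter n T y) by rewrite (le_trans (ltW tm0)).
have tS : t_ n y <= t_ n.+1 y by rewrite return_timeS lerDl.
rewrite (@vintegral_co_split _ _ 0 (t_ n y) (t_ n.+1 y) h K)//; last 2 first.
- by apply: coord_measurableS mh => //; exact: subset_co_ray.
- by move=> s /andP[s0 _]; exact: hK.
rewrite big_nat_recr//= opprD addrACA (le_trans (ler_normD _ _))//.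
rewrite -[in leRHS]natr1 mulrDl lerD// mul1r.
have mhn : coord_measurable `[t_ n y, t_ n.+1 y[ h.
  by apply: coord_measurableS mh => //; exact: subset_co_ray.
have -> : vintegral `[t_ n y, t_ n.+1 y[ h =
    vintegral `[0, tau (iter n T y)[ (fun s => f (eps * (s + t_ n y)) (iter n T y, s)).
  have := @vintegral_co_shift _ _ 0 (tau (iter n T y)) (t_ n y) h.
  rewrite add0r (addrC (tau _)) -return_timeS => /(_ mhn) <-.
  apply: eq_vintegral_co => s /andP[s0 st]; rewrite /h.
  rewrite (@suspension_flow_fiber _ _ _ _ _ _ tm0 tau_ge n); last 2 first.
  - by rewrite lerDr.
  - by rewrite return_timeS addrC ltrD2l.
  by rewrite addrK.
apply: (@le_trans _ _ ((L * eps * tM) * (tau (iter n T y) - 0))); last first.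
  rewrite subr0 expr2 mulrA ler_wpM2l//.
  by apply: mulr_ge0 => //; exact: mulr_ge0.
apply: (@vintegral_co_close _ _ _ _ _ _ K) => //.
- by rewrite !mulr_ge0.
- move=> i.
  apply: (@measurable_comp _ _ _ R (R * (M * R))%type R ([set: R] `*` D)
    (fun q : R * (M * R) => f q.1 q.2 0 i)
    `[0, tau (iter n T y)[%classic (fun s => (eps * (s + t_ n y), (iter n T y, s)))) => //.
  + by apply: measurableX => //; exact: measurable_suspension_space.
  + by move=> _ [s + <-]; rewrite /= in_itv/= => /andP[? ?].
  + apply: measurable_funTS; apply: measurable_fun_pair.
      by apply: measurable_funM => //; exact: measurable_funD.
    exact: pair1_measurable.
- exact: roof_slice_measurable.
- by move=> s /andP[? ?]; exact: fK.
- by move=> s /andP[? ?]; exact: fK.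
- move=> s /andP[s0 st]; rewrite (le_trans (fL _ _ _))//.
  rewrite -mulrA ler_wpM2l// -mulrBr addrK normrM !ger0_norm// ler_wpM2l//.
  by rewrite (le_trans (ltW st)).
Qed.

End flow_integrals.

(** * The averaging estimate along one orbit *)

Section averaging_estimate.
Context (R : realType) dM (M : measurableType dM) (d : nat).
Variables (T : M -> M) (tau : M -> R) (tm tM taubar : R).
Hypotheses (mT : measurable_fun setT T) (mtau : measurable_fun setT tau)
  (tm0 : 0 < tm) (tau_ge : forall y, tm <= tau y) (tau_le : forall y, tau y <= tM)
  (tM0 : 0 <= tM) (taubar0 : 0 < taubar).
Local Notation D := (suspension_space tau).
Variables (f : R -> M * R -> 'rV[R]_d) (K L K0 K1 K2 : R).
Hypotheses (f_meas : forall i, measurable_fun ([set: R] `*` D)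
     (fun q : R * (M * R) => f q.1 q.2 0 i))
  (K_ge0 : 0 <= K) (L_ge0 : 0 <= L)
  (fK : forall y p, D p -> `|f y p| <= K)
  (fL : forall y y' p, D p -> `|f y p - f y' p| <= L * `|y - y'|).
Local Notation t_ := (return_time T tau).
Local Notation count := (return_count T tau).
Local Notation flow := (suspension_flow T tau).
Local Notation F := (roof_integral tau f).
Hypotheses (dF : twice_differentiable1 F) (FK0 : forall y w, `|F y w| <= K0)
  (FK1 : forall y w, `|D1 F y w| <= K1) (FK2 : forall y w, `|D1 (D1 F) y w| <= K2).
Variable a : R -> R.

(** The integrand does not depend on the slow variable, so this is
[slow_integral_sum] with Lipschitz constant [0]. *)
Lemma roof_process_grid (eps : R) y (k : nat) : 0 < eps ->
  roof_process T tau taubar a eps y (eps * k%:R) =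
  Num.sqrt (eps * a eps) * (t_ k y - k%:R * taubar).
Proof.
move=> eps0; rewrite /roof_process mulrAC divff ?gt_eqF// mul1r; congr (_ * _).
pose G (z : R) w : 'rV[R]_1 := \row__ (tau w - taubar).
have mG i : measurable_fun setT (fun q : R * M => G q.1 q.2 0 i).
  rewrite (_ : (fun q : R * M => _) = (fun q => tau q.2 - taubar)).
    apply: measurable_funB; last exact: measurable_cst.
    exact: (measurableT_comp mtau measurable_snd).
  by apply/funext => q; rewrite mxE.
have B0 : 0 <= tM + taubar by rewrite addr_ge0// ltW.
have GB (z : R) w : `|G z w| <= tM + taubar.
  apply/row_norm_leP => // i; rewrite mxE.
  have := tau_le w; have := lt_le_trans tm0 (tau_ge w).
  by rewrite ler_norml; have := tM0; have := taubar0; lra.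
have GL (z z' : R) w : `|G z w - G z' w| <= 0 * `|z - z'|.
  by rewrite mul0r (_ : G z w = G z' w)// subrr normr0.
have := slow_integral_sum mT mG GB B0 (lexx 0) GL 1 y k.
rewrite mul0r mulr0 normr_le0 subr_eq0 => /eqP/rowP/(_ 0).
rewrite /vintegral !mxE => E; rewrite -[LHS](_ : \int[lebesgue_measure]_(s in
  `[0, k%:R]) (G (1 * s) (iter (Num.truncn s) T y)) 0 0 = _); last first.
  by apply: eq_Rintegral => s _; rewrite mxE.
rewrite E summxE (eq_bigr (fun j => tau (iter j T y) - taubar)); last first.
  by move=> j _; rewrite mxE.
by rewrite sumrB sumr_const_nat subn0 /return_time mulr_natl.
Qed.

Section one_path.
Variables (eps S S' theta delta eta rho delta' : R) (y : M).
Hypotheses (eps0 : 0 < eps) (a0 : 0 < a eps) (S0 : 0 < S)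
  (SS' : S / tm + 1 <= S') (SS'2 : S / taubar <= S')
  (theta0 : 0 <= theta) (eps_delta : eps <= delta) (delta1 : delta <= 1)
  (eta0 : 0 <= eta).
Hypothesis roof_small : forall k : nat, eps * k%:R <= S' ->
  `|roof_process T tau taubar a eps y (eps * k%:R)| <= theta.
Hypothesis derivative_osc : forall s s' : R, 0 <= s <= S' -> 0 <= s' <= S' ->
  `|s - s'| <= delta ->
  `|slow_process T taubar a (D1 F) eps y s - slow_process T taubar a (D1 F) eps y s'|
     <= eta.
Hypothesis slow_osc : forall s s' : R, 0 <= s <= S' -> 0 <= s' <= S' ->
  `|s - s'| <= delta' ->
  `|slow_process T taubar a F eps y s - slow_process T taubar a F eps y s'| <= rho.

(** A bound for [eps] times the deviation of the return times: the hypothesis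
[roof_small] controls it with the factor [sqrt (eps * a eps)]. *)
Local Notation beta := (Num.sqrt (eps / a eps) * theta).
Hypothesis delta'_large : (eps * tM + beta) / taubar <= delta'.
Local Notation X k := (iter k T y).
Local Notation c := (taubar * eps).
Let B (k : nat) : R := eps * t_ k y - c * k%:R.
(** The derivative process at time [eps * k], up to a term of order [a eps]. *)
Let A (k : nat) : 'rV[R]_d := a eps *: \sum_(0 <= j < k) D1 F (c * j%:R) (X j).

Let K1_ge0 : 0 <= K1. Proof. by rewrite (le_trans _ (FK1 0 y)). Qed.
Let K2_ge0 : 0 <= K2. Proof. by rewrite (le_trans _ (FK2 0 y)). Qed.
Let K0_ge0 : 0 <= K0. Proof. by rewrite (le_trans _ (FK0 0 y)). Qed.
Let beta_ge0 : 0 <= beta. Proof. by rewrite mulr_ge0 ?sqrtr_ge0. Qed.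
Let c0 : 0 < c. Proof. exact: mulr_gt0. Qed.

Let dF1 w z : derivable (fun x => F x w) z 1.
Proof. by have [] := dF w z. Qed.

Let dF2 w z : derivable (fun x => D1 F x w) z 1.
Proof. by have [] := dF w z. Qed.

Let mF i : measurable_fun setT (fun q : R * M => F q.1 q.2 0 i).
Proof. exact: (measurable_roof_integral mtau f_meas). Qed.

Let mD1F i : measurable_fun setT (fun q : R * M => D1 F q.1 q.2 0 i).
Proof. exact: measurable_D1. Qed.

Let FL x z w : `|F x w - F z w| <= K1 * `|x - z|.
Proof. by apply: (row_mean_value (G := fun x => F x w)) => // u; exact: FK1. Qed.

Let D1FL x z w : `|D1 F x w - D1 F z w| <= K2 * `|x - z|.
Proof. by apply: (row_mean_value (G := fun x => D1 F x w)) => // u; exact: FK2. Qed.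

Let B_le k : eps * k%:R <= S' -> `|B k| <= beta.
Proof.
move=> /roof_small; rewrite roof_process_grid// normrM (ger0_norm (sqrtr_ge0 _)).
move=> h; have -> : B k = eps * (t_ k y - k%:R * taubar) by rewrite /B; ring.
rewrite normrM (ger0_norm (ltW eps0)).
have {1}-> : eps = Num.sqrt (eps / a eps) * Num.sqrt (eps * a eps).
  rewrite -sqrtrM ?divr_ge0// ?ltW// (_ : eps / a eps * (eps * a eps) = eps ^+ 2).
    by rewrite sqrtr_sqr ger0_norm// ltW.
  by field; rewrite gt_eqF.
by rewrite -mulrA ler_wpM2l ?sqrtr_ge0.
Qed.

Let B_sqr k : eps * k%:R <= S' -> a eps * `|B k| ^+ 2 <= eps * theta ^+ 2.
Proof.
move=> /roof_small; rewrite roof_process_grid// normrM (ger0_norm (sqrtr_ge0 _)).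
have -> : B k = eps * (t_ k y - k%:R * taubar) by rewrite /B; ring.
move: (_ - _) => e h.
have : (Num.sqrt (eps * a eps) * `|e|) ^+ 2 <= theta ^+ 2.
  by rewrite lerXn2r ?nnegrE ?mulr_ge0 ?sqrtr_ge0.
rewrite exprMn sqr_sqrtr ?mulr_ge0 ?(ltW eps0) ?(ltW a0)// => h2.
rewrite normrM (ger0_norm (ltW eps0)) exprMn.
have -> : a eps * (eps ^+ 2 * `|e| ^+ 2) = eps * (eps * a eps * `|e| ^+ 2) by ring.
by rewrite ler_wpM2l// ltW.
Qed.

Let B_step k : `|B k.+1 - B k| <= eps * (tM + taubar).
Proof.
have -> : B k.+1 - B k = eps * (tau (X k) - taubar).
  by rewrite /B return_timeS -natr1; ring.
rewrite normrM (ger0_norm (ltW eps0)) ler_wpM2l ?(ltW eps0)//.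
have := tau_le (X k); have := lt_le_trans tm0 (tau_ge (X k)).
by rewrite ler_norml; have := tM0; have := taubar0; lra.
Qed.

Let slow_grid (G : R -> M -> 'rV[R]_d) (C : R) m :
  (forall i, measurable_fun setT (fun q : R * M => G q.1 q.2 0 i)) ->
  (exists C' : R, 0 <= C' /\ forall y w, `|G y w| <= C') -> 0 <= C ->
  (forall x z w, `|G x w - G z w| <= C * `|x - z|) -> eps * m%:R <= S' ->
  `|slow_process T taubar a G eps y (eps * m%:R) -
    a eps *: \sum_(0 <= j < m) G (c * j%:R) (X j)| <=
  a eps * (eps * m%:R) * (C * taubar).
Proof.
move=> mG [C' [C'0 GC']] C0 GC mS.
rewrite /slow_process mulrAC divff ?gt_eqF// mul1r -scalerBr normrZ gtr0_norm//.
have := slow_integral_sum mT mG GC' C'0 C0 GC c y m.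
rewrite (gtr0_norm c0) => h.
have -> : a eps * (eps * m%:R) * (C * taubar) = a eps * (m%:R * (C * c)) by ring.
by rewrite ler_wpM2l// ltW.
Qed.

Let A_osc k j : eps * (k + j)%:R <= S' -> eps * j%:R <= delta ->
  `|A (k + j)%N - A k| <= eta + 2 * (a eps * S' * (K2 * taubar)).
Proof.
move=> kjS jd.
have kS : eps * k%:R <= S'.
  by rewrite (le_trans _ kjS)// ler_wpM2l ?(ltW eps0)// ler_nat leq_addr.
have D1K : exists C' : R, 0 <= C' /\ forall y w, `|D1 F y w| <= C' by exists K1.
have h1 := slow_grid mD1F D1K K2_ge0 D1FL kjS.
have h2 := slow_grid mD1F D1K K2_ge0 D1FL kS.
have sg m : eps * m%:R <= S' -> a eps * (eps * m%:R) * (K2 * taubar) <=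
    a eps * S' * (K2 * taubar).
  move=> mS; rewrite ler_wpM2r ?mulr_ge0 ?(ltW taubar0)//.
  by rewrite ler_wpM2l// ltW.
have := derivative_osc (s := eps * (k + j)%:R) (s' := eps * k%:R).
rewrite kjS kS !mulr_ge0 ?(ltW eps0)// => /(_ isT isT).
rewrite -mulrBr natrD addrAC subrr add0r ger0_norm ?mulr_ge0 ?(ltW eps0)//.
rewrite -natrD => /(_ jd) h3.
rewrite /A; set p := slow_process _ _ _ _ _ _ _ in h1 h3.
set q := slow_process _ _ _ _ _ _ _ in h2 h3.
apply: (le_trans (ler_distD p _ _)); rewrite distrC.
apply: (le_trans (lerD h1 (le_trans (ler_distD q _ _) (lerD h3 h2)))).
by rewrite addrCA lerD2l mulr_natl mulr2n lerD ?sg.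
Qed.

Let n t := count (t / eps) y.

Let n_le t : 0 <= t <= S -> eps * (n t)%:R <= S / tm.
Proof.
move=> /andP[t0 tS]; have te : 0 <= t / eps by rewrite divr_ge0// ltW.
have := return_count_le T tm0 tau_ge y te; rewrite -/(n t) => h.
rewrite ler_pdivlMr// -mulrA mulrC.
have : (n t)%:R * tm <= t / eps by rewrite -ler_pdivlMr.
by rewrite ler_pdivlMr// => /le_trans; apply.
Qed.

Let flow_part t : 0 <= t <= S ->
  `|flow_process T tau a f eps (y, 0) t -
     a eps *: \sum_(0 <= k < n t) F (eps * t_ k y) (X k)| <=
  a eps * (K * tM) + a eps * (S / tm * (L * tM ^+ 2)).
Proof.
move=> tS; have /andP[t0 _] := tS.
have te : 0 <= t / eps by rewrite divr_ge0// ltW.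
have Dy := suspension_space_base tm0 tau_ge y.
have /andP[tn nt] := return_countP T tm0 tau_ge y te.
rewrite -/(n t) in tn nt.
have mh := flow_slice_measurable mT mtau tm0 tau_ge f_meas eps Dy.
have hK s : 0 <= s -> `|f (eps * s) (flow s (y, 0))| <= K.
  by move=> s0; apply: fK; exact: (suspension_flow_in T tm0 tau_ge s0 Dy).
have tn0 : 0 <= t_ (n t) y.
  by rewrite (le_trans _ (return_time_ge T tau_ge (n t) y))// mulr_ge0// ltW.
rewrite /flow_process (primitive_co mh hK).
rewrite (vintegral_co_split tn0 tn (K := K)); last 2 first.
- by apply: coord_measurableS mh => //; exact: subset_co_ray.
- by move=> s /andP[s0 _]; exact: hK.
rewrite -scalerBr normrZ (gtr0_norm a0) -mulrDr ler_wpM2l ?(ltW a0)//.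
rewrite addrAC addrC (le_trans (ler_normD _ _))// lerD//.
  apply: (@le_trans _ _ (K * (t / eps - t_ (n t) y))).
    apply: vintegral_co_norm => //.
      by apply: coord_measurableS mh => //; exact: subset_co_ray.
    by move=> s /andP[s0 _]; apply: hK; exact: le_trans s0.
  rewrite ler_wpM2l// lerBlDl (le_trans (ltW nt))// return_timeS lerD2l.
  exact: tau_le.
apply: (le_trans (flow_integral_sum mT mtau tm0 tau_ge tau_le f_meas K_ge0 L_ge0
  fK fL tM0 y (n t) (ltW eps0))).
have := n_le tS => h.
have -> : (n t)%:R * (L * eps * tM ^+ 2) = eps * (n t)%:R * (L * tM ^+ 2) by ring.
by rewrite ler_wpM2r// mulr_ge0// sqr_ge0.
Qed.

Let taylor_part t : 0 <= t <= S ->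
  `|a eps *: \sum_(0 <= k < n t) F (eps * t_ k y) (X k) -
    a eps *: \sum_(0 <= k < n t) F (c * k%:R) (X k) -
    \sum_(0 <= k < n t) B k *: (A k.+1 - A k)| <= S / tm * (K2 * theta ^+ 2).
Proof.
move=> tS; have nS := n_le tS.
have -> : \sum_(0 <= k < n t) B k *: (A k.+1 - A k) =
    a eps *: \sum_(0 <= k < n t) B k *: D1 F (c * k%:R) (X k).
  rewrite scaler_sumr; apply: eq_bigr => k _.
  rewrite /A -scalerBr big_nat_recr//= addrAC subrr add0r !scalerA.
  by rewrite mulrC.
rewrite -!scalerBr -!sumrB normrZ (gtr0_norm a0).
apply: (@le_trans _ _ (a eps * ((n t)%:R * (K2 * (eps * theta ^+ 2 / a eps))))).
  rewrite ler_wpM2l ?(ltW a0)//; apply: norm_sum_le => k kn.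
  have kS : eps * k%:R <= S'.
    apply: (@le_trans _ _ (eps * (n t)%:R)).
      by rewrite ler_wpM2l ?(ltW eps0)// ler_nat ltnW.
    by rewrite (le_trans nS)// (le_trans _ SS')// lerDl.
  have h := @row_taylor1 _ _ (fun x => F x (X k)) K2 (@dF1 (X k)) (@dF2 (X k))
    (fun u => FK2 u (X k)) (eps * t_ k y) (c * k%:R).
  apply: (le_trans h).
  by rewrite ler_wpM2l// ler_pdivlMr// mulrC B_sqr.
have -> : a eps * ((n t)%:R * (K2 * (eps * theta ^+ 2 / a eps))) =
   eps * (n t)%:R * (K2 * theta ^+ 2) by field; rewrite gt_eqF.
by rewrite ler_wpM2r// mulr_ge0// sqr_ge0.
Qed.

(** The window [w] of the smoothing has length about [delta] in macroscopic
time, so that [w] is of order [delta / eps] while the number of terms is at most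
[S / (tm * eps)]. *)
Let abel_part t : 0 <= t <= S ->
  `|\sum_(0 <= k < n t) B k *: (A k.+1 - A k)| <=
  (eta + 2 * (a eps * S' * (K2 * taubar))) *
   (2 * (S / tm) * beta / delta + 2 * beta + S / tm * (tM + taubar)).
Proof.
move=> tS; have nS := n_le tS.
have delta0 : 0 < delta by exact: lt_le_trans eps_delta.
have S'0 : 0 <= S'.
  by rewrite (le_trans _ SS')// addr_ge0// divr_ge0// ltW.
pose w := Num.truncn (delta / eps).
have /andP[w1 w2] := truncn_itv (divr_ge0 (ltW delta0) (ltW eps0)).
rewrite -/w in w1 w2.
have w0 : (0 < w)%N.
  rewrite lt0n; apply: contraTneq w2 => ->.
  by rewrite -leNgt ler_pdivlMr// mul1r.
have ewd : eps * w%:R <= delta by rewrite mulrC -ler_pdivlMr.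
have eta1 : 0 <= eta + 2 * (a eps * S' * (K2 * taubar)).
  by rewrite addr_ge0// !mulr_ge0// ltW.
have gamma0 : 0 <= eps * (tM + taubar).
  by apply: mulr_ge0; [exact: ltW|apply: addr_ge0 => //; exact: ltW].
apply: (le_trans (smoothed_sum_le w0 beta_ge0 gamma0 eta1 _ _ _)).
- move=> k j kn jw; apply: A_osc.
    rewrite natrD mulrDr (le_trans _ SS')// lerD//.
      by rewrite (le_trans _ nS)// ler_wpM2l ?(ltW eps0)// ler_nat.
    rewrite (le_trans _ delta1)// (le_trans _ ewd)//.
    by rewrite ler_wpM2l ?(ltW eps0)// ler_nat.
  by rewrite (le_trans _ ewd)// ler_wpM2l ?(ltW eps0)// ler_nat.
- move=> k kn; apply: B_le; rewrite (le_trans _ SS')//.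
  rewrite (@le_trans _ _ (eps * (n t)%:R))//.
    by rewrite ler_wpM2l ?(ltW eps0)// ler_nat.
  by rewrite (le_trans nS)// lerDl.
- by move=> k _; exact: B_step.
rewrite ler_wpM2l// lerD//; last first.
  by rewrite mulrA (mulrC _ eps) ler_wpM2r// addr_ge0// ltW.
rewrite lerD// mulrAC [leRHS]mulrAC ler_wpM2r//.
have wR : 0 < w%:R :> R by rewrite ltr0n.
rewrite ler_pdivlMr// mulrAC ler_pdivrMr//.
have dw : delta <= eps * (2 * w%:R).
  rewrite mulrC -ler_pdivrMr// (le_trans (ltW w2))// -natr1.
  have : 1 <= w%:R :> R by rewrite ler1n.
  lra.
have nS0 : 0 <= (n t)%:R :> R by [].
apply: (@le_trans _ _ ((n t)%:R * (eps * (2 * w%:R)))).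
  by rewrite ler_wpM2l.
have -> : (n t)%:R * (eps * (2 * w%:R)) = eps * (n t)%:R * (2 * w%:R) by ring.
have -> : 2 * (S / tm) * w%:R = S / tm * (2 * w%:R) by ring.
by rewrite ler_wpM2r// mulr_ge0.
Qed.

Let slow_part t : 0 <= t <= S ->
  `|a eps *: \sum_(0 <= k < n t) F (c * k%:R) (X k) -
    slow_process T taubar a F eps y (t / taubar)| <=
  a eps * (S / tm) * (K1 * taubar) + rho.
Proof.
move=> tS; have nS := n_le tS; have /andP[t0 tS1] := tS.
have nS' : eps * (n t)%:R <= S' by rewrite (le_trans nS)// (le_trans _ SS')// lerDl.
have FK : exists C' : R, 0 <= C' /\ forall y w, `|F y w| <= C' by exists K0.
have h1 := slow_grid mF FK K1_ge0 FL nS'.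
rewrite (le_trans (ler_distD (slow_process T taubar a F eps y (eps * (n t)%:R)) _ _))//.
rewrite lerD//.
  rewrite distrC (le_trans h1)// ler_wpM2r ?mulr_ge0 ?(ltW taubar0)//.
  by rewrite ler_wpM2l// ltW.
apply: slow_osc.
- by rewrite nS' mulr_ge0// ltW.
- rewrite divr_ge0 ?(ltW taubar0)//= (le_trans _ SS'2)//.
  by rewrite ler_wpM2r ?invr_ge0// ltW.
have te : 0 <= t / eps by rewrite divr_ge0// ltW.
have /andP[tn nt] := return_countP T tm0 tau_ge y te.
rewrite -/(n t) in tn nt.
rewrite (le_trans _ delta'_large)//.
have -> : eps * (n t)%:R - t / taubar = (- (t - eps * t_ (n t) y) - B (n t)) / taubar.
  by rewrite /B; field; rewrite gt_eqF.
rewrite normrM [`|taubar^-1|]gtr0_norm ?invr_gt0// ler_wpM2r ?invr_ge0 ?(ltW taubar0)//.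
rewrite (le_trans (ler_normB _ _))// normrN lerD//; last exact: B_le.
have te1 : eps * t_ (n t) y <= t by rewrite mulrC -ler_pdivlMr.
rewrite ger0_norm ?subr_ge0// lerBlDl -mulrDr mulrC -ler_pdivrMr//.
rewrite (le_trans (ltW nt))// return_timeS lerD2l; exact: tau_le.
Qed.

(** Up to boundary terms, the ergodic integral of the flow is the sum of the
integrals [F] over the fibres visited, taken at the return times. Replacing
the return times by their averages in [F] costs, by the formula of Taylor, a
second-order term controlled by [theta ^+ 2] and a first-order term that pairs
the increments of the derivative process with the deviations of the return
times; [smoothed_sum_le] shows that the latter is small because the derivative
process oscillates little and the deviations are small and have small
increments. *)
Lemma flow_slow_close :
  path_close S
    (a eps * (K * tM + S / tm * (L * tM ^+ 2) + S / tm * (K1 * taubar)) +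
     S / tm * (K2 * theta ^+ 2) +
     (eta + 2 * (a eps * S' * (K2 * taubar))) *
      (2 * (S / tm) * beta / delta + 2 * beta + S / tm * (tM + taubar)) + rho)
    (flow_process T tau a f eps (y, 0))
    (fun t => slow_process T taubar a F eps y (t / taubar)).
Proof.
move=> t tS; have h1 := flow_part tS; have h2 := taylor_part tS.
have h3 := abel_part tS; have h4 := slow_part tS.
set p1 := flow_process _ _ _ _ _ _ _ in h1 *.
set p2 := _ *: _ in h1 h2; set p3 := _ *: _ in h2 h4.
set p4 := slow_process _ _ _ _ _ _ _ in h4 *.
set q := \sum_(_ <= _ < _) _ in h2 h3.
have h5 := ler_distD p2 p1 p4; have h6 := ler_distD p3 p2 p4.
have h7 : `|p2 - p3| <= `|p2 - p3 - q| + `|q|.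
  by rewrite -{1}(subrK q (p2 - p3)) ler_normD.
apply: (le_trans h5); apply: (le_trans (lerD h1 (le_trans h6 (lerD (le_trans h7 (lerD h2 h3)) h4)))).
by rewrite le_eqVlt; apply/orP; left; apply/eqP; ring.
Qed.

End one_path.
End averaging_estimate.

(** * The processes are random continuous paths *)

Section random_row_paths.
Context (R : realType) dO (Om : measurableType dO).

Lemma random_path_row (d : nat) (D : set Om) (S : R) (X : Om -> R -> 'rV[R]_d) :
  0 < S -> measurable D ->
  (forall (t : R) i, 0 <= t <= S -> measurable_fun D (fun w => X w t 0 i)) ->
  (forall w, D w -> @Cpath R 'rV[R]_d S (X w)) -> random_path D S X.
Proof.
move=> S0 mD mX XC; split=> // U oU.
apply: (@measurable_path_open R _ _ Om d (fun i (x : 'rV[R]_d) => x 0 i)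
  (fun x y r r0 => row_dist_leP x y r0) S S0 D X U) => //.
Qed.

Lemma random_path_real (D : set Om) (S : R) (X : Om -> R -> R) :
  0 < S -> measurable D ->
  (forall t : R, 0 <= t <= S -> measurable_fun D (fun w => X w t)) ->
  (forall w, D w -> @Cpath R R S (X w)) -> random_path D S X.
Proof.
move=> S0 mD mX XC; split=> // U oU.
apply: (@measurable_path_open R R _ Om 1 (fun _ x => x) _ S S0 D X U) => //.
  by move=> x y r r0; split=> // /(_ 0).
by move=> t i; exact: mX.
Qed.

End random_row_paths.

Section processes.
Context (R : realType) dM (M : measurableType dM).
Variables (T : M -> M) (tau : M -> R) (tm tM taubar : R).
Hypotheses (mT : measurable_fun setT T) (mtau : measurable_fun setT tau)
  (tm0 : 0 < tm) (tau_ge : forall y, tm <= tau y) (tau_le : forall y, tau y <= tM)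
  (tM0 : 0 <= tM) (taubar0 : 0 < taubar).
Variables (a : R -> R) (eps S : R).
Hypotheses (eps0 : 0 < eps) (a0 : 0 < a eps) (S0 : 0 < S).

Section slow.
Variables (d : nat) (G : R -> M -> 'rV[R]_d) (K : R).
Hypotheses (mG : forall i, measurable_fun setT (fun q : R * M => G q.1 q.2 0 i))
  (GK : forall y w, `|G y w| <= K).

Lemma slow_process_lipschitz w (s t : R) : 0 <= s -> s <= t ->
  `|slow_process T taubar a G eps w s - slow_process T taubar a G eps w t| <=
    a eps * K / eps * (t - s).
Proof.
move=> s0 st; rewrite -scalerBr normrZ (gtr0_norm a0) -!mulrA.
rewrite ler_wpM2l ?(ltW a0)//.
have K0 : 0 <= K by rewrite (le_trans _ (GK 0 w)).
apply: (le_trans (primitive_lipschitz K0 (slow_integrand_measurable mT mG _ w)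
  (fun s _ => GK _ _) _ _)).
- by rewrite divr_ge0// ltW.
- by rewrite ler_wpM2r// invr_ge0 ltW.
- by rewrite -mulrBl [eps^-1 * _]mulrC.
Qed.

Lemma random_path_slow : random_path setT S (slow_process T taubar a G eps).
Proof.
apply: random_path_row => // [t i tS|w _].
  rewrite (_ : (fun w => _) = fun w => a eps *
     \int[@lebesgue_measure R]_(s in `[0, t / eps])
     G (taubar * eps * s) (iter (Num.truncn s) T w) 0 i).
    apply: measurable_funM; first exact: measurable_cst.
    exact: (measurable_slow_integral mT (g := fun y w => G y w 0 i) (mG i)).
  by apply/funext => w; rewrite !mxE.
apply: (@lipschitz_Cpath _ _ _ (a eps * K / eps)) => s t /andP[s0 _] _ st.
exact: slow_process_lipschitz.
Qed.

End slow.

Lemma roof_process_measurable (t : R) :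
  measurable_fun setT (fun w => roof_process T tau taubar a eps w t).
Proof.
apply: measurable_funM; first exact: measurable_cst.
apply: (measurable_slow_integral mT (g := fun _ w => tau w - taubar) _ 1).
apply: measurable_funB; last exact: measurable_cst.
exact: (measurableT_comp mtau measurable_snd).
Qed.

Lemma roof_process_lipschitz w (s t : R) : 0 <= s -> s <= t ->
  `|roof_process T tau taubar a eps w s - roof_process T tau taubar a eps w t|
  <= Num.sqrt (eps * a eps) * (tM + taubar) / eps * (t - s).
Proof.
move=> s0 st; rewrite -mulrBr normrM (ger0_norm (sqrtr_ge0 _)) -!mulrA.
rewrite ler_wpM2l ?sqrtr_ge0//.
have seps : 0 <= s / eps by rewrite divr_ge0// ltW.
have steps : s / eps <= t / eps by rewrite ler_wpM2r// invr_ge0 ltW.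
have B0 : 0 <= tM + taubar by rewrite addr_ge0// ltW.
pose g (x : R) : 'rV[R]_1 := \row__ (tau (iter (Num.truncn x) T w) - taubar).
have mg : coord_measurable `[0, +oo[ g.
  move=> i; have mt : measurable_fun setT (fun q : R * M => tau q.2 - taubar).
    apply: measurable_funB; last exact: measurable_cst.
    exact: (measurableT_comp mtau measurable_snd).
  have := measurable_slow_slice mT (g := fun _ w => tau w - taubar) mt 1 w.
  by apply: eq_measurable_fun => x _; rewrite mxE.
have gB x : `|g x| <= tM + taubar.
  apply/row_norm_leP => // i; rewrite mxE.
  have := tau_le (iter (Num.truncn x) T w).
  have := lt_le_trans tm0 (tau_ge (iter (Num.truncn x) T w)).
  by rewrite ler_norml; have := tM0; have := taubar0; lra.
have E r : \int[@lebesgue_measure R]_(x in `[0, r])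
    (tau (iter (Num.truncn x) T w) - taubar) = vintegral `[0, r] g 0 0.
  by rewrite mxE; apply: eq_Rintegral => x _; rewrite mxE.
rewrite !E.
have := primitive_lipschitz B0 mg (fun s _ => gB s) seps steps.
move=> /row_dist_leP-/(_ _ 0) h; apply: le_trans (h _) _.
  by rewrite mulr_ge0// subr_ge0.
by rewrite -mulrBl [eps^-1 * _]mulrC.
Qed.

Lemma random_path_roof : random_path setT S (roof_process T tau taubar a eps).
Proof.
apply: random_path_real => // [t _|w _]; first exact: roof_process_measurable.
apply: (@lipschitz_Cpath _ R _ (Num.sqrt (eps * a eps) * (tM + taubar) / eps)).
move=> s t /andP[s0 _] _ st; exact: roof_process_lipschitz.
Qed.

Section flow.
Local Notation D := (suspension_space tau).
Variables (d : nat) (f : R -> M * R -> 'rV[R]_d) (K L : R).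
Hypotheses (f_meas : forall i, measurable_fun ([set: R] `*` D)
     (fun q : R * (M * R) => f q.1 q.2 0 i))
  (K_ge0 : 0 <= K) (L_ge0 : 0 <= L)
  (fK : forall y p, D p -> `|f y p| <= K)
  (fL : forall y y' p, D p -> `|f y p - f y' p| <= L * `|y - y'|).

Lemma flow_process_lipschitz p (s t : R) : D p -> 0 <= s -> s <= t ->
  `|flow_process T tau a f eps p s - flow_process T tau a f eps p t| <=
    a eps * K / eps * (t - s).
Proof.
move=> Dp s0 st; rewrite -scalerBr normrZ (gtr0_norm a0) -!mulrA.
rewrite ler_wpM2l ?(ltW a0)//.
have mh := flow_slice_measurable mT mtau tm0 tau_ge f_meas eps Dp.
have hK x : 0 <= x -> `|f (eps * x) (suspension_flow T tau x p)| <= K.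
  by move=> x0; apply: fK; exact: (suspension_flow_in T tm0 tau_ge x0 Dp).
apply: (le_trans (primitive_lipschitz K_ge0 mh hK _ _)).
- by rewrite divr_ge0// ltW.
- by rewrite ler_wpM2r// invr_ge0 ltW.
- by rewrite -mulrBl [eps^-1 * _]mulrC.
Qed.

Lemma random_path_flow : random_path D S (flow_process T tau a f eps).
Proof.
apply: random_path_row => // [|t i tS|p Dp].
- exact: measurable_suspension_space.
- exact: (measurable_flow_process mT mtau tm0 tau_ge f_meas).
apply: (@lipschitz_Cpath _ _ _ (a eps * K / eps)) => s t /andP[s0 _] _ st.
exact: flow_process_lipschitz.
Qed.

Lemma random_path_flow_base :
  random_path setT S (fun y => flow_process T tau a f eps (y, 0)).
Proof.
apply: random_path_row => // [t i tS|y _].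
  have mf := measurable_flow_process mT mtau tm0 tau_ge f_meas a eps t i.
  apply: (@measurable_comp _ _ _ M (M * R)%type R D
    (fun p => flow_process T tau a f eps p t 0 i) setT (fun y => (y, 0))) => //.
  - exact: measurable_suspension_space.
  - by move=> _ [y _ <-]; exact: (suspension_space_base tm0 tau_ge).
have Dy := suspension_space_base tm0 tau_ge y.
apply: (@lipschitz_Cpath _ _ _ (a eps * K / eps)) => s t /andP[s0 _] _ st.
exact: flow_process_lipschitz.
Qed.

Let flow_shift_close p y (r : R) : D p -> 0 <= r -> r <= tM ->
  (forall s, 0 <= s ->
     suspension_flow T tau s p = suspension_flow T tau (s + r) (y, 0)) ->
  path_close S (a eps * ((L * S + 2 * K) * tM))
    (flow_process T tau a f eps p) (flow_process T tau a f eps (y, 0)).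
Proof.
move=> Dp r0 rtM pr t /andP[t0 tS].
have Dy := suspension_space_base tm0 tau_ge y.
have hK p' x : D p' -> 0 <= x -> `|f (eps * x) (suspension_flow T tau x p')| <= K.
  by move=> Dp' x0; apply: fK; exact: (suspension_flow_in T tm0 tau_ge x0 Dp').
rewrite -scalerBr normrZ (gtr0_norm a0) ler_wpM2l ?(ltW a0)//.
apply: (@le_trans _ _ (L * eps * r * (t / eps) + 2 * K * r)).
  apply: primitive_translate => //.
  - exact: (flow_slice_measurable mT mtau tm0 tau_ge f_meas).
  - by move=> x; exact: hK.
  - by rewrite divr_ge0// ltW.
  - by rewrite !mulr_ge0// ltW.
  - exact: (flow_slice_measurable mT mtau tm0 tau_ge f_meas).
  - by move=> x; exact: hK.
  - move=> x /andP[x0 _]; rewrite pr//.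
    apply: (le_trans (fL _ _ _)).
      by apply: (suspension_flow_in T tm0 tau_ge) => //; exact: addr_ge0.
    rewrite -!mulrA ler_wpM2l// mulrDr opprD addrA subrr add0r normrN.
    by rewrite normrM !ger0_norm// ltW.
have -> : L * eps * r * (t / eps) + 2 * K * r = (L * t + 2 * K) * r.
  by field; rewrite gt_eqF.
apply: ler_pM => //; first by rewrite addr_ge0 ?mulr_ge0.
by rewrite lerD2r ler_wpM2l.
Qed.

(** Moving along a fibre, or to the next fibre, shifts time by at most the
height of the roof; as the slow variable is Lipschitz, this moves the
renormalised integral by a multiple of [a eps]. *)
Lemma flow_process_height p : D p ->
  path_close S (a eps * ((L * S + 2 * K) * tM))
    (flow_process T tau a f eps p) (flow_process T tau a f eps (p.1, 0)).
Proof.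
case: p => y r [/= r0 rt]; apply: (@flow_shift_close _ _ r) => //.
  by rewrite (le_trans (ltW rt)).
by move=> s s0; rewrite suspension_flow_height.
Qed.

Lemma flow_process_base y :
  path_close S (a eps * ((L * S + 2 * K) * tM))
    (flow_process T tau a f eps (T y, 0)) (flow_process T tau a f eps (y, 0)).
Proof.
apply: (@flow_shift_close _ _ (tau y)) => //.
- exact: (suspension_space_base tm0 tau_ge).
- by rewrite (le_trans (ltW tm0)).
- by move=> s s0; rewrite (suspension_flow_base _ tm0 tau_ge).
Qed.

End flow.
End processes.

Section limit_process.
Context (R : realType) dO (Om : measurableType dO) (d : nat).

Lemma random_path_continuous_process (v : Om -> R -> 'rV[R]_d) (S c : R) :
  0 < S -> 0 < c -> continuous_process v ->
  random_path setT S (fun w t => v w (t / c)).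
Proof.
move=> S0 c0 [mv cv]; apply: random_path_row => // [t i /andP[t0 _]|w _].
  by apply: mv; rewrite divr_ge0// ltW.
apply/CpathP => t /andP[t0 tS] eta eta0.
have := cv w => /(@subspace_continuousP R (`[0, +oo[%classic : set R) _ (v w)).
have tc0 : 0 <= t / c by rewrite divr_ge0// ltW.
move=> /(_ (t / c)); rewrite /= in_itv/= andbT => /(_ tc0).
move=> /cvgrPdist_le/(_ eta eta0) /nbhs_ballP[e /= e0 He].
exists (e * c); first exact: mulr_gt0.
move=> s /andP[s0 sS] ts; apply: He.
  rewrite -ball_normE /= -mulrBl normrM [`|c^-1|]gtr0_norm ?invr_gt0//.
  by rewrite ltr_pdivrMr.
by rewrite in_itv/= andbT divr_ge0// ltW.
Qed.

End limit_process.

(** * Oscillations in probability *)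

Section markov_inequality.
Context (R : realType) d (Om : measurableType d) (P : probability Om R).

Lemma Rintegral_markov (g : Om -> R) (c : R) : 0 < c ->
  measurable_fun setT g -> (forall w, 0 <= g w <= 1) ->
  (P [set w | (c <= g w)%R] <= ((\int[P]_w g w) / c)%:E)%E.
Proof.
move=> c0 mg g01.
have gK w : `|g w| <= 1 by have /andP[g0 g1] := g01 w; rewrite ger0_norm.
pose A := [set w | c <= g w].
have mA : measurable A.
  rewrite (_ : A = setT `&` g @^-1` `[c, +oo[); first exact: mg.
  by apply/seteqP; split=> w /=; rewrite in_itv/= andbT // => -[].
have lt B : measurable B -> (P B < +oo)%E := probability_lty P (D:=B).
have int B : measurable B -> P.-integrable B (EFin \o g).
  move=> mB; apply: (@bounded_integrable _ _ _ P B mB (lt _ mB) g 1) => //.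
  exact: measurable_funTS.
rewrite -[leLHS]fineK; last by rewrite ge0_fin_numE// lt.
rewrite lee_fin ler_pdivlMr// mulrC -Rintegral_cst//.
have -> : \int[P]_w g w = \int[P]_(w in A) g w + \int[P]_(w in ~` A) g w.
  rewrite -Rintegral_setU ?setUCr//; first exact: measurableC.
    exact: int.
  by apply/disj_setPS => w [].
rewrite ler_wpDr//.
  by apply: Rintegral_ge0 => w _; have /andP[] := g01 w.
apply: le_Rintegral => //; last exact: int.
by apply: (@bounded_integrable _ _ _ P A mA (lt _ mA) _ `|c|).
Qed.

End markov_inequality.

Section oscillation_events.
Context (R : realType) (V : normedModType R) d (Om : measurableType d)
  (P : probability Om R).
Variables (S : R) (S0 : 0 < S).

Section limit.
Context d' (Om' : measurableType d').
Variables (X : R -> Om -> R -> V) (Q : probability Om' R) (Y : Om' -> R -> V).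
Hypotheses (rX : forall eps : R, 0 < eps -> random_path setT S (X eps))
  (rY : random_path setT S Y) (XY : cvg_in_distribution P setT X Q Y S).

Lemma oscillation_event (J : set (R * R)) (rho zeta : R) : J !=set0 ->
  (forall st, J st -> 0 <= st.1 <= S /\ 0 <= st.2 <= S) ->
  0 < rho -> rho <= 1 -> 0 < zeta -> \int[Q]_w oscillation J (Y w) < rho * zeta ->
  \forall eps \near 0^'+, exists G, [/\ measurable G, (P (~` G) <= zeta%:E)%E &
    forall w, G w -> forall st, J st -> `|X eps w st.1 - X eps w st.2| <= rho].
Proof.
move=> J0 JS rho0 rho1 zeta0 Jlt.
have cJ := @oscillation_bounded_continuous R V J S J0 JS.
have := cvg_in_distribution_Rintegral rY XY cJ.
move=> /cvgr_lt/(_ _ Jlt); apply: filterS2 (nbhs_right_gt (0 : R)) => eps eps0 lt.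
have mo := random_path_functional (rX eps0) cJ.
exists (~` [set w | rho <= oscillation J (X eps w)]); split.
- apply: measurableC.
  rewrite (_ : [set w | _] = setT `&`
    (fun w => oscillation J (X eps w)) @^-1` `[rho, +oo[); first exact: mo.
  by apply/seteqP; split=> w /=; rewrite in_itv/= andbT // => -[].
- rewrite setCK; apply: (le_trans (Rintegral_markov _ rho0 mo _)).
    by move=> w; rewrite oscillation_ge0//= oscillation_le1.
  by rewrite lee_fin ler_pdivrMr// mulrC ltW.
- move=> w /= /negP; rewrite -ltNge => wrho st Jst.
  exact: oscillation_lt rho1 wrho Jst.
Qed.

Let window (n : nat) : set (R * R) :=
  [set st | [/\ 0 <= st.1 <= S, 0 <= st.2 <= S & `|st.1 - st.2| <= n.+1%:R^-1]].

Let window0 n : window n !=set0.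
Proof.
have S00 : 0 <= (0 : R) <= S by rewrite lexx ltW.
by exists (0, 0); split; rewrite //= subrr normr0 invr_ge0.
Qed.

Let windowS n st : window n st -> 0 <= st.1 <= S /\ 0 <= st.2 <= S.
Proof. by case. Qed.

(** A family that converges in distribution in a space of continuous paths
is asymptotically equicontinuous in probability: the mean oscillation at a given
scale converges to that of the limit, which tends to zero with the scale. *)
Lemma cvg_in_distribution_equicontinuous (rho zeta : R) : 0 < rho -> 0 < zeta ->
  exists2 delta : R, 0 < delta & \forall eps \near 0^'+,
    exists G, [/\ measurable G, (P (~` G) <= zeta%:E)%E &
    forall w, G w -> forall s t, 0 <= s <= S -> 0 <= t <= S ->
      `|s - t| <= delta -> `|X eps w s - X eps w t| <= rho].
Proof.
move=> rho0 zeta0; have [_ YC _] := rY.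
pose r := Num.min rho 1; have r0 : 0 < r by rewrite lt_min rho0 ltr01.
have cv : (fun n => \int[Q]_w oscillation (window n) (Y w)) @ \oo -->
    \int[Q]_w (fun=> 0 : R) w.
  apply: (@Rintegral_bounded_cvg _ _ _ Q setT measurableT
    (probability_lty Q measurableT) _ _ 1).
  - move=> n; apply: (random_path_functional rY).
    exact: oscillation_bounded_continuous (@windowS n).
  - exact: measurable_cst.
  - move=> n w _; rewrite ger0_norm ?oscillation_le1//; exact: oscillation_ge0.
  - apply: aeW => w _; apply/cvgrPdist_le => e e0.
    have [delta d0 Hd] := Cpath_uniformly_continuous e0 (YC w I).
    exists (Num.truncn delta^-1) => // n /= Nn.
    have nd : n.+1%:R^-1 <= delta.
      rewrite -[leRHS]invrK lef_pV2 ?posrE ?invr_gt0// ltW//.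
      by rewrite (lt_le_trans (truncnS_gt _))// ler_nat ltnS.
    rewrite sub0r normrN ger0_norm ?oscillation_ge0//.
    apply: oscillation_le => // st [s1 s2 st12]; apply: Hd => //.
    exact: le_trans nd.
rewrite Rintegral_cst// mul0r in cv.
have /cvgr_lt/(_ _ (mulr_gt0 r0 zeta0))[n _ /(_ n (leqnn n)) /= Hn] := cv.
exists n.+1%:R^-1; first by rewrite invr_gt0.
have r1 : r <= 1 by rewrite ge_min lexx orbT.
have := oscillation_event (window0 n) (@windowS n) r0 r1 zeta0 Hn.
apply: filterS => eps [G [mG PG HG]]; exists G; split=> // w Gw s t sS tS st.
rewrite (@le_trans _ _ r) ?ge_min ?lexx//.
exact: (HG w Gw (s, t)).
Qed.

End limit.

Lemma null_limit_event (X : R -> Om -> R -> V) (Q : probability Om R)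
    (theta zeta : R) :
  (forall eps : R, 0 < eps -> random_path setT S (X eps)) ->
  cvg_in_distribution P setT X Q (fun _ _ => 0) S -> 0 < theta -> theta <= 1 ->
  0 < zeta ->
  \forall eps \near 0^'+, exists G, [/\ measurable G, (P (~` G) <= zeta%:E)%E &
    forall w, G w -> forall t, 0 <= t <= S -> `|X eps w 0 - X eps w t| <= theta].
Proof.
move=> rX X0 theta0 theta1 zeta0.
have S00 : 0 <= (0 : R) <= S by rewrite lexx ltW.
pose J : set (R * R) := [set st | st.1 = 0 /\ 0 <= st.2 <= S].
have J0 : J !=set0 by exists (0, 0).
have JS st : J st -> 0 <= st.1 <= S /\ 0 <= st.2 <= S.
  by move=> [-> ?].
have rY : random_path setT S (fun (_ : Om) (_ : R) => 0 : V).
  split=> // [w _|U _].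
    apply: (@lipschitz_Cpath _ _ _ 0) => s t _ _ _.
    by rewrite subrr normr0 mul0r.
  have [U0|nU0] := pselect (U (fun=> 0)).
    rewrite (_ : [set w | _] = setT) ?setIT//.
    by apply/seteqP; split.
  rewrite (_ : [set w | _] = set0) ?setI0//.
  by apply/seteqP; split.
have := @oscillation_event _ _ X Q (fun _ _ => 0) rX rY X0 J theta zeta J0 JS
  theta0 theta1 zeta0.
have -> : \int[Q]_w oscillation J (fun=> 0 : V) = 0.
  have -> : oscillation J (fun=> 0 : V) = 0.
    apply/eqP; rewrite eq_le oscillation_ge0// andbT.
    by apply: oscillation_le => // st _; rewrite subrr normr0.
  by rewrite Rintegral_cst// mul0r.
move=> /(_ (mulr_gt0 theta0 zeta0)); apply: filterS => eps [G [mG PG HG]].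
by exists G; split=> // w Gw t tS; exact: (HG w Gw (0, t)).
Qed.

(** Up to a small probability, the paths stay in a compact set, which is
equicontinuous. *)
Lemma tight_equicontinuous (X : R -> Om -> R -> V) (eta zeta : R) :
  (forall eps : R, 0 < eps -> random_path setT S (X eps)) -> tight P X S ->
  0 < eta -> 0 < zeta ->
  exists2 delta : R, 0 < delta & forall eps : R, 0 < eps ->
    exists G, [/\ measurable G, (P (~` G) <= zeta%:E)%E &
    forall w, G w -> forall s t, 0 <= s <= S -> 0 <= t <= S ->
      `|s - t| <= delta -> `|X eps w s - X eps w t| <= eta].
Proof.
move=> rX tX eta0 zeta0; have [K [cK clK KC PK]] := tX _ zeta0.
have [delta d0 Hd] := compact_equicontinuous eta0 cK KC.
exists delta => // eps eps0; have [_ _ oX] := rX _ eps0.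
exists (~` [set w | ~ K (X eps w)]); split.
- apply: measurableC; rewrite -[X in measurable X]setTI.
  apply: (oX (~` K)) => x xC nKx.
  have /nbhs_path[e e0 He] : nbhs (x : {uniform` `[0, S] -> V}) (~` K).
    exact: (open_nbhs_nbhs (conj (closed_openC clK) nKx)).
  by exists e => // y _ xy; exact: He.
- by rewrite setCK; exact: PK.
- by move=> w /= /contrapT Kw; exact: Hd.
Qed.

End oscillation_events.

(** * Convergence on the base *)

Section time_change.
Context (R : realType) (V : normedModType R).

Variables (S S' c : R).
Hypotheses (c0 : 0 < c) (SS' : S / c <= S').

Let time_change_in (t : R) : 0 <= t <= S -> 0 <= t / c <= S'.
Proof.
move=> /andP[t0 tS]; rewrite divr_ge0 ?(ltW c0)//= (le_trans _ SS')//.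
by rewrite ler_wpM2r// invr_ge0 ltW.
Qed.

Lemma Cpath_time_change x : @Cpath R V S' x ->
  @Cpath R V S (fun t => x (t / c)).
Proof.
move=> /CpathP H; apply/CpathP => t tS eta eta0.
have [e e0 He] := H (t / c) (time_change_in tS) eta eta0.
exists (e * c) => [|s sS ts]; first exact: mulr_gt0.
apply: He; first exact: time_change_in.
rewrite -mulrBl normrM [`|c^-1|]gtr0_norm ?invr_gt0//.
by rewrite ltr_pdivrMr.
Qed.

Lemma path_close_time_change r (x y : R -> V) : path_close S' r x y ->
  path_close S r (fun t => x (t / c)) (fun t => y (t / c)).
Proof. by move=> xy t tS; apply: xy; exact: time_change_in. Qed.

Lemma lipschitz_functional_time_change (Phi : (R -> V) -> R) :
  lipschitz_functional S Phi ->
  lipschitz_functional S' (fun x => Phi (fun t => x (t / c))).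
Proof.
move=> [K [k [K0 k0 PhiK Phik]]]; exists K, k; split=> // [x xC|x y r xC yC r0 xy].
  exact/PhiK/Cpath_time_change.
apply: Phik => //; [exact: Cpath_time_change|exact: Cpath_time_change|].
exact: path_close_time_change.
Qed.

Lemma random_path_time_change dO (Om : measurableType dO) (D : set Om)
    (X : Om -> R -> V) : random_path D S' X ->
  random_path D S (fun w t => X w (t / c)).
Proof.
move=> [mD XC oX]; split=> // [w Dw|U oU]; first exact/Cpath_time_change/XC.
apply: (oX (fun x => U (fun t => x (t / c)))) => x xC Ux.
have [e e0 He] := oU _ (Cpath_time_change xC) Ux.
exists e => // y yC xy; apply: He; first exact: Cpath_time_change.
exact: path_close_time_change.
Qed.

End time_change.

Lemma probability_setU_le (R : realType) dO (Om : measurableType dO)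
    (P : probability Om R) (A B : set Om) (x y : \bar R) :
  measurable A -> measurable B -> (P A <= x)%E -> (P B <= y)%E ->
  (P (A `|` B) <= x + y)%E.
Proof.
by move=> mA mB Ax By; apply: (le_trans (measureU2 P mA mB)); exact: leeD.
Qed.

Section marginal.
Context (R : realType) dM (M : measurableType dM).

Definition fst_mfun : {mfun (M * R)%type >-> M} :=
  mfun_Sub (mem_set (@measurable_fst _ _ M R)).

Lemma Rintegral_marginal (P : probability (M * R)%type R) (psi : M -> R) (K : R) :
  measurable_fun setT psi -> (forall y, `|psi y| <= K) ->
  \int[distribution P fst_mfun]_y psi y = \int[P]_p psi p.1.
Proof.
move=> mpsi psiK; congr fine.
rewrite integral_pushforward//.
  exact/measurable_EFinP.
apply: (@bounded_integrable _ _ _ P setT measurableT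
  (probability_lty P measurableT) (fun p => psi p.1) K) => //.
exact: (measurableT_comp mpsi measurable_fst).
Qed.

(** A [mu]-null set of the base lifts to a cylinder of measure [0 * +oo = 0]. *)
Lemma marginal_dominated (mu : {sigma_finite_measure set M -> \bar R}) (tau : M -> R)
    (mtau : measurable_fun setT tau) (P : probability (M * R)%type R) :
  P `<< suspension_measure mu mtau -> distribution P fst_mfun `<< mu.
Proof.
move=> Pnu; apply/null_content_dominatesP => A mA muA.
have mfA : measurable (fst @^-1` A : set (M * R)).
  by rewrite -[X in measurable X]setTI; exact: measurable_fst.
suff H : null_set (suspension_measure mu mtau) (fst @^-1` A : set (M * R)).
  exact: (measure0_null_setP P mfA).1 (Pnu _ H).
move=> B mB BA; rewrite /suspension_measure /mrestr.
apply: (@subset_measure0 _ _ _ (mu \x (@lebesgue_measure R))%E _ (A `*` setT)).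
- by apply: measurableI => //; exact: measurable_suspension_space.
- exact: measurableX.
- by move=> p [/BA].
- apply: (etrans (product_measure1E mu (@lebesgue_measure R) mA measurableT)).
  by rewrite [X in (X * _)%E](muA : mu A = 0%E) mul0e.
Qed.

End marginal.

Section convergence.
Context (R : realType) dM (M : measurableType dM).
Variables (T : M -> M) (tau : M -> R) (tm tM taubar : R).
Hypotheses (mT : measurable_fun setT T) (mtau : measurable_fun setT tau)
  (tm0 : 0 < tm) (tau_ge : forall y, tm <= tau y) (tau_le : forall y, tau y <= tM)
  (tM0 : 0 <= tM) (taubar0 : 0 < taubar).
Local Notation D := (suspension_space tau).
Variables (d : nat) (f : R -> M * R -> 'rV[R]_d) (K L K0 K1 K2 : R).
Hypotheses (f_meas : forall i, measurable_fun ([set: R] `*` D)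
     (fun q : R * (M * R) => f q.1 q.2 0 i))
  (K_ge0 : 0 <= K) (L_ge0 : 0 <= L)
  (fK : forall y p, D p -> `|f y p| <= K)
  (fL : forall y y' p, D p -> `|f y p - f y' p| <= L * `|y - y'|).
Local Notation F := (roof_integral tau f).
Hypotheses (dF : twice_differentiable1 F) (FK0 : forall y w, `|F y w| <= K0)
  (FK1 : forall y w, `|D1 F y w| <= K1) (FK2 : forall y w, `|D1 (D1 F) y w| <= K2).
Variable a : R -> R.
Hypotheses (a_gt0 : forall eps, 0 < eps -> 0 < a eps)
  (a_cvg0 : a eps @[eps --> 0^'+] --> (0 : R))
  (eps_a_cvg0 : eps / a eps @[eps --> 0^'+] --> (0 : R)).
Variables (mubar : probability M R).
Context dO (Om : measurableType dO).
Variables (Q : probability Om R) (v : Om -> R -> 'rV[R]_d).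
Hypotheses (v_process : continuous_process v)
  (slow_cvg : forall S', 0 < S' ->
     cvg_in_distribution mubar [set: M] (slow_process T taubar a F) Q v S')
  (slow_tight : forall S', 0 < S' ->
     tight mubar (slow_process T taubar a (D1 F)) S')
  (roof_cvg : forall S', 0 < S' ->
     cvg_in_distribution mubar [set: M] (roof_process T tau taubar a)
       mubar (fun _ _ => 0) S').
Variables (S : R) (S0 : 0 < S).

Let mF i : measurable_fun setT (fun q : R * M => F q.1 q.2 0 i).
Proof. exact: (measurable_roof_integral mtau f_meas). Qed.

Let mD1F i : measurable_fun setT (fun q : R * M => D1 F q.1 q.2 0 i).
Proof. by apply: measurable_D1 => // w y; have [] := dF w y. Qed.

Let rF S' eps : 0 < S' -> 0 < eps ->
  random_path setT S' (slow_process T taubar a F eps).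
Proof.
by move=> S'0 eps0; apply: (random_path_slow taubar mT eps0 (a_gt0 eps0) S'0 mF FK0).
Qed.

Let rD1F S' eps : 0 < S' -> 0 < eps ->
  random_path setT S' (slow_process T taubar a (D1 F) eps).
Proof.
by move=> S'0 eps0; apply: (random_path_slow taubar mT eps0 (a_gt0 eps0) S'0 mD1F FK1).
Qed.

Let rz S' eps : 0 < S' -> 0 < eps ->
  random_path setT S' (roof_process T tau taubar a eps).
Proof. by move=> S'0 eps0; exact: (random_path_roof mT mtau tm0 tau_ge tau_le tM0 taubar0 a eps0 S'0). Qed.

Let rv S' c : 0 < S' -> 0 < c -> random_path setT S' (fun w t => v w (t / c)).
Proof. by move=> S'0 c0; exact: random_path_continuous_process. Qed.

(** The small parameters are chosen in turn: [theta] and [eta] so that the terms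
they control in [flow_slow_close] are at most [zeta / 8] each, then the
oscillation scales [delta] and [delta'] of the two slow processes for these
levels, and [eps] last, which makes the terms with a factor [a eps] or [be eps]
vanish. *)
Lemma flow_slow_close_in_probability (zeta : R) : 0 < zeta ->
  \forall eps \near 0^'+, exists G, [/\ measurable G, (mubar (~` G) <= zeta%:E)%E &
    forall w, G w -> path_close S zeta (flow_process T tau a f eps (w, 0))
      (fun t => slow_process T taubar a F eps w (t / taubar))].
Proof.
move=> zeta0.
have [y0 _] : [set: M] !=set0.
  apply/set0P/eqP => M0; have := probability_setT mubar; rewrite M0 measure0.
  by move=> /eqP; rewrite lt_eqF ?lte01.
have K1_ge0 : 0 <= K1 by rewrite (le_trans _ (FK1 0 y0)).
have K2_ge0 : 0 <= K2 by rewrite (le_trans _ (FK2 0 y0)).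
pose S1 := S / tm; have S1_gt0 : 0 < S1 by rewrite divr_gt0.
pose S' := Num.max (S1 + 1) (S / taubar).
have S'0 : 0 < S' by rewrite lt_max addr_gt0.
have SS'1 : S1 + 1 <= S' by rewrite le_max lexx.
have SS'2 : S / taubar <= S' by rewrite le_max lexx orbT.
pose C2 := S1 * K2; have C2_ge0 : 0 <= C2 by rewrite mulr_ge0// ltW.
pose C5 := S1 * (tM + taubar).
have C5_ge0 : 0 <= C5 by rewrite mulr_ge0 ?addr_ge0 ?(ltW S1_gt0) ?(ltW taubar0).
pose theta := Num.min 1 (zeta / (8 * (C2 + 1))).
have theta0 : 0 < theta by rewrite lt_min ltr01 divr_gt0// mulr_gt0// ltr_wpDl.
have theta1 : theta <= 1 by rewrite ge_min lexx.
have C2theta : C2 * theta ^+ 2 <= zeta / 8.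
  have th : theta <= zeta / (8 * (C2 + 1)) by rewrite ge_min lexx orbT.
  apply: (@le_trans _ _ (C2 * theta)).
    by rewrite ler_wpM2l// expr2 ler_piMr// ltW.
  apply: (@le_trans _ _ ((C2 + 1) * theta)).
    by rewrite ler_wpM2r ?(ltW theta0)// lerDl.
  rewrite mulrC -ler_pdivlMr ?ltr_wpDl//.
  by rewrite -mulrA -invfM.
pose eta := zeta / (8 * (C5 + 1)).
have eta0 : 0 < eta by rewrite divr_gt0// mulr_gt0// ltr_wpDl.
have C5eta : eta * C5 <= zeta / 8.
  apply: (@le_trans _ _ (eta * (C5 + 1))).
    by rewrite ler_wpM2l ?(ltW eta0)// lerDl.
  rewrite /eta invfM mulrA -[leLHS]mulrA mulVf ?mulr1//.
  by rewrite gt_eqF// ltr_wpDl.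
have z4 : 0 < zeta / 4 by rewrite divr_gt0.
have z8 : 0 < zeta / 8 by rewrite divr_gt0.
have [delta0 d00 Hd] := tight_equicontinuous (fun eps => rD1F S'0 (eps:=eps))
  (slow_tight S'0) eta0 z4.
pose delta := Num.min delta0 1.
have d0 : 0 < delta by rewrite lt_min d00 ltr01.
have delta1 : delta <= 1 by rewrite ge_min lexx orbT.
have rv1 : random_path setT S' v.
  have := rv S'0 (@ltr01 R); congr random_path.
  by apply/funext => w; apply/funext => t; rewrite divr1.
have [delta' d'0 Hv] := cvg_in_distribution_equicontinuous S'0
  (fun eps => rF S'0 (eps:=eps)) rv1 (slow_cvg S'0) z8 z4.
have Hz := null_limit_event S'0 (fun eps => rz S'0 (eps:=eps)) (roof_cvg S'0)
  theta0 theta1 z4.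
pose be eps := Num.sqrt (eps / a eps) * theta.
have cbe : be eps @[eps --> 0^'+] --> 0.
  rewrite -[X in _ --> X](mul0r theta); apply: cvgM; last exact: cvg_cst.
  rewrite -[X in _ --> X](@sqrtr0 R).
  exact: (cvg_comp _ _ eps_a_cvg0 (@sqrt_continuous R 0)).
have ceps : eps @[eps --> 0^'+] --> (0 : R).
  exact: cvg_at_right_filter.
pose bound eps := a eps * (K * tM + S1 * (L * tM ^+ 2) + S1 * (K1 * taubar)) +
     S1 * (K2 * theta ^+ 2) +
     (eta + 2 * (a eps * S' * (K2 * taubar))) *
      (2 * S1 * be eps / delta + 2 * be eps + S1 * (tM + taubar)) + zeta / 8.
have cbound : bound eps @[eps --> 0^'+] -->
     0 * (K * tM + S1 * (L * tM ^+ 2) + S1 * (K1 * taubar)) +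
     S1 * (K2 * theta ^+ 2) +
     (eta + 2 * (0 * S' * (K2 * taubar))) *
      (2 * S1 * 0 / delta + 2 * 0 + S1 * (tM + taubar)) + zeta / 8.
  have cscale c : a eps * c @[eps --> 0^'+] --> 0 * c.
    by apply: cvgM; [exact: a_cvg0|exact: cvg_cst].
  apply: cvgD; last exact: cvg_cst.
  apply: cvgD; first by apply: cvgD; [exact: cscale|exact: cvg_cst].
  apply: cvgM.
    apply: cvgD; first exact: cvg_cst.
    apply: cvgM; first exact: cvg_cst.
    by apply: cvgM; [exact: cscale|exact: cvg_cst].
  apply: cvgD; last exact: cvg_cst.
  apply: cvgD; last by apply: cvgM; [exact: cvg_cst|exact: cbe].
  apply: cvgM; last exact: cvg_cst.
  by apply: cvgM; [exact: cvg_cst|exact: cbe].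
have bound_lt : 0 * (K * tM + S1 * (L * tM ^+ 2) + S1 * (K1 * taubar)) +
     S1 * (K2 * theta ^+ 2) +
     (eta + 2 * (0 * S' * (K2 * taubar))) *
      (2 * S1 * 0 / delta + 2 * 0 + S1 * (tM + taubar)) + zeta / 8 < zeta.
  rewrite !(mul0r, mulr0, add0r, addr0) [S1 * (K2 * _)]mulrA -/C2 -/C5.
  by move: C2theta C5eta z8 zeta0; lra.
have csmall : (eps * tM + be eps) / taubar @[eps --> 0^'+] --> (0 * tM + 0) / taubar.
  apply: cvgM; last exact: cvg_cst.
  apply: cvgD; last exact: cbe.
  by apply: cvgM; [exact: ceps|exact: cvg_cst].
have small_lt : (0 * tM + 0) / taubar < delta' by rewrite mul0r addr0 mul0r.
have nbound := cvgr_lt _ cbound _ bound_lt.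
have nsmall := cvgr_lt _ csmall _ small_lt.
have neps := cvgr_lt _ ceps _ d0.
near=> eps.
have eps0 : 0 < eps by near: eps; exact: nbhs_right_gt.
have [Gd [mGd PGd HGd]] := Hd eps eps0.
have [Gv [mGv PGv HGv]] : exists G, [/\ measurable G,
    (mubar (~` G) <= (zeta / 4)%:E)%E &
    forall w, G w -> forall s t, 0 <= s <= S' -> 0 <= t <= S' ->
      `|s - t| <= delta' -> `|slow_process T taubar a F eps w s -
         slow_process T taubar a F eps w t| <= zeta / 8] by near: eps.
have [Gz [mGz PGz HGz]] : exists G, [/\ measurable G,
    (mubar (~` G) <= (zeta / 4)%:E)%E &
    forall w, G w -> forall t, 0 <= t <= S' ->
      `|roof_process T tau taubar a eps w 0 - roof_process T tau taubar a eps w t|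
        <= theta] by near: eps.
exists (Gd `&` Gv `&` Gz); split.
- by apply: measurableI => //; exact: measurableI.
- rewrite !setCI.
  have [mGdC mGvC mGzC] : [/\ measurable (~` Gd), measurable (~` Gv) &
      measurable (~` Gz)] by split; exact: measurableC.
  apply: (@le_trans _ _ ((zeta / 4)%:E + (zeta / 4)%:E + (zeta / 4)%:E)%E).
    apply: (probability_setU_le (measurableU _ _ mGdC mGvC) mGzC _ PGz).
    exact: (probability_setU_le mGdC mGvC PGd PGv).
  rewrite -!EFinD lee_fin.
  have -> : zeta / 4 + zeta / 4 + zeta / 4 = zeta - zeta / 4 by field.
  by rewrite lerBlDr lerDl ltW.
move=> w [[Gdw Gvw] Gzw].
have roof0 : roof_process T tau taubar a eps w 0 = 0.
  by have := roof_process_grid mT mtau tm0 tau_ge tau_le tM0 taubar0 a w 0 eps0;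
     rewrite mulr0 return_time0 mul0r subrr mulr0.
have H := @flow_slow_close R _ M d T tau tm tM taubar mT mtau tm0 tau_ge tau_le
  tM0 taubar0 f K L K0 K1 K2 f_meas K_ge0 L_ge0 fK fL dF FK0 FK1 FK2 a eps S S'
  theta delta eta (zeta / 8) delta' w eps0 (a_gt0 eps0) S0 SS'1 SS'2 (ltW theta0).
have ed : eps <= delta by rewrite ltW//; near: eps.
have ds : (eps * tM + be eps) / taubar <= delta' by rewrite ltW//; near: eps; exact: nsmall.
have bz : bound eps <= zeta by rewrite ltW//; near: eps; exact: nbound.
move=> t tS; apply: le_trans bz; apply: H => //.
- exact: ltW.
- move=> k kS; have := HGz w Gzw (eps * k%:R); rewrite roof0 sub0r normrN.
  by apply; rewrite kS mulr_ge0// ltW.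
- move=> s s' sS s'S ss'; apply: (HGd w Gdw) => //.
  by rewrite (le_trans ss')// ge_min lexx.
- by move=> s s' sS s'S ss'; exact: (HGv w Gvw).
Unshelve. all: by end_near. Qed.

(** The slow process converges by assumption, the change of time [t / taubar] is
continuous for the uniform distance, and the flow integrals are close in
probability to the slow process so changed. *)
Lemma flow_base_cvg Phi : lipschitz_functional S Phi ->
  (\int[mubar]_w Phi (flow_process T tau a f eps (w, 0))) @[eps --> 0^'+] -->
  \int[Q]_w Phi (fun t => v w (t / taubar)).
Proof.
move=> lPhi; have [Kp [k [Kp0 k0 PhiK Phik]]] := lPhi.
have cPhi := lipschitz_functional_continuous lPhi.
have St0 : 0 < S / taubar by rewrite divr_gt0.
have rv1 : random_path setT (S / taubar) v.
  have := rv St0 (@ltr01 R); congr random_path.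
  by apply/funext => w; apply/funext => t; rewrite divr1.
have cv := cvg_in_distribution_Rintegral rv1 (slow_cvg St0)
  (lipschitz_functional_continuous
    (lipschitz_functional_time_change taubar0 (lexx _) lPhi)).
apply/cvgrPdist_le => e e0.
pose zeta := e / (2 * (k + 2 * Kp + 1)).
have C0 : 0 < k + 2 * Kp + 1 by rewrite ltr_wpDl// addr_ge0// mulr_ge0.
have zeta0 : 0 < zeta by rewrite divr_gt0// mulr_gt0.
have zetae : k * zeta + 2 * Kp * zeta <= e / 2.
  rewrite -mulrDl; apply: (@le_trans _ _ ((k + 2 * Kp + 1) * zeta)).
    by rewrite ler_wpM2r ?(ltW zeta0)// lerDl.
  by rewrite /zeta le_eqVlt; apply/orP; left; apply/eqP; field; rewrite gt_eqF.
have e20 : 0 < e / 2 by rewrite divr_gt0.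
have /cvgrPdist_le/(_ _ e20) := cv.
apply: filterS3 (flow_slow_close_in_probability zeta0) (nbhs_right_gt (0 : R)).
move=> eps [G [mG PG HG]] eps0 h1.
have rf := random_path_flow_base mT mtau tm0 tau_ge eps0 (a_gt0 eps0) S0
  f_meas K_ge0 fK.
have rs : random_path setT S (fun w t => slow_process T taubar a F eps w (t / taubar)).
  exact: random_path_time_change taubar0 (lexx _) _ _ _ _ (rF St0 eps0).
have mTG : setT `\` G = ~` G by rewrite setTD.
have := @Rintegral_lipschitz_close R _ _ M mubar setT S _ _ G Phi Kp k zeta zeta
  rf rs cPhi PhiK Kp0 k0 (ltW zeta0) Phik mG.
rewrite mTG => /(_ PG (fun w _ => HG w)) h2.
apply: (le_trans (ler_distD (\int[mubar]_w
  Phi (fun t => slow_process T taubar a F eps w (t / taubar))) _ _)).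
rewrite (splitr e); apply: lerD; first exact: h1.
rewrite distrC; exact: le_trans h2 zetae.
Qed.

End convergence.

(** * From the base to the suspension *)

Section suspension_marginal.
Context (R : realType) dM (M : measurableType dM).
Variables (mu : {sigma_finite_measure set M -> \bar R}) (tau : M -> R)
    (mtau : measurable_fun setT tau) (P : probability (M * R)%type R).
Hypothesis Pnu : P `<< suspension_measure mu mtau.
Local Notation D := (suspension_space tau).

Lemma suspension_space_full : P (~` D) = 0%E.
Proof.
have mD : measurable D by exact: measurable_suspension_space.
have mDC : measurable (~` D) by exact: measurableC.
suff H : null_set (suspension_measure mu mtau) (~` D).
  exact: (measure0_null_setP P mDC).1 (Pnu H).
move=> B mB BD; rewrite /suspension_measure /mrestr (_ : B `&` D = set0).
  exact: measure0.
by apply/seteqP; split=> // p [/BD].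
Qed.

Lemma Rintegral_suspension_space (g : M * R -> R) (K : R) :
  measurable_fun setT g -> (forall p, `|g p| <= K) ->
  \int[P]_p g p = \int[P]_(p in D) g p.
Proof.
move=> mg gK.
have mD : measurable D by exact: measurable_suspension_space.
have mDC : measurable (~` D) by exact: measurableC.
rewrite -(setUv D) Rintegral_setU//; last 2 first.
- rewrite setUv; apply: (@bounded_integrable _ _ _ P setT measurableT
    (probability_lty P measurableT) g K) => //.
- by apply/disj_setPS => p [].
have := @normr_Rintegral_le _ _ _ P _ mDC (probability_lty P mDC) g K
  (measurable_funTS mg) (fun p _ => gK p).
have -> : fine (P (~` D)) = 0 by rewrite suspension_space_full.
by rewrite mulr0 normr_le0 => /eqP ->; rewrite addr0.
Qed.

End suspension_marginal.

Theorem corollary5p5 (R : realType)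
  (dM : measure_display) (M : measurableType dM)
  (mu : {sigma_finite_measure set M -> \bar R}) (T : M -> M)
  (T_mp : measure_preserving mu T)
  (T_cons : conservative mu T)
  (T_erg : ergodic mu T)
  (mu_infinite : mu [set: M] = +oo%E)
  (tau : M -> R) (tau_meas : measurable_fun [set: M] tau)
  (tau_gt0 : forall y, 0 < tau y)
  (tau_inf : (0 < ereal_inf [set (tau y)%:E | y in [set: M]])%E)
  (tau_sup : (ereal_sup [set (tau y)%:E | y in [set: M]] < +oo)%E)
  (d : nat) (f : R -> M * R -> 'rV[R]_d)
  (f_meas : forall i, measurable_fun ([set: R] `*` suspension_space tau)
     (fun q : R * (M * R) => f q.1 q.2 0 i))
  (f_bounded : exists K : R, forall y p, suspension_space tau p ->
     `|f y p| <= K)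
  (f_lipschitz : exists L : R, forall y y' p, suspension_space tau p ->
     `|f y p - f y' p| <= L * `|y - y'|)
  (taubar : R) (taubar_gt0 : 0 < taubar)
  (mubar : probability M R) (mubar_ac : mubar `<< mu)
  (a : R -> R) (a_gt0 : forall eps, 0 < eps -> 0 < a eps)
  (a_cvg0 : a eps @[eps --> 0^'+] --> (0 : R))
  (eps_a_cvg0 : eps / a eps @[eps --> 0^'+] --> (0 : R))
  (dO : measure_display) (Om : measurableType dO) (Q : probability Om R)
  (v : Om -> R -> 'rV[R]_d) (v_process : continuous_process v) :
  let F := roof_integral tau f in
  twice_differentiable1 F ->
  uniformly_bounded F ->
  uniformly_bounded (D1 F) ->
  uniformly_bounded (D1 (D1 F)) ->
  (forall S', 0 < S' ->
     cvg_in_distribution mubar [set: M] (slow_process T taubar a F) Q v S') ->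
  (forall S', 0 < S' ->
     tight mubar (slow_process T taubar a (D1 F)) S') ->
  (forall S', 0 < S' ->
     cvg_in_probability_unif mubar
       (fun eps w t => eps * (return_count T tau (t / eps) w)%:R)
       (fun t => t / taubar) S') ->
  (forall S', 0 < S' ->
     cvg_in_distribution mubar [set: M] (roof_process T tau taubar a)
       mubar (fun _ _ => 0) S') ->
  forall S, 0 < S ->
    strong_cvg_in_distribution (suspension_measure mu tau_meas)
      (suspension_space tau) (flow_process T tau a f)
      Q (fun w t => v w (t / taubar)) S.
Proof.
move=> F dF [K0 FK0] [K1 FK1] [K2 FK2] slow_cvg slow_tight _ roof_cvg S S0 P Pnu.
have [mT _] := T_mp.
have [y0 _] : [set: M] !=set0.
  by apply/set0P/eqP => M0; move: mu_infinite; rewrite M0 measure0.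
have [tm tm0 tau_ge] : exists2 tm : R, 0 < tm & forall y, tm <= tau y.
  have inf_le y : (ereal_inf [set (tau y)%:E | y in [set: M]] <= (tau y)%:E)%E.
    by apply: ereal_inf_lbound; exists y.
  have inf_fin : ereal_inf [set (tau y)%:E | y in [set: M]] \is a fin_num.
    by rewrite gt0_fin_numE// (le_lt_trans (inf_le y0))// ltry.
  exists (fine (ereal_inf [set (tau y)%:E | y in [set: M]])).
    by rewrite -lte_fin fineK.
  by move=> y; rewrite -lee_fin fineK.
have [tM tau_le] : exists tM : R, forall y, tau y <= tM.
  have sup_ge y : ((tau y)%:E <= ereal_sup [set (tau y)%:E | y in [set: M]])%E.
    by apply: ereal_sup_ubound; exists y.
  exists (fine (ereal_sup [set (tau y)%:E | y in [set: M]])) => y.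
  rewrite -lee_fin fineK// fin_numElt tau_sup andbT.
  by rewrite (lt_le_trans _ (sup_ge y))// ltNyr.
have tM0 : 0 <= tM by rewrite (le_trans (ltW tm0))// (le_trans (tau_ge y0)).
have [K K_ge0 fK] : exists2 K : R, 0 <= K &
    forall y p, suspension_space tau p -> `|f y p| <= K.
  have [K fK] := f_bounded; exists `|K| => // y p Dp.
  by rewrite (le_trans (fK y p Dp))// ler_norm.
have [L L_ge0 fL] : exists2 L : R, 0 <= L & forall y y' p,
    suspension_space tau p -> `|f y p - f y' p| <= L * `|y - y'|.
  have [L fL] := f_lipschitz; exists `|L| => // y y' p Dp.
  by rewrite (le_trans (fL y y' p Dp))// ler_wpM2r// ler_norm.
have rX (eps : R) : 0 < eps ->
    random_path (suspension_space tau) S (flow_process T tau a f eps).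
  move=> eps0.
  exact: (random_path_flow mT tau_meas tm0 tau_ge eps0 (a_gt0 eps eps0) S0
    f_meas K_ge0 fK).
have rX0 (eps : R) : 0 < eps ->
    random_path setT S (fun y => flow_process T tau a f eps (y, 0)).
  move=> eps0.
  exact: (random_path_flow_base mT tau_meas tm0 tau_ge eps0 (a_gt0 eps eps0) S0
    f_meas K_ge0 fK).
have rY : random_path setT S (fun w t => v w (t / taubar)).
  exact: random_path_continuous_process.
apply: (lipschitz_cvg_in_distribution rX rY) => Phi lPhi.
have [Kp [k [Kp0 k0 PhiK Phik]]] := lPhi.
have cPhi := lipschitz_functional_continuous lPhi.
have base := flow_base_cvg mT tau_meas tm0 tau_ge tau_le tM0 taubar_gt0 f_meas
  K_ge0 L_ge0 fK fL dF FK0 FK1 FK2 a_gt0 a_cvg0 eps_a_cvg0 v_process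
  slow_cvg slow_tight roof_cvg S0 lPhi.
pose psi eps y := Phi (flow_process T tau a f eps (y, 0)).
have mpsi eps : 0 < eps -> measurable_fun setT (psi eps).
  by move=> eps0; exact: random_path_functional (rX0 eps eps0) cPhi.
have psiK eps y : 0 < eps -> `|psi eps y| <= Kp.
  by move=> eps0; have [_ C _] := rX0 eps eps0; exact/PhiK/C.
pose C := (L * S + 2 * K) * tM.
have C_ge0 : 0 <= C by rewrite mulr_ge0// addr_ge0// mulr_ge0// ltW.
have small (delta : R) : 0 < delta -> \forall eps \near 0^'+, k * (a eps * C) <= delta.
  move=> d0.
  have : k * (a eps * C) @[eps --> 0^'+] --> k * (0 * C).
    by apply: cvgM; [exact: cvg_cst|apply: cvgM => //; exact: cvg_cst].
  rewrite mul0r mulr0 => /cvgr_lt/(_ _ d0); apply: filterS => eps; exact: ltW.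
have psiT (delta : R) : 0 < delta -> \forall eps \near 0^'+,
    forall y, `|psi eps (T y) - psi eps y| <= delta.
  move=> /small; apply: filterS2 (nbhs_right_gt (0 : R)) => eps eps0 le y.
  have [_ XC _] := rX0 eps eps0; apply: le_trans le.
  apply: Phik; [exact: XC|exact: XC|by rewrite mulr_ge0// ltW// a_gt0|].
  exact: (flow_process_base mT tau_meas tm0 tau_ge tau_le eps0 (a_gt0 eps eps0)
    f_meas K_ge0 L_ge0 fK fL).
have P1mu := marginal_dominated Pnu.
(* The law of the base point can now be changed from [mubar] to the marginal
   of [P]. *)
have marg := asymptotically_invariant_means T_erg mubar_ac P1mu mpsi psiK psiT base.
apply/cvgrPdist_le => e e0; have e20 : 0 < e / 2 by rewrite divr_gt0.
have /cvgrPdist_le/(_ _ e20) := marg.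
apply: filterS3 (small _ e20) (nbhs_right_gt (0 : R)) => eps le eps0.
rewrite (Rintegral_marginal P (mpsi eps eps0) (fun y => psiK eps y eps0)).
have mpsi1 : measurable_fun setT (fun p : M * R => psi eps p.1).
  exact: (measurableT_comp (mpsi eps eps0) measurable_fst).
rewrite (Rintegral_suspension_space Pnu mpsi1 (fun p => psiK eps p.1 eps0)).
move=> h1; rewrite (splitr e).
apply: (le_trans (ler_distD (\int[P]_(p in suspension_space tau) psi eps p.1) _ _)).
apply: lerD; first exact: h1.
have mD := measurable_suspension_space tau_meas.
have [_ XC _] := rX eps eps0; have [_ XC0 _] := rX0 eps eps0.
apply: (@le_trans _ _ (e / 2 * fine (P (suspension_space tau)))); last first.
  rewrite ler_piMr ?(ltW e20)// -lee_fin fineK ?probability_le1//.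
  by rewrite ge0_fin_numE// probability_lty.
apply: (Rintegral_close mD (probability_lty P mD) (K := Kp)).
- exact: measurable_funTS.
- exact: random_path_functional (rX eps eps0) cPhi.
- by move=> p _; exact: psiK.
- by move=> p Dp; exact/PhiK/XC.
- move=> p Dp; apply: le_trans le; rewrite distrC.
  apply: Phik; [exact: XC|exact: XC0|by rewrite mulr_ge0// ltW// a_gt0|].
  exact: (flow_process_height mT tau_meas tm0 tau_ge tau_le eps0 (a_gt0 eps eps0)
    f_meas K_ge0 L_ge0 fK fL).
Qed.
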